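(* Assume conditions (A1), (A2)', (A3), (A4)' and (A5) listed in the context, and let $(s,u)$ be a solution of $(\mathrm{P})_{u_0,s_0,b}$ on $[0,\infty)$. Put $r_*:=a+H(b^* )^{-1}|u_0|_{L^1(a,s_0)}$. Then either of the following holds: (i) $\displaystyle\lim_{t\to\infty}\int_0^t\beta(b(\tau)-Hu(\tau,a))\,d\tau=\infty$ and $\displaystyle\lim_{t\to\infty}s(t)=\infty$; (ii) $\displaystyle\lim_{t\to\infty}\int_0^t\beta(b(\tau)-Hu(\tau,a))\,d\tau\le\frac{b^*}{H}(r_\varphi-r_* )$ and $\displaystyle\limsup_{t\to\infty}s(t)\le a+\frac{1}{\varphi(a)}\frac{b^*}{H}(s_0-a+r_\varphi-r_* )$.
   Context: Assumptions: (A1) $a,a_0,H,k$ are positive constants. (A2)' $b\in W^{1,2}_{loc}([0,\infty))$, $b_t\in L^1(0,\infty)$, $\lim_{t\to\infty}b(t)=b_\infty$, $b-b_\infty\in L^1(0,\infty)$, and $b_*\le b\le b^*$ on $(0,\infty)$, where $b_*,b^*$ are positive constants. (A3) $\beta\in C^1(\mathbb{R})\cap W^{1,\infty}(\mathbb{R})$, $\beta=0$ on $(-\infty,0]$, and there exists $r_\beta>0$ such that $\beta'>0$ on $(0,r_\beta)$ and $\beta=k_0$ on $[r_\beta,+\infty)$, where $k_0$ is a positive constant. (A4)' $\varphi\in C^1(\mathbb{R})\cap W^{1,\infty}(\mathbb{R})$, $\varphi=0$ on $(-\infty,0]$, and there exists $r_\varphi>0$ such that $\varphi'>0$ on $(0,r_\varphi)$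 and $\varphi=c_0$ on $[r_\varphi,+\infty)$, where $c_0$ is a positive constant satisfying $0<c_0<\min\{2\varphi(a),\,b_*H^{-1}\}$. (A5) $a<s_0<r_\varphi$, and $u_0\in H^1(a,s_0)$ with $\varphi(a)\le u_0\le b^*H^{-1}$ on $[a,s_0]$. For $T>0$ and a function $s$ with $s>a$, put $Q_s(T)=\{(t,z): 0<t<T,\ a<z<s(t)\}$. Problem $(\mathrm{P})_{u_0,s_0,b}$ and its solutions: a pair $(s,u)$, with $s$ a function on $[0,T]$ and $u$ a function on $Q_s(T)$, is a solution to $(\mathrm{P})_{u_0,s_0,b}$ on $[0,T]$ if (S1) $s,s_t\in L^\infty(0,T)$, $a<s$ on $[0,T]$, $u\in L^\infty(Q_s(T))$, $u_t,u_{zz}\in L^2(Q_s(T))$, and $t\in[0,T]\mapsto |u_z(t,\cdot)|_{L^2(a,s(t))}$ is bounded; (S2) $u_t-ku_{zz}=0$ a.e. on $Q_s(T)$; (S3) $-ku_z(t,a)=\beta(b(t)-Hu(t,a))$ for a.e. $t\in(0,T)$; (S4) $-ku_z(t,s(t))=u(t,s(t))s_t(t)$ for a.e. $t\in(0,T)$; (S5) $s_t(t)=a_0(u(t,s(t))-\varphi(s(t)))$ for a.e. $t\in(0,T)$; (S6) $s(0)=s_0$ and $u(0,z)=u_0(z)$ for $z\in[a,s_0]$. A solution on $[0,\infty)$ is a pair $(s,u)$ whose restriction to $[0,T]$ is a solution on $[0,T]$ for every $T>0$. *)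

(* Defs.v *)
From HB Require Import structures.
From mathcomp Require Import all_boot all_order all_algebra.
From mathcomp Require Import all_classical all_reals all_analysis.

Set Implicit Arguments.
Unset Strict Implicit.
Unset Printing Implicit Defensive.

Import Order.TTheory GRing.Theory Num.Theory.
Import numFieldNormedType.Exports.

Local Open Scope classical_set_scope.
Local Open Scope ring_scope.

Notation leb1 R := (@lebesgue_measure R).
Notation leb2 R := (@lebesgue_measure R \x @lebesgue_measure R)%E.

Definition in_Lp d (X : measurableType d) (R : realType)
    (mu : {measure set X -> \bar R}) (p : \bar R) (D : set X) (f : X -> R) :
    Prop :=
  (f \_ D) \in Lfun mu p.

(* C^oo on V (finite-dimensional in all uses): iterated directional
   derivatives of all orders exist and are continuous. *)
Definition smooth (R : realType) (V : normedModType R) (phi : V -> R) : Prop :=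
  forall vs : seq V, let g := foldr (fun v h => 'D_v h) phi vs in
    continuous g /\ forall x v, derivable g x v.

Definition test_function (R : realType) (V : normedModType R) (Om : set V)
    (phi : V -> R) : Prop :=
  let supp := closure [set x | phi x != 0] in
  [/\ smooth phi, compact supp & supp `<=` Om].

(* [weak_deriv1 I f g] and [weak_deriv2 Om v f g]: g is the distributional
   derivative of f (in the direction v).  They only carry their usual meaning
   for f and g locally integrable on the open set I, resp. Om. *)
Definition weak_deriv1 (R : realType) (I : set R) (f g : R -> R) : Prop :=
  forall phi : R -> R, test_function I phi ->
    \int[leb1 R]_(x in I) (f x * 'D_1 phi x) =
    - \int[leb1 R]_(x in I) (g x * phi x).

Definition weak_deriv2 (R : realType) (Om : set (R * R)) (v : R * R)
    (f g : R * R -> R) : Prop :=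
  forall phi : R * R -> R, test_function Om phi ->
    \int[leb2 R]_(x in Om) (f x * 'D_v phi x) =
    - \int[leb2 R]_(x in Om) (g x * phi x).

(* f belongs to W^{1,p}(I), with weak derivative g. *)
Definition in_W1p (R : realType) (p : \bar R) (I : set R) (f g : R -> R) :
    Prop :=
  [/\ in_Lp (leb1 R) p I f, in_Lp (leb1 R) p I g & weak_deriv1 I f g].

(* A Sobolev function on an interval is identified with its continuous
   representative, here up to the end points. *)
Definition in_H1_itv (R : realType) (c d : R) (f : R -> R) : Prop :=
  {within `[c, d], continuous f} /\ exists g, in_W1p 2%:E `]c, d[ f g.

(* Here b is the continuous representative on [0, oo). *)
Definition cond_b (R : realType) (blow bup binf : R) (b : R -> R) : Prop :=
  [/\ {within `[0, +oo[, continuous b},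
      exists bt : R -> R,
        (forall T, 0 < T -> in_W1p 2%:E `]0, T[ b bt) /\
        in_Lp (leb1 R) 1 `]0, +oo[ bt,
      b t @[t --> +oo] --> binf,
      in_Lp (leb1 R) 1 `]0, +oo[ (fun t => b t - binf) &
      0 < blow /\ 0 < bup /\ forall t, 0 < t -> blow <= b t <= bup].

(* C^1(R) \cap W^{1,oo}(R): for a C^1 function the weak derivative is the
   classical one. *)
Definition C1_W1oo (R : realType) (f : R -> R) : Prop :=
  [/\ forall x, derivable f x 1, continuous (derive1 f),
      in_Lp (leb1 R) +oo setT f & in_Lp (leb1 R) +oo setT (derive1 f)].

(* The structural condition shared by beta (r = r_beta, c = k_0) and
   varphi (r = r_varphi, c = c_0). *)
Definition cond_saturating (R : realType) (r c : R) (f : R -> R) : Prop :=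
  [/\ C1_W1oo f,
      forall x, x <= 0 -> f x = 0,
      0 < r /\ 0 < c,
      forall x, 0 < x < r -> 0 < derive1 f x &
      forall x, r <= x -> f x = c].

Definition Qdom (R : realType) (a : R) (s : R -> R) (T : R) : set (R * R) :=
  [set p | 0 < p.1 < T /\ a < p.2 < s p.1].

Definition Qdom_closed (R : realType) (a : R) (s : R -> R) (T : R) :
    set (R * R) :=
  [set p | 0 <= p.1 <= T /\ a <= p.2 <= s p.1].

(* Points of the plane are (t, z).  The regularity required of a solution makes
   s continuous on [0, T] and u continuous up to the boundary of Q_s(T), and,
   for a.e. t, makes u_z(t, .) an H^1(a, s(t)) function; s, u and u_z denote
   the corresponding continuous representatives, whose values are the traces
   in the boundary and initial conditions. *)
Record solution_with (R : realType) (a a0 H k : R) (beta varphi b : R -> R)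
    (s0 : R) (u0 : R -> R) (T : R) (s : R -> R) (u : R * R -> R)
    (st : R -> R) (ut uz uzz : R * R -> R) : Prop := SolutionWith {
  sol_s_cont : {within `[0, T], continuous s} ;
  sol_s_W1oo : in_W1p +oo `]0, T[ s st ;
  sol_s_gt : forall t, 0 <= t <= T -> a < s t ;
  sol_u_cont : {within Qdom_closed a s T, continuous u} ;
  sol_u_Loo : in_Lp (leb2 R) +oo (Qdom a s T) u ;
  sol_ut : weak_deriv2 (Qdom a s T) (1, 0) u ut ;
  sol_ut_L2 : in_Lp (leb2 R) 2%:E (Qdom a s T) ut ;
  (* implied by [sol_uz_bounded] up to joint measurability *)
  sol_uz_L2 : in_Lp (leb2 R) 2%:E (Qdom a s T) uz ;
  sol_uz : weak_deriv2 (Qdom a s T) (0, 1) u uz ;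
  sol_uz_slice : forall t, 0 <= t <= T ->
    in_W1p 2%:E `]a, s t[ (fun z => u (t, z)) (fun z => uz (t, z)) ;
  sol_uz_bounded : exists C : R, forall t, 0 <= t <= T ->
    (Lnorm (leb1 R) 2%:E (EFin \o ((fun z => uz (t, z)) \_ `]a, s t[))
      <= C%:E)%E ;
  sol_uz_cont : {ae leb1 R, forall t, 0 < t < T ->
    {within `[a, s t], continuous (fun z => uz (t, z))}} ;
  sol_uzz : weak_deriv2 (Qdom a s T) (0, 1) uz uzz ;
  sol_uzz_L2 : in_Lp (leb2 R) 2%:E (Qdom a s T) uzz ;
  sol_heat : {ae leb2 R, forall p, Qdom a s T p -> ut p - k * uzz p = 0} ;
  sol_bc_a : {ae leb1 R, forall t, 0 < t < T ->
    - k * uz (t, a) = beta (b t - H * u (t, a))} ;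
  sol_bc_s : {ae leb1 R, forall t, 0 < t < T ->
    - k * uz (t, s t) = u (t, s t) * st t} ;
  sol_fb : {ae leb1 R, forall t, 0 < t < T ->
    st t = a0 * (u (t, s t) - varphi (s t))} ;
  sol_init_s : s 0 = s0 ;
  sol_init_u : forall z, a <= z <= s0 -> u (0, z) = u0 z
}.

Definition is_solution (R : realType) (a a0 H k : R) (beta varphi b : R -> R)
    (s0 : R) (u0 : R -> R) (T : R) (s : R -> R) (u : R * R -> R) : Prop :=
  exists (st : R -> R) (ut uz uzz : R * R -> R),
    solution_with a a0 H k beta varphi b s0 u0 T s u st ut uz uzz.

Definition is_global_solution (R : realType) (a a0 H k : R)
    (beta varphi b : R -> R) (s0 : R) (u0 : R -> R)
    (s : R -> R) (u : R * R -> R) : Prop :=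
  forall T, 0 < T -> is_solution a a0 H k beta varphi b s0 u0 T s u.

(* Main.v *)
Require Import Defs.
From HB Require Import structures.
From mathcomp Require Import all_boot all_order all_algebra.
From mathcomp Require Import all_classical all_reals all_analysis.
From mathcomp Require Import measurable_realfun ring lra.

(** Every estimate comes from one energy inequality. For a convex function [G] of
    class C^2, multiplying the heat equation by [G'(u)] and integrating over the
    moving interval [[a, s(t)]] gives formally
      d/dt int_a^s G(u) = s_t (G(u_s) - u_s G'(u_s)) + beta(b - H u_a) G'(u_a)
                          - k int_a^s G''(u) u_z^2,
    where [u_s] and [u_a] are the traces at [z = s(t)] and [z = a], because the two
    boundary conditions turn [- k u_z] into [u_s s_t] and into [beta(b - H u_a)].
    If [G'' >= gam >= 0], the last term is at most
    [- k gam (u_s - u_a)^2 / (s - a)] ([energy_inequality]).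

    Four choices of [G] are used. With [G(x) = x] and [G(x) = - x] the inequality
    becomes the exact balance of mass: the mass int_a^s u grows by the total influx
    ([mass_balance]). With [G] a truncation that vanishes on [(-oo, bup/H]], resp. on
    [[varphi(a), +oo)], the right-hand side is nonpositive and the energy stays zero,
    so that [varphi(a) <= u <= bup/H] ([u_upper_bound], [u_lower_bound]). Hence the mass
    lies between [varphi(a) (s - a)] and [(bup/H) (s - a)].

    If the total influx is unbounded, so are the mass and [s]: this is the first
    alternative. Otherwise the influx converges to some [l], and everything follows
    from the claim that the limit mass is at most [(bup/H) (r_varphi - a)]. If it were
    larger, then [s(t) > r_varphi] for all large [t], hence [varphi(s) = c0], and the
    choice [G(x) = (x - c0)^2] bounds the time integral of [(u_a - c0)^2]. But
    [c0 < blow/H], so [beta(b - H u_a)] is bounded below as long as [u_a] is close to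
    [c0]; the influx could then not have a finite integral ([flux_unbounded]).

    The energy inequality has to be extracted from distributional derivatives. Products
    of two plateau functions of one variable are enough test functions: they show
    that for almost every [t] the slice of [u_z], and for almost every [z] the slice of
    [u], is a primitive of the corresponding slice of the weak derivative
    ([slice_increment_z], [slice_increment_t]). In the space direction this gives the
    integration by parts at almost every time. In the time direction the
    increments of int_a^s G(u) are added up over a fine partition of the time interval
    ([moving_domain_increment]). *)

Set Implicit Arguments.
Unset Strict Implicit.
Unset Printing Implicit Defensive.

Import Order.TTheory GRing.Theory Num.Theory.
Import numFieldNormedType.Exports.

Local Open Scope classical_set_scope.
Local Open Scope ring_scope.

(** * Smooth functions and plateaus *)

Section smooth_plateau.
Context {R : realType}.
Implicit Types (P : {poly R}) (f g : R -> R).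

(** The functions [P(1/x) exp(-1/x)], extended by zero to the left of the origin: a
    family of functions closed under differentiation. *)
Definition expinv P (x : R) : R :=
  if 0 < x then P.[x^-1] * expR (- x^-1) else 0.

Lemma horner_bound P : exists2 M : R, 0 <= M &
  forall y, 1 <= y -> `|P.[y]| <= M * y ^+ size P.
Proof.
exists (\sum_(i < size P) `|P`_i|); first by apply: sumr_ge0.
move=> y y1; rewrite horner_coef mulr_suml.
apply: le_trans (ler_norm_sum _ _ _) _; apply: ler_sum => i _.
rewrite normrM ler_wpM2l// normrX ger0_norm ?(le_trans ler01)//.
by rewrite ler_weXn2l// ltnW.
Qed.

(** The exponential beats every power: [y^(n+2) exp(-y) <= (n+2)!] for [y = 1/h]. The
    bound by a square makes the derivative at the origin vanish. *)
Lemma expinv_bound P : exists2 C : R, 0 <= C &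
  forall h, 0 < h -> h <= 1 -> `|expinv P h| <= C * h ^+ 2.
Proof.
have [M M0 PM] := horner_bound P.
set n := size P; exists (M * (n.+2)`!%:R); first by rewrite mulr_ge0.
move=> h h0 h1; rewrite /expinv h0 normrM (ger0_norm (expR_ge0 _)).
have y1 : 1 <= h^-1 by rewrite invf_ge1.
have y0 : 0 < h^-1 by rewrite invr_gt0.
have fact0 : 0 < (n.+2)`!%:R :> R by rewrite ltr0n fact_gt0.
have e1 : (h^-1) ^+ n.+2 * expR (- h^-1) <= (n.+2)`!%:R.
  rewrite expRN ler_pdivrMr ?expR_gt0// mulrC -ler_pdivrMr//.
  by apply: le_trans (expR_ge1Dxn n.+1 (ltW y0)); rewrite lerDr.
apply: le_trans (_ : M * (h^-1) ^+ n * expR (- h^-1) <= _).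
  by rewrite ler_wpM2r ?expR_ge0// PM.
have -> : M * (h^-1) ^+ n * expR (- h^-1) =
    (M * ((h^-1) ^+ n.+2 * expR (- h^-1))) * h ^+ 2.
  by rewrite !exprS; field; rewrite gt_eqF.
by rewrite ler_wpM2r ?sqr_ge0// ler_wpM2l.
Qed.

Lemma is_derive_expinv P (x : R) :
  is_derive x (1 : R) (expinv P) (expinv ('X^2 * (P - P^`())) x).
Proof.
have [x0|x0|->] := ltgtP x 0.
- have -> : expinv ('X^2 * (P - P^`())) x = 0 by rewrite /expinv ltNge (ltW x0).
  apply: (@near_eq_is_derive R R R (cst 0)).
    near=> y; rewrite /expinv /= ltNge ifF//; apply/negbF/ltW.
    by near: y; exact: lt_nbhsl.
- have -> : expinv ('X^2 * (P - P^`())) x =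
    ('X^2 * (P - P^`())).[x^-1] * expR (- x^-1) by rewrite /expinv x0.
  apply: (@near_eq_is_derive R R R (fun y => P.[y^-1] * expR (- y^-1))).
    near=> y; rewrite /expinv ifT//.
    by near: y; exact: lt_nbhsr.
  have xn0 : x != 0 by rewrite gt_eqF.
  have dV : is_derive x (1 : R) (fun y : R => y^-1) (- x^-2).
    have := @is_derive_id R R x 1 => hid.
    apply: DeriveDef; first by apply: (@derivableV R R id x 1).
    by rewrite (@deriveV R R id x 1)// derive_id /= scaler1.
  have dP : is_derive x (1 : R) (fun y => P.[y^-1]) (P^`().[x^-1] * - x^-2).
    exact: (@is_derive1_comp R (horner P) (fun y => y^-1) x).
  have dE : is_derive x (1 : R) (fun y : R => expR (- y^-1)) (expR (- x^-1) * x^-2).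
    have dN : is_derive x (1 : R) (fun y : R => - y^-1) (x^-2).
      by have := is_deriveN dV; rewrite opprK.
    exact: (@is_derive1_comp R expR (fun y => - y^-1) x).
  have dM := is_deriveM dP dE.
  apply: (@is_derive_eq R R R _ x 1 _ _ dM).
  rewrite hornerM hornerXn hornerD hornerN /GRing.scale /=.
  by rewrite -exprVn; ring.
- have -> : expinv ('X^2 * (P - P^`())) 0 = 0 by rewrite /expinv ltxx.
  have [C C0 hC] := expinv_bound P.
  have cv : (h^-1 *: (expinv P (h *: 1 + 0) - expinv P 0)) @[h --> 0^'] --> (0:R).
    apply/cvgr0Pnorm_le => /= e e0.
    near=> h.
    have h1 : `|h| <= 1 by near: h; exact: dnbhs0_le.
    have he : `|h| <= e / (C + 1).
      by near: h; apply: dnbhs0_le; rewrite divr_gt0// ltr_wpDl.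
    rewrite {2}/expinv ltxx subr0 addr0 /GRing.scale /= mulr1.
    have [h0|h0] := ltP 0 h; last first.
      by rewrite /expinv ltNge h0 /= mulr0 normr0 ltW.
    rewrite gtr0_norm// in h1 he.
    rewrite normrM normfV (gtr0_norm h0) mulrC ler_pdivrMr//.
    apply: le_trans (hC h h0 h1) _.
    rewrite expr2 mulrA ler_wpM2r// ?(ltW h0)//.
    apply: le_trans (_ : (C + 1) * h <= _); first by rewrite ler_wpM2r ?lerDl// ltW.
    by rewrite mulrC -ler_pdivlMr// ltr_wpDl.
  by apply: DeriveDef; [apply/cvg_ex; exists 0|exact/cvg_lim].
Unshelve. all: by end_near. Qed.

(** [Cn n f]: [f] is differentiable, and so are its first [n - 1] derivatives. *)
Fixpoint Cn (n : nat) f : Prop :=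
  if n is m.+1 then (forall x, derivable f x 1) /\ Cn m (derive1 f) else True.

Lemma CnW n f : Cn n.+1 f -> Cn n f.
Proof. by elim: n f => [//|n IH] f [df cf]; split=> //; exact: IH. Qed.

Lemma derive1_fE f (df : R -> R) : (forall x, is_derive x (1 : R) f (df x)) ->
  (derive1 f) = df.
Proof. by move=> h; apply/funext => x; rewrite derive1E derive_val. Qed.

Lemma Cn_is_derive n f df : (forall x, is_derive x (1 : R) f (df x)) ->
  Cn n df -> Cn n.+1 f.
Proof.
move=> h c; split; first by move=> x; apply: ex_derive.
by rewrite (derive1_fE h).
Qed.

Lemma Cn_derive n f : Cn n.+1 f -> forall x, is_derive x (1 : R) f ((derive1 f) x).
Proof. by move=> [df _] x; rewrite derive1E; apply: derivableP. Qed.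

Lemma Cn_cst n (c : R) : Cn n (cst c).
Proof.
elim: n c => [//|n IH] c; by apply: (@Cn_is_derive n (cst c) (cst 0)); exact: IH.
Qed.

Lemma CnD n f g : Cn n f -> Cn n g -> Cn n (fun x => f x + g x).
Proof.
elim: n f g => [//|n IH] f g cf cg.
apply: (@Cn_is_derive n (fun x => f x + g x) (fun x => (derive1 f) x + (derive1 g) x)).
  by move=> x; have := is_deriveD (Cn_derive cf x) (Cn_derive cg x).
by apply: IH; [exact: cf.2|exact: cg.2].
Qed.

Lemma CnM n f g : Cn n f -> Cn n g -> Cn n (fun x => f x * g x).
Proof.
elim: n f g => [//|n IH] f g cf cg.
apply: (@Cn_is_derive n (fun x => f x * g x)
  (fun x => f x * (derive1 g) x + g x * (derive1 f) x)).
  by move=> x; have := is_deriveM (Cn_derive cf x) (Cn_derive cg x).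
by apply: CnD; apply: IH; [exact: CnW|exact: cg.2|exact: CnW|exact: cf.2].
Qed.

Lemma CnV n f : (forall x, f x != 0) -> Cn n f -> Cn n (fun x => (f x)^-1).
Proof.
elim: n f => [//|n IH] f f0 cf.
apply: (@Cn_is_derive n (fun x => (f x)^-1)
  (fun x => cst (-1) x * ((derive1 f) x * ((f x)^-1 * (f x)^-1)))).
  move=> x; apply: DeriveDef.
    by apply: (@derivableV R R f x 1) => //; exact: cf.1.
  rewrite (@deriveV R R f x 1)//; last exact: cf.1.
  by rewrite derive1E /GRing.scale /= -exprVn; ring.
apply: CnM; first exact: Cn_cst.
apply: CnM; first exact: cf.2.
by apply: CnM; apply: IH => //; exact: CnW.
Qed.

Lemma is_derive_affine (p q x : R) : is_derive x (1 : R) (fun x => p * x + q) p.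
Proof.
have := is_deriveD (is_deriveZ p (is_derive_id x (1:R))) (is_derive_cst q x (1:R)).
by rewrite addr0 [p *: 1]mulr1.
Qed.

Lemma Cn_affine n f (p q : R) : Cn n f -> Cn n (fun x => f (p * x + q)).
Proof.
elim: n f => [//|n IH] f cf.
apply: (@Cn_is_derive n (fun x => f (p * x + q))
  (fun x => (derive1 f) (p * x + q) * cst p x)).
  move=> x; exact: (@is_derive1_comp R f (fun x => p * x + q) x _ _
    (Cn_derive cf _) (is_derive_affine p q x)).
by apply: CnM; [apply: IH; exact: cf.2|exact: Cn_cst].
Qed.

Lemma Cn_expinv n P : Cn n (expinv P).
Proof.
elim: n P => [//|n IH] P.
by apply: Cn_is_derive (IH _); exact: is_derive_expinv.
Qed.

Lemma expinv1_gt0 x : 0 < x -> 0 < expinv 1 x.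
Proof. by move=> x0; rewrite /expinv x0 hornerC mul1r expR_gt0. Qed.

Lemma expinv1_ge0 x : 0 <= expinv 1 x.
Proof.
have [x0|x0] := ltP 0 x; first by rewrite ltW ?expinv1_gt0.
by rewrite /expinv ltNge x0.
Qed.

Definition smoothstep (x : R) : R :=
  expinv 1 x * (expinv 1 x + expinv 1 ((-1) * x + 1))^-1.

Let den_gt0 (x : R) : 0 < expinv 1 x + expinv 1 ((-1) * x + 1).
Proof.
have [x0|x0] := ltP 0 x.
  by rewrite ltr_pwDl ?expinv1_ge0 ?expinv1_gt0.
by rewrite ltr_wpDl ?expinv1_ge0// expinv1_gt0; lra.
Qed.

Lemma Cn_smoothstep n : Cn n smoothstep.
Proof.
apply: CnM; first exact: Cn_expinv.
apply: CnV; first by move=> x; rewrite gt_eqF.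
by apply: CnD; [|apply: Cn_affine]; exact: Cn_expinv.
Qed.

Lemma smoothstep_le0 x : x <= 0 -> smoothstep x = 0.
Proof. by move=> x0; rewrite /smoothstep {1}/expinv ltNge x0 mul0r. Qed.

Lemma smoothstep_ge1 x : 1 <= x -> smoothstep x = 1.
Proof.
move=> x1; rewrite /smoothstep.
have -> : expinv 1 (-1 * x + 1) = 0 by rewrite /expinv ifF//; apply/negbTE; lra.
by rewrite addr0 divff// gt_eqF// expinv1_gt0//; lra.
Qed.

Lemma smoothstep_ge0 x : 0 <= smoothstep x.
Proof. by rewrite mulr_ge0 ?expinv1_ge0// invr_ge0 ltW. Qed.

Lemma smoothstep_le1 x : smoothstep x <= 1.
Proof. by rewrite ler_pdivrMr// mul1r lerDl expinv1_ge0. Qed.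

Lemma derive1_smoothstep_out x : x < 0 \/ 1 < x -> (derive1 smoothstep) x = 0.
Proof.
move=> [x0|x1]; rewrite derive1E.
  rewrite (@near_eq_derive R R R smoothstep (cst 0)) ?derive_cst//.
  near=> y; rewrite /= smoothstep_le0//; apply: ltW.
  by near: y; exact: lt_nbhsl.
rewrite (@near_eq_derive R R R smoothstep (cst 1)) ?derive_cst//.
near=> y; rewrite /= smoothstep_ge1//; apply: ltW.
by near: y; exact: lt_nbhsr.
Unshelve. all: by end_near. Qed.

(** Once [4 <= n (d - c)], this is a smooth function with values in [[0, 1]], equal to
    [1] on [[c + 2/n, d - 2/n]] and to [0] off [[c + 1/n, d - 1/n]]. *)
Definition plateau (c d : R) (n : nat) (x : R) : R :=
  smoothstep (n%:R * x + (- (n%:R * c) - 1)) +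
  cst (-1) x * smoothstep (n%:R * x + (2 - n%:R * d)).

Lemma Cn_plateau c d n m : Cn m (plateau c d n).
Proof.
apply: CnD; first exact: Cn_affine (Cn_smoothstep _).
by apply: CnM; [exact: Cn_cst|exact: Cn_affine (Cn_smoothstep _)].
Qed.

Lemma Cn_continuous f : Cn 1 f -> continuous f.
Proof. by move=> [df _] x; apply/differentiable_continuous/derivable1_diffP. Qed.

Lemma Cn_derive1 f : (forall n, Cn n f) -> forall n, Cn n (derive1 f).
Proof. by move=> h n; exact: (h n.+1).2. Qed.

End smooth_plateau.

(** * Integration toolkit *)

Section L1_toolkit.
Context d (T : measurableType d) (R : realType).
Variable nu : {measure set T -> \bar R}.
Implicit Types (D : set T) (f g h : T -> R).

Local Notation L1 D f := (nu.-integrable D (EFin \o f)).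

Lemma L1_measurable D f : L1 D f -> measurable_fun D f.
Proof. by move=> /integrableP[/measurable_EFinP]. Qed.

Lemma L1D D f g : measurable D -> L1 D f -> L1 D g -> L1 D (fun x => f x + g x).
Proof. by move=> mD hf hg; exact: (integrableD mD hf hg). Qed.

Lemma L1B D f g : measurable D -> L1 D f -> L1 D g -> L1 D (fun x => f x - g x).
Proof. by move=> mD hf hg; exact: (integrableB mD hf hg). Qed.

Lemma L1Z D (c : R) f : measurable D -> L1 D f -> L1 D (fun x => c * f x).
Proof. by move=> mD hf; exact: (integrableZl mD c hf). Qed.

Lemma L1abs D f : measurable D -> L1 D f -> L1 D (fun x => `|f x|).
Proof. by move=> mD hf; exact: (integrable_norm hf). Qed.

Lemma L1_dom D f g : measurable D -> measurable_fun D f ->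
  (forall x, D x -> `|f x| <= g x) -> L1 D g -> L1 D f.
Proof.
move=> mD mf fg; apply: le_integrable => //; first exact/measurable_EFinP.
move=> x Dx /=; rewrite lee_fin; apply: le_trans (fg x Dx) _; exact: ler_norm.
Qed.

Lemma L1_bmul D h g (M : R) : measurable D -> measurable_fun D h ->
  (forall x, D x -> `|h x| <= M) -> L1 D g -> L1 D (fun x => h x * g x).
Proof.
move=> mD mh hM hg.
have M0 x : D x -> 0 <= M by move=> /hM; exact: le_trans.
apply: (@L1_dom _ _ (fun x => M * `|g x|)) => //.
- by apply: measurable_funM => //; exact: L1_measurable hg.
- by move=> x Dx; rewrite normrM ler_wpM2r// hM.
- by apply: L1Z => //; exact: L1abs.
Qed.

Lemma L1_ae_eq D f g : measurable D -> measurable_fun D g -> L1 D f ->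
  {ae nu, forall x, D x -> f x = g x} -> L1 D g.
Proof.
move=> mD mg /integrableP[mf If] fg; apply/integrableP; split.
  exact/measurable_EFinP.
rewrite (_ : (\int[nu]_(x in D) `|(EFin \o g) x| = \int[nu]_(x in D) `|(EFin \o f) x|)%E)//.
apply: ae_eq_integral => //.
- by apply/measurable_EFinP; exact: measurableT_comp.
- by apply: measurableT_comp => //; exact: mf.
- by apply: filterS fg => x /= + Dx => ->.
Qed.

Lemma ae_eq_Rintegral D f g : measurable D -> L1 D f -> L1 D g ->
  {ae nu, forall x, D x -> f x = g x} ->
  \int[nu]_(x in D) f x = \int[nu]_(x in D) g x.
Proof.
move=> mD hf hg fg; congr fine; apply: ae_eq_integral => //.
- exact: measurable_int hf.
- exact: measurable_int hg.
- by apply: filterS fg => x /= + Dx => ->.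
Qed.

Lemma ae_Rintegral_ge0 D f : measurable D -> L1 D f ->
  {ae nu, forall x, D x -> 0 <= f x} -> 0 <= \int[nu]_(x in D) f x.
Proof.
move=> mD hf f0; rewrite (@ae_eq_Rintegral _ _ (fun x => `|f x|))//.
- by apply: Rintegral_ge0.
- exact: L1abs.
- by apply: filterS f0 => x + Dx => /(_ Dx) /ger0_norm.
Qed.

Lemma ae_le_Rintegral D f g : measurable D -> L1 D f -> L1 D g ->
  {ae nu, forall x, D x -> f x <= g x} ->
  \int[nu]_(x in D) f x <= \int[nu]_(x in D) g x.
Proof.
move=> mD hf hg fg; rewrite -subr_ge0 -RintegralB//.
apply: ae_Rintegral_ge0 => //; first exact: L1B.
by apply: filterS fg => x + Dx => /(_ Dx); rewrite subr_ge0.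
Qed.

Lemma ae_norm_Rintegral_le D f g : measurable D -> L1 D f -> L1 D g ->
  {ae nu, forall x, D x -> `|f x| <= g x} ->
  `|\int[nu]_(x in D) f x| <= \int[nu]_(x in D) g x.
Proof.
move=> mD hf hg fg; apply: le_trans (le_normr_Rintegral mD hf) _.
by apply: ae_le_Rintegral => //; exact: L1abs.
Qed.

Lemma norm_Rintegral_le D f g : measurable D -> L1 D f -> L1 D g ->
  (forall x, D x -> `|f x| <= g x) ->
  `|\int[nu]_(x in D) f x| <= \int[nu]_(x in D) g x.
Proof.
by move=> mD hf hg fg; apply: ae_norm_Rintegral_le => //; exact: aeW.
Qed.

Lemma L1_restrict D f : measurable D -> L1 setT (f \_ D) <-> L1 D f.
Proof. by move=> mD; rewrite -restrict_EFin; exact: iff_sym (integrable_mkcond _ mD). Qed.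

Lemma L1S D E f : measurable D -> measurable E -> E `<=` D -> L1 D f -> L1 E f.
Proof. by move=> mD mE ED hf; apply: integrableS ED _. Qed.

(** Dominated convergence for real functions whose limit is integrable. *)
Lemma Rintegral_dominated_cvg D (f_ : nat -> T -> R) f g : measurable D ->
  (forall n, measurable_fun D (f_ n)) -> L1 D f -> L1 D g ->
  (forall x, D x -> f_ n x @[n --> \oo] --> f x) ->
  (forall n x, D x -> `|f_ n x| <= g x) ->
  \int[nu]_(x in D) f_ n x @[n --> \oo] --> \int[nu]_(x in D) f x.
Proof.
move=> mD mf_ hf hg cf fg.
have [] := @dominated_convergence _ _ _ nu D mD (fun n => EFin \o f_ n)
  (EFin \o f) (EFin \o g).
- by move=> n; exact/measurable_EFinP.
- exact: measurable_int hf.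
- by apply: aeW => x Dx; apply: cvg_EFin; [exact: nearW|exact: cf].
- exact: hg.
- by apply: aeW => x n Dx /=; rewrite lee_fin fg.
move=> _ _ h; apply: fine_cvg.
by rewrite /Rintegral fineK//; exact: integrable_fin_num.
Qed.

End L1_toolkit.

(** * Increments and uniform continuity *)

(** A function is constant when its increments are small compared with those of
    a fixed function: sum over a fine partition. *)
Lemma const_of_small_increments (R : realType) (Phi A : R -> R) (c d : R) :
  c <= d ->
  (forall e, 0 < e -> exists2 del, 0 < del & forall x y, c <= x -> x <= y ->
     y <= d -> y - x < del -> `|Phi y - Phi x| <= e * (A y - A x)) ->
  Phi d = Phi c.
Proof.
move=> cd H; apply/eqP; rewrite -subr_eq0 -normr_le0.
have [cd0|cd0] := eqVneq c d; first by rewrite cd0 subrr normr0.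
have key e : 0 < e -> `|Phi d - Phi c| <= e * (A d - A c).
  move=> e0; have [del del0 hd] := H e e0.
  have [N hN] : exists N : nat, (d - c) / del < N%:R.
    exists (Num.trunc ((d - c) / del)).+1; exact: truncnS_gt.
  have N0 : (0 : R) < N%:R.
    by apply: le_lt_trans hN; rewrite divr_ge0 ?subr_ge0// ltW.
  pose x_ (i : nat) := c + i%:R * ((d - c) / N%:R).
  have st0 : 0 <= (d - c) / N%:R by rewrite divr_ge0 ?subr_ge0// ltW.
  have st1 : (d - c) / N%:R < del.
    by rewrite ltr_pdivrMr// mulrC -ltr_pdivrMr.
  have tel i : (i <= N)%N -> `|Phi (x_ i) - Phi c| <= e * (A (x_ i) - A c).
    elim: i => [_|i IH iN].
      by rewrite /x_ mul0r addr0 !subrr normr0 mulr0.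
    have := IH (ltnW iN).
    have xd : x_ i.+1 <= d.
      rewrite /x_ -lerBrDl mulrA ler_pdivrMr// mulrC ler_wpM2l ?subr_ge0//.
      by rewrite ler_nat.
    have xS : x_ i.+1 = x_ i + (d - c) / N%:R.
      by rewrite /x_ -natr1 mulrDl mul1r addrA.
    have xi : c <= x_ i by rewrite /x_ lerDl mulr_ge0.
    have xx : x_ i <= x_ i.+1 by rewrite xS lerDl.
    have := hd (x_ i) (x_ i.+1) xi xx xd.
    rewrite {1}xS addrAC subrr add0r => /(_ st1) h1 h2.
    have -> : Phi (x_ i.+1) - Phi c =
      (Phi (x_ i.+1) - Phi (x_ i)) + (Phi (x_ i) - Phi c) by ring.
    apply: le_trans (ler_normD _ _) _.
    apply: le_trans (lerD h1 h2) _.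
    by rewrite -mulrDr addrA subrK.
  have := tel N (leqnn N).
  by rewrite /x_ mulrC divfK ?gt_eqF// subrKC.
apply/ler_addgt0Pr => e e0; rewrite add0r.
pose B := `|A d - A c| + 1.
have B0 : 0 < B by rewrite ltr_wpDl.
apply: le_trans (key (e / B) (divr_gt0 e0 B0)) _.
rewrite mulrAC ler_pdivrMr// ler_wpM2l ?(ltW e0)//.
by apply: le_trans (ler_norm _) _; rewrite lerDl.
Qed.

Lemma compact_unif_continuous (R : realType) (T : pseudoMetricType R) (A : set T)
    (f : T -> R) : compact A -> {within A, continuous f} ->
  forall e, 0 < e -> exists2 del, 0 < del &
    forall x y, A x -> A y -> ball x del y -> `|f x - f y| < e.
Proof.
move=> /compact_near_coveringP cA /subspace_continuousP cf e e0.
pose P (del : R) x' := A x' -> forall y, A y -> ball x' del y -> `|f x' - f y| < e.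
have : \forall del \near (0:R)^'+, A `<=` P del.
  apply: (cA R (0^'+) P) => x Ax.
  have e20 : 0 < e / 2 by rewrite divr_gt0.
  have /cvgrPdist_lt /(_ _ e20) := cf x Ax.
  rewrite near_withinE => /nbhs_ballP[r /= r0 hr].
  exists (ball x (r / 2), [set del | del < r / 2]).
    split; first by apply: nbhsx_ballx; rewrite divr_gt0.
    by apply: nbhs_right_lt; rewrite divr_gt0.
  move=> [x' del] [/= xx' dr] Ax' y Ay x'y.
  have h1 : `|f x - f x'| < e / 2.
    by apply: hr => //; apply: le_ball xx'; lra.
  have h2 : `|f x - f y| < e / 2.
    apply: hr => //; rewrite (splitr r).
    by apply: ball_triangle xx' _; apply: le_ball x'y; exact: ltW.
  have -> : f x' - f y = (f x - f y) - (f x - f x') by ring.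
  by apply: le_lt_trans (ler_normB _ _) _; rewrite (splitr e) ltrD.
move=> /(filterI (nbhs_right_gt 0)) /filter_ex[del [del0 h]].
by exists del => // x y Ax Ay; exact: h.
Qed.

Lemma within_continuous_comp (T U V : topologicalType) (A : set T) (B : set U)
    (f : T -> U) (g : U -> V) :
  {within A, continuous f} -> (forall x, A x -> B (f x)) ->
  {within B, continuous g} -> {within A, continuous (g \o f)}.
Proof.
move=> /subspace_continuousP cf AB /subspace_continuousP cg.
apply/subspace_continuousP => x Ax.
apply: cvg_comp (cg _ (AB _ Ax)).
move=> W hW.
have h : nbhs x (fun y => A y -> B (f y) -> W (f y)) := cf x Ax _ hW.
by apply: (@filterS _ (nbhs x) _ _ _ _ h) => y {}h Ay; exact: (h Ay (AB _ Ay)).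
Qed.

Lemma within_continuous_pair (T U V : topologicalType) (A : set T)
    (f : T -> U) (g : T -> V) :
  {within A, continuous f} -> {within A, continuous g} ->
  {within A, continuous (fun x => (f x, g x))}.
Proof.
move=> /subspace_continuousP cf /subspace_continuousP cg.
apply/subspace_continuousP => x Ax.
by apply: cvg_pair; [exact: cf|exact: cg].
Qed.

(** * Integrals over a closed interval *)

Section oint.
Context {R : realType}.
Local Notation mu := (@lebesgue_measure R).
Implicit Types (f g : R -> R) (c d : R).

Definition L1i c d f := mu.-integrable `[c, d] (EFin \o f).
Definition oint c d f : R := \int[mu]_(x in `[c, d]) f x.

Lemma mitv c d : measurable (`[c, d]%classic : set R).
Proof. exact: measurable_itv. Qed.
Hint Resolve mitv : core.

Lemma L1iS c d c' d' f : c <= c' -> d' <= d -> L1i c d f -> L1i c' d' f.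
Proof.
move=> cc dd; apply: L1S => //; apply: subset_itv; rewrite bnd_simp//.
Qed.

Lemma L1i_cont c d f : {within `[c, d], continuous f} -> L1i c d f.
Proof.
by move=> cf; apply: continuous_compact_integrable => //; exact: segment_compact.
Qed.

Lemma L1iD c d f g : L1i c d f -> L1i c d g -> L1i c d (fun x => f x + g x).
Proof. exact: L1D. Qed.

Lemma L1iB c d f g : L1i c d f -> L1i c d g -> L1i c d (fun x => f x - g x).
Proof. exact: L1B. Qed.

Lemma L1iZ c d (r : R) f : L1i c d f -> L1i c d (fun x => r * f x).
Proof. exact: L1Z. Qed.

Lemma L1iabs c d f : L1i c d f -> L1i c d (fun x => `|f x|).
Proof. exact: L1abs. Qed.

Lemma L1i_cst c d (r : R) : L1i c d (fun=> r).
Proof. by apply: L1i_cont => x; exact: cvg_cst. Qed.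

Lemma oint_cst c d (r : R) : c <= d -> oint c d (fun=> r) = r * (d - c).
Proof.
move=> cd; rewrite /oint Rintegral_cst//= lebesgue_measure_itv/= lte_fin.
by case: ltP => // dc; rewrite (le_anti (_ : d <= c <= d)) ?subrr ?mulr0 ?dc.
Qed.

Lemma oint_split c m d f : c <= m -> m <= d -> L1i c d f ->
  oint c d f = oint c m f + oint m d f.
Proof.
move=> cm md hf.
have := @Rintegral_itvB R f (BLeft c) (BRight d) m hf.
rewrite !bnd_simp => /(_ cm md); rewrite /oint => h.
rewrite -(@Rintegral_itv_obnd_cbnd _ m)//; first by rewrite -h; ring.
by apply: L1S hf => //; apply: subset_itvr; rewrite bnd_simp.
Qed.

Lemma oint_xx c f : oint c c f = 0.
Proof. by rewrite /oint set_itv1 Rintegral_set1. Qed.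

Lemma ointD c d f g : L1i c d f -> L1i c d g ->
  oint c d (fun x => f x + g x) = oint c d f + oint c d g.
Proof. by move=> hf hg; rewrite /oint RintegralD. Qed.

Lemma ointB c d f g : L1i c d f -> L1i c d g ->
  oint c d (fun x => f x - g x) = oint c d f - oint c d g.
Proof. by move=> hf hg; rewrite /oint RintegralB. Qed.

Lemma ointZ c d (r : R) f : L1i c d f ->
  oint c d (fun x => r * f x) = r * oint c d f.
Proof. by move=> hf; rewrite /oint RintegralZl. Qed.

Lemma oint_le c d f g : L1i c d f -> L1i c d g ->
  (forall x, c <= x <= d -> f x <= g x) -> oint c d f <= oint c d g.
Proof.
by move=> hf hg fg; apply: le_Rintegral => // x; rewrite /= in_itv; exact: fg.
Qed.

Lemma oint_ge0 c d f : (forall x, c <= x <= d -> 0 <= f x) -> 0 <= oint c d f.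
Proof. by move=> f0; apply: Rintegral_ge0 => x; rewrite /= in_itv; exact: f0. Qed.

Lemma oint_norm c d f g : L1i c d f -> L1i c d g ->
  (forall x, c <= x <= d -> `|f x| <= g x) -> `|oint c d f| <= oint c d g.
Proof.
by move=> hf hg fg; apply: norm_Rintegral_le => // x; rewrite /= in_itv; exact: fg.
Qed.

Lemma eq_oint c d f g : (forall x, c <= x <= d -> f x = g x) ->
  oint c d f = oint c d g.
Proof.
by move=> fg; apply: eq_Rintegral => x; rewrite inE /= in_itv; exact: fg.
Qed.

Lemma leb_aeS (P Q : R -> Prop) : (forall x, P x -> Q x) ->
  {ae mu, forall x, P x} -> {ae mu, forall x, Q x}.
Proof. by move=> PQ; apply: negligibleS => x /= + /PQ. Qed.

Lemma leb_aeS2 (P Q S : R -> Prop) : (forall x, P x -> Q x -> S x) ->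
  {ae mu, forall x, P x} -> {ae mu, forall x, Q x} -> {ae mu, forall x, S x}.
Proof.
move=> PQ hP hQ; apply: negligibleS (negligibleU hP hQ) => x /= nS.
by apply: contrapT => /not_orP[/contrapT Px /contrapT Qx]; apply: nS; exact: PQ.
Qed.

(** Almost-everywhere statements at interior points suffice. *)
Lemma ae_itv_oo c d (P : R -> Prop) :
  {ae mu, forall x, c < x < d -> P x} ->
  {ae mu, forall x, `[c, d]%classic x -> P x}.
Proof.
move=> h.
have hc : {ae mu, forall x, x <> c}.
  by exists [set c]; split => //; [exact: lebesgue_measure_set1|move=> x /= /contrapT].
have hd : {ae mu, forall x, x <> d}.
  by exists [set d]; split => //; [exact: lebesgue_measure_set1|move=> x /= /contrapT].
apply: leb_aeS2 h (leb_aeS2 (fun x p q => conj p q) hc hd) => x hx [xc xd].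
rewrite /= in_itv /= => /andP[cx dx].
by apply: hx; rewrite !lt_neqAle cx dx !andbT; apply/andP; split; apply/eqP => // /esym.
Qed.

Lemma ae_oint_le c d f g : L1i c d f -> L1i c d g ->
  {ae mu, forall x, c < x < d -> f x <= g x} -> oint c d f <= oint c d g.
Proof. by move=> hf hg fg; apply: ae_le_Rintegral => //; exact: ae_itv_oo. Qed.

Lemma ae_eq_oint c d f g : L1i c d f -> L1i c d g ->
  {ae mu, forall x, c < x < d -> f x = g x} -> oint c d f = oint c d g.
Proof. by move=> hf hg fg; apply: ae_eq_Rintegral => //; exact: ae_itv_oo. Qed.

Lemma oint_le_interior c d f g : L1i c d f -> L1i c d g ->
  (forall x, c < x < d -> f x <= g x) -> oint c d f <= oint c d g.
Proof. by move=> hf hg fg; apply: ae_oint_le => //; exact: aeW. Qed.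

Lemma oint_FTC2 c d f F : c < d -> {within `[c, d], continuous f} ->
  {within `[c, d], continuous F} ->
  (forall x, c < x < d -> is_derive x (1 : R) F (f x)) ->
  oint c d f = F d - F c.
Proof.
move=> cd cf cF dF; rewrite /oint /Rintegral (@continuous_FTC2 _ f F c d)//.
- split; first by move=> x; rewrite in_itv => /dF h; exact: ex_derive.
  + by move/(continuous_within_itvP _ cd) : cF => [].
  + by move/(continuous_within_itvP _ cd) : cF => [].
- by move=> x; rewrite in_itv => /dF h; rewrite derive1E derive_val.
Qed.

(** Lebesgue differentiation: an integrable function all of whose interval
    integrals vanish is null. *)
Lemma oint_eq0_ae c d f : L1i c d f ->
  (forall x y, c < x -> x <= y -> y < d -> oint x y f = 0) ->
  {ae mu, forall x, c < x < d -> f x = 0}.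
Proof.
move=> hf h0.
have [dc|cd] := leP d c.
  by apply: aeW => x /andP[/lt_trans] /[apply]; rewrite ltNge dc.
pose g : R -> R := f \_ `[c, d].
have hg : mu.-integrable setT (EFin \o g) by apply/L1_restrict.
have hgS D : measurable D -> mu.-integrable D (EFin \o g).
  by move=> mD; apply: L1S hg.
have ocont : {within `[c, d], continuous (fun x => oint c x f)}.
  exact: (@parameterized_integral_continuous _ c d f (ltW cd) hf).
have od x : c < x < d -> oint c x f = 0.
  move=> /andP[cx xd].
  have ox y : c < y -> y <= x -> oint c x f = oint c y f.
    move=> cy yx; rewrite (@oint_split c y x)// ?(ltW cy)//.
      by rewrite (h0 y x)// addr0.
    by apply: L1iS hf => //; exact: ltW.
  have [_ hl _] := (continuous_within_itvP _ cd).1 ocont.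
  rewrite oint_xx in hl.
  have hx : oint c y f @[y --> c^'+] --> oint c x f.
    apply: cvg_near_cst; near=> y.
    apply/esym/ox; first by near: y; exact: nbhs_right_gt.
    by near: y; apply: nbhs_right_ltW.
  exact: (cvg_unique (@Rhausdorff R) hx hl).
have oE y : \int[mu]_(t in [set` Interval (BLeft c) (BRight y)]) g t =
     oint c (Num.min y d) f.
  rewrite /g /oint -Rintegral_mkcondr; congr Rintegral.
  apply/seteqP; split => x /=; rewrite !in_itv /= le_min.
    by move=> [/andP[-> ->] /andP[_ ->]].
  by move=> /andP[-> /andP[-> ->]].
have := @FTC1 R g (BLeft c).
move=> /(_ (fun y => hgS _ (measurable_itv _))).
have lg : locally_integrable setT g.
  by apply: open_integrable_locally => //; exact: openT.
move=> /(_ lg); apply: leb_aeS => x /= hx /andP[cx xd].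
move: hx; rewrite lte_fin => /(_ cx)[_].
rewrite /g patchE mem_set/=; last by rewrite in_itv /= !ltW.
move=> <-; rewrite derive1E.
rewrite (@near_eq_derive R R R _ (cst 0)) ?derive_cst//.
near=> y; rewrite oE /=.
have yd : y < d by near: y; exact: lt_nbhsl.
have cy : c < y by near: y; exact: lt_nbhsr.
by rewrite min_l ?(ltW yd)// od// cy.
Unshelve. all: by end_near. Qed.

(** Product rule for absolutely continuous functions: over a short interval the
    increment of [f * g] differs from the integral of [f * g1 + f1 * g] by at most the
    oscillation of [f] and [g] times the integral of [|f1| + |g1|]. *)
Lemma oint_parts c d f g f1 g1 : c <= d ->
  {within `[c, d], continuous f} -> {within `[c, d], continuous g} ->
  L1i c d f1 -> L1i c d g1 ->
  (forall x y, c <= x -> x <= y -> y <= d -> f y - f x = oint x y f1) ->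
  (forall x y, c <= x -> x <= y -> y <= d -> g y - g x = oint x y g1) ->
  oint c d (fun x => f x * g1 x) =
    f d * g d - f c * g c - oint c d (fun x => f1 x * g x).
Proof.
move=> cd cf cg hf1 hg1 fE gE.
have [Mf [_ hMf]] := compact_bounded (continuous_compact cf (segment_compact (a := c) (b := d))).
have [Mg [_ hMg]] := compact_bounded (continuous_compact cg (segment_compact (a := c) (b := d))).
have mf : measurable_fun (`[c, d]%classic : set R) f by apply: L1_measurable (L1i_cont cf).
have mg : measurable_fun (`[c, d]%classic : set R) g by apply: L1_measurable (L1i_cont cg).
have i1 : L1i c d (fun x => f x * g1 x).
  apply: (@L1_bmul _ _ _ mu _ _ _ (Mf + 1)) => // x cdx.
  by apply: hMf; rewrite ?ltrDl//; exists x.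
have i2 : L1i c d (fun x => f1 x * g x).
  have : L1i c d (fun x => g x * f1 x).
    apply: (@L1_bmul _ _ _ mu _ _ _ (Mg + 1)) => // x cdx.
    by apply: hMg; rewrite ?ltrDl//; exists x.
  by under eq_fun do rewrite mulrC.
pose Phi x := f x * g x - oint c x (fun x => f x * g1 x) - oint c x (fun x => f1 x * g x).
pose A x := oint c x (fun y => `|g1 y| + `|f1 y|).
have iA : L1i c d (fun y => `|g1 y| + `|f1 y|).
  by apply: L1D => //; apply: L1abs.
suff : Phi d = Phi c by rewrite /Phi !oint_xx !subr0 => <-; ring.
apply: (const_of_small_increments (A := A)) => // e e0.
have [d1 d10 h1] := compact_unif_continuous (segment_compact (a := c) (b := d)) cf e0.
have [d2 d20 h2] := compact_unif_continuous (segment_compact (a := c) (b := d)) cg e0.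
exists (Num.min d1 d2); first by rewrite lt_min d10.
move=> x y cx xy yd; rewrite lt_min => /andP[yx1 yx2].
have S (h : R -> R) : L1i c d h -> L1i x y h by apply: L1iS.
have sp (h : R -> R) : L1i c d h -> oint c y h - oint c x h = oint x y h.
  move=> ih; rewrite (@oint_split c x y)//; first ring.
  by apply: L1iS ih.
have -> : Phi y - Phi x = oint x y (fun t => (f y - f t) * g1 t) +
    oint x y (fun t => (g x - g t) * f1 t).
  have -> : oint x y (fun t => (f y - f t) * g1 t) =
      f y * (g y - g x) - oint x y (fun t => f t * g1 t).
    rewrite gE// -ointZ; last exact: S.
    rewrite -ointB; [|exact/L1Z/S|exact: S].
    by apply: eq_oint => t _; rewrite mulrBl.
  have -> : oint x y (fun t => (g x - g t) * f1 t) =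
      g x * (f y - f x) - oint x y (fun t => f1 t * g t).
    rewrite fE// -ointZ; last exact: S.
    rewrite -ointB; [|exact/L1Z/S|exact: S].
    by apply: eq_oint => t _; ring.
  by rewrite -!sp//; rewrite /Phi; ring.
rewrite /A sp// ointD; [|exact/L1abs/S|exact/L1abs/S].
rewrite mulrDr; apply: le_trans (ler_normD _ _) _; apply: lerD.
- rewrite -ointZ; last exact/L1abs/S.
  apply: oint_norm; first 2 last.
  + move=> t /andP[xt ty]; rewrite normrM ler_wpM2r// ltW// h1//=.
    * by rewrite in_itv /= yd andbT (le_trans cx).
    * by rewrite in_itv /= (le_trans cx)//= (le_trans ty).
    * by rewrite /ball /= ger0_norm ?subr_ge0//; lra.
  + have : L1i x y (fun t => f y * g1 t - f t * g1 t) by apply: L1B; [|exact/L1Z/S|exact: S].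
    by under eq_fun do rewrite -mulrBl.
  + exact/L1Z/L1abs/S.
- rewrite -ointZ; last exact/L1abs/S.
  apply: oint_norm; first 2 last.
  + move=> t /andP[xt ty]; rewrite normrM ler_wpM2r// ltW// h2//=.
    * by rewrite in_itv /= cx (le_trans xy).
    * by rewrite in_itv /= (le_trans cx)//= (le_trans ty).
    * by rewrite /ball /= ler0_norm ?subr_le0//; lra.
  + have : L1i x y (fun t => g x * f1 t - f1 t * g t) by apply: L1B; [|exact/L1Z/S|exact: S].
    by under eq_fun => t do rewrite [f1 t * g t]mulrC -mulrBl.
  + exact/L1Z/L1abs/S.
Qed.

End oint.

#[global] Hint Resolve mitv : core.

(** * Test functions *)

Section test_functions.
Context {R : realType}.
Implicit Types (f g theta psi : R -> R).

Lemma smooth_Cn f : (forall n, Cn n f) -> smooth f.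
Proof.
move=> hf vs; move: f hf.
have DE g v : (forall n, Cn n g) -> 'D_v g = fun x => cst v x * (derive1 g) x.
  move=> hg; apply/funext => x.
  have dg : differentiable g x by apply/derivable1_diffP; exact: (hg 1%N).1.
  by rewrite deriveE// deriv1E//; exact: (hg 1%N).1.
have H vs' g : (forall n, Cn n g) -> forall n, Cn n (foldr (fun v h => 'D_v h) g vs').
  move=> hg; elim: vs' => [//|v vs' IH] n /=.
  rewrite DE//; apply: CnM; first exact: Cn_cst.
  exact: Cn_derive1.
move=> f hf /=; have h := H vs f hf; split; first exact: Cn_continuous (h 1%N).
move=> x v; apply: diff_derivable; apply/derivable1_diffP; exact: (h 1%N).1.
Qed.

Lemma test_function_itv (c d c' d' : R) f : c < c' -> d' < d ->
  (forall n, Cn n f) -> (forall x, f x != 0 -> c' <= x <= d') ->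
  test_function `]c, d[ f.
Proof.
move=> cc dd hf sf.
have sub : closure [set x | f x != 0] `<=` `[c', d'].
  rewrite [X in _ `<=` X](closure_id _).1; last exact: itv_closed.
  by apply: closureS => x /= /sf; rewrite in_itv.
split; first exact: smooth_Cn.
- by apply: (subclosed_compact _ (segment_compact (a := c') (b := d'))) => //; exact: closed_closure.
- move=> x /sub /=; rewrite !in_itv /= => /andP[c'x xd'].
  by rewrite (lt_le_trans cc)//= (le_lt_trans xd').
Qed.

(** Smoothness in the plane, level by level as in [Cn]. *)
Fixpoint Dn (n : nat) (f : R * R -> R) : Prop :=
  if n is m.+1 then
    [/\ continuous f, forall x v, derivable f x v & forall v, Dn m ('D_v f)]
  else True.

Lemma smooth_Dn (f : R * R -> R) : (forall n, Dn n f) -> smooth f.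
Proof.
move=> hf vs /=.
suff h : forall n, Dn n (foldr (fun v h => 'D_v h) f vs).
  by have [c d _] := h 1%N.
by elim: vs => [//|v vs IH] n /=; have [_ _] := IH n.+1; exact.
Qed.

Lemma is_derive_line (f : R * R -> R) (x v : R * R) (df : R) :
  is_derive (0 : R) (1 : R) (fun h : R => f (h *: v + x)) df -> is_derive x v f df.
Proof.
move=> [d1 d2]; have d : derivable f x v by apply/derivable1P.
apply: DeriveDef => //; rewrite -d2 /derive.
by under [in RHS]eq_fun do rewrite /= addr0 scale0r add0r [_ *: 1]mulr1.
Qed.

Lemma Dn_sum n (f g : R * R -> R) : Dn n f -> Dn n g -> Dn n (fun p => f p + g p).
Proof.
elim: n f g => [//|n IH] f g [cf df Df] [cg dg Dg]; split.
- by move=> x; apply: cvgD; [exact: cf|exact: cg].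
- by move=> x v; apply: derivableD.
- move=> v; rewrite (_ : 'D_v _ = fun p => 'D_v f p + 'D_v g p).
    by apply: IH; [exact: Df|exact: Dg].
  by apply/funext => p; rewrite -deriveD.
Qed.

Definition tensor theta psi (p : R * R) : R := theta p.1 * psi p.2.

Lemma is_derive_tensor theta psi (x v : R * R) : Cn 1 theta -> Cn 1 psi ->
  is_derive x v (tensor theta psi)
    (v.1 * derive1 theta x.1 * psi x.2 + theta x.1 * (v.2 * derive1 psi x.2)).
Proof.
move=> ht hp; apply: is_derive_line => /=.
have aff (g : R -> R) (q w : R) : Cn 1 g ->
    is_derive (0 : R) (1 : R) (fun h : R => g (h * w + q)) (w * derive1 g q).
  move=> hg.
  have dA : is_derive (0:R) (1 : R) (fun h : R => h * w + q) w.
    under eq_fun do rewrite mulrC.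
    exact: is_derive_affine.
  have hg0 := Cn_derive hg (0 * w + q).
  have := @is_derive1_comp R g (fun h => h * w + q) (0:R) _ _ hg0 dA.
  by rewrite mul0r add0r mulrC.
have := is_deriveM (aff theta x.1 v.1 ht) (aff psi x.2 v.2 hp).
rewrite !mul0r !add0r => h.
by apply: (@is_derive_eq R R R _ 0 1 _ _ h); rewrite /GRing.scale /=; ring.
Qed.

Lemma Dn_tensor n theta psi : Cn n.+1 theta -> Cn n.+1 psi ->
  Dn n (tensor theta psi).
Proof.
elim: n theta psi => [//|n IH] theta psi ht hp.
have C1 g : Cn n.+2 g -> Cn 1 g by move=> [? [? _]]; split.
have Dt := fun x v => is_derive_tensor x v (C1 _ ht) (C1 _ hp).
split.
- move=> x; apply: cvgM; apply: continuous_comp; [exact: cvg_fst| |exact: cvg_snd|].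
    by apply: Cn_continuous; exact: C1.
  by apply: Cn_continuous; exact: C1.
- by move=> x v; apply: ex_derive.
- move=> v; rewrite (_ : 'D_v _ = fun p =>
      tensor (fun x => cst v.1 x * derive1 theta x) psi p +
      tensor theta (fun x => cst v.2 x * derive1 psi x) p).
    apply: Dn_sum; apply: IH.
    + by apply: CnM; [exact: Cn_cst|exact: ht.2].
    + exact: CnW.
    + exact: CnW.
    + by apply: CnM; [exact: Cn_cst|exact: hp.2].
  by apply/funext => p; rewrite derive_val.
Qed.

Lemma test_function_tensor (Om : set (R * R)) theta psi (t1 t2 c d : R) :
  (forall n, Cn n theta) -> (forall n, Cn n psi) ->
  (forall t, theta t != 0 -> t1 <= t <= t2) ->
  (forall z, psi z != 0 -> c <= z <= d) ->
  (forall t z, t1 <= t <= t2 -> c <= z <= d -> Om (t, z)) ->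
  test_function Om (tensor theta psi).
Proof.
move=> ht hp st sp sO.
pose K : set (R * R) := `[t1, t2] `*` `[c, d].
have cK : compact K by apply: compact_setX; exact: segment_compact.
have sub : closure [set x | tensor theta psi x != 0] `<=` K.
  rewrite [X in _ `<=` X](closure_id _).1.
    apply: closureS => -[t z] /=; rewrite /tensor mulf_eq0 negb_or /= => /andP[t0 z0].
    by split; rewrite /= in_itv /= ?st ?sp.
  by apply: compact_closed cK; exact: norm_hausdorff.
split; first by apply: smooth_Dn => n; exact: Dn_tensor.
- by apply: (subclosed_compact _ cK) => //; exact: closed_closure.
- by move=> [t z] /sub[/=]; rewrite !in_itv /= => ? ?; exact: sO.
Qed.

End test_functions.

(** * From plateaus to increments *)

Section plateau.
Context {R : realType}.
Local Notation mu := (@lebesgue_measure R).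
Implicit Types (f g : R -> R) (c d : R).

Lemma is_derive_comp_affine f (p q x : R) : Cn 1 f ->
  is_derive x (1 : R) (fun x => f (p * x + q)) (p * derive1 f (p * x + q)).
Proof.
move=> hf.
have := @is_derive1_comp R f (fun x => p * x + q) x _ _ (Cn_derive hf _)
  (is_derive_affine p q x).
by rewrite mulrC.
Qed.

(** The derivatives of the rising and of the falling edge of a plateau. *)
Definition bumpL c (n : nat) (x : R) : R :=
  n%:R * derive1 smoothstep (n%:R * x + (- (n%:R * c) - 1)).
Definition bumpR d (n : nat) (x : R) : R :=
  n%:R * derive1 smoothstep (n%:R * x + (2 - n%:R * d)).

Lemma derive1_plateau c d n x :
  derive1 (plateau c d n) x = bumpL c n x - bumpR d n x.
Proof.
have h1 := is_derive_comp_affine n%:R (- (n%:R * c) - 1) x (Cn_smoothstep 1).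
have h2 := is_derive_comp_affine n%:R (2 - n%:R * d) x (Cn_smoothstep 1).
have -> : plateau c d n = (fun x => smoothstep (n%:R * x + (- (n%:R * c) - 1))) -
    (fun x => smoothstep (n%:R * x + (2 - n%:R * d))).
  by apply/funext => y; rewrite /plateau /= mulN1r.
by have h := is_deriveB h1 h2; rewrite derive1E derive_val.
Qed.

Lemma derive1_smoothstep_cont : continuous (derive1 (@smoothstep R)).
Proof. by apply: Cn_continuous; exact: (Cn_derive1 (fun n => Cn_smoothstep n) 1). Qed.

Lemma derive1_smoothstep_bound : exists2 C : R, 0 < C &
  forall x, `|derive1 smoothstep x| <= C.
Proof.
have cw : {within `[0, 1], continuous (derive1 (@smoothstep R))}.
  by apply: continuous_subspaceT; exact: derive1_smoothstep_cont.
have [M [_ hM]] := compact_bounded (continuous_compact cw (segment_compact (a := 0) (b := 1))).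
have C0 : 0 < `|M| + 1 by rewrite ltr_wpDl.
exists (`|M| + 1) => // x.
have [x0|x0] := ltP x 0; first by rewrite derive1_smoothstep_out ?normr0 ?ltW//; left.
have [x1|x1] := ltP 1 x; first by rewrite derive1_smoothstep_out ?normr0 ?ltW//; right.
apply: hM; first by apply: le_lt_trans (ler_norm _) _; rewrite ltrDl.
by exists x => //; rewrite /= in_itv /= x0.
Qed.

Lemma bumpL_cont c n : continuous (bumpL c n).
Proof.
apply: Cn_continuous; apply: (CnM (f := cst n%:R)); first exact: Cn_cst.
exact: Cn_affine (Cn_derive1 (fun n => Cn_smoothstep n) 1).
Qed.

Lemma bumpR_cont d n : continuous (bumpR d n).
Proof.
apply: Cn_continuous; apply: (CnM (f := cst n%:R)); first exact: Cn_cst.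
exact: Cn_affine (Cn_derive1 (fun n => Cn_smoothstep n) 1).
Qed.

Lemma plateau_supp c d n x : 4 <= n%:R * (d - c) -> plateau c d n x != 0 ->
  c + n%:R^-1 <= x <= d - n%:R^-1.
Proof.
move=> nd; apply: contraNT => h.
have n0 : 0 < (n%:R : R).
  by rewrite ltr0n lt0n; apply/negP => /eqP n0; move: nd; rewrite n0 mul0r; lra.
have nn : n%:R * n%:R^-1 = 1 :> R by rewrite divff// gt_eqF.
have [h1|h1] := leP (c + n%:R^-1) x.
  move: h; rewrite h1 /= -ltNge => xd.
  have e : n%:R * (d - n%:R^-1) < n%:R * x by rewrite ltr_pM2l.
  have e' : n%:R * c + 4 <= n%:R * d by move: nd; rewrite mulrBr; lra.
  rewrite mulrBr nn in e.
  by rewrite /plateau /= !smoothstep_ge1 ?mulr1 ?subrr//; lra.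
have e : n%:R * x < n%:R * (c + n%:R^-1) by rewrite ltr_pM2l.
have e' : n%:R * c + 4 <= n%:R * d by move: nd; rewrite mulrBr; lra.
rewrite mulrDr nn in e.
by rewrite /plateau /= !smoothstep_le0 ?mulr0 ?addr0//; lra.
Qed.

Lemma plateau_norm c d n x : `|plateau c d n x| <= 1.
Proof.
rewrite /plateau /= mulN1r ler_norml.
set p := smoothstep _; set q := smoothstep _.
have := smoothstep_ge0 (n%:R * x + (- (n%:R * c) - 1)); rewrite -/p => p0.
have := smoothstep_ge0 (n%:R * x + (2 - n%:R * d)); rewrite -/q => q0.
have := smoothstep_le1 (n%:R * x + (- (n%:R * c) - 1)); rewrite -/p => p1.
have := smoothstep_le1 (n%:R * x + (2 - n%:R * d)); rewrite -/q => q1.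
by apply/andP; split; lra.
Qed.

Lemma plateau_cvg c d x : c < x < d -> plateau c d n x @[n --> \oo] --> (1 : R).
Proof.
move=> /andP[cx xd]; apply: cvg_near_cst.
pose m := Num.min (x - c) (d - x).
have m0 : 0 < m by rewrite lt_min !subr_gt0 cx.
near=> n.
have hn : 2 <= n%:R * m.
  by rewrite -ler_pdivrMr//; near: n; exact: nbhs_infty_ger.
have h1 : 2 <= n%:R * x - n%:R * c.
  by rewrite -mulrBr; apply: le_trans hn _; rewrite ler_wpM2l// ge_min lexx.
have h2 : 2 <= n%:R * d - n%:R * x.
  by rewrite -mulrBr; apply: le_trans hn _; rewrite ler_wpM2l// ge_min lexx orbT.
rewrite /plateau /= smoothstep_ge1; last lra.
by rewrite smoothstep_le0 ?mulr0 ?addr0//; lra.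
Unshelve. all: by end_near. Qed.

Lemma plateau_large c d : c < d -> \forall n \near \oo, 4 <= n%:R * (d - c).
Proof.
move=> cd; near=> n; rewrite -ler_pdivrMr ?subr_gt0//.
by near: n; exact: nbhs_infty_ger.
Unshelve. all: by end_near. Qed.

Lemma derive1_plateau_supp c d n x : 4 <= n%:R * (d - c) ->
  derive1 (plateau c d n) x != 0 -> c < x < d.
Proof.
move=> nd; apply: contraNT => h.
have n0 : 0 < (n%:R : R).
  by rewrite ltr0n lt0n; apply/negP => /eqP n0; move: nd; rewrite n0 mul0r; lra.
have e' : n%:R * c + 4 <= n%:R * d by move: nd; rewrite mulrBr; lra.
rewrite derive1_plateau /bumpL /bumpR.
have [h1|h1] := ltP c x.
  move: h; rewrite h1 /= -leNgt => dx.
  have e : n%:R * d <= n%:R * x by rewrite ler_pM2l.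
  by rewrite !derive1_smoothstep_out ?mulr0 ?subrr//; right; lra.
have e : n%:R * x <= n%:R * c by rewrite ler_pM2l.
by rewrite !derive1_smoothstep_out ?mulr0 ?subrr//; left; lra.
Qed.

Lemma plateau_supp_oo c d n x : 4 <= n%:R * (d - c) ->
  plateau c d n x != 0 -> c < x < d.
Proof.
move=> nd /(plateau_supp nd).
have n0 : 0 < (n%:R : R).
  by rewrite ltr0n lt0n; apply/negP => /eqP n0; move: nd; rewrite n0 mul0r; lra.
have : 0 < (n%:R : R)^-1 by rewrite invr_gt0.
by move=> ? /andP[? ?]; apply/andP; split; lra.
Qed.

(** A kernel of mass one concentrated where [f] is close to [l]. *)
Lemma approx_identity c d x1 x2 f (k : R -> R) (l e K : R) : c <= x1 -> x1 <= x2 -> x2 <= d ->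
  {within `[c, d], continuous f} -> {within `[c, d], continuous k} ->
  (forall x, x < x1 \/ x2 < x -> k x = 0) -> oint c d k = 1 ->
  0 <= e -> (forall x, `|k x| <= K) -> (forall x, x1 <= x <= x2 -> `|f x - l| <= e) ->
  `|oint c d (fun x => f x * k x) - l| <= e * (K * (x2 - x1)).
Proof.
move=> cx xx xd cf ck k0 k1 e0 kK fl.
have cfk : {within `[c, d], continuous (fun x => f x * k x)}.
  by move=> x; apply: cvgM; [exact: cf|exact: ck].
have ifk := L1i_cont cfk.
have ilk : L1i c d (fun x => l * k x) by exact: (L1iZ l (L1i_cont ck)).
have -> : oint c d (fun x => f x * k x) - l = oint c d (fun x => (f x - l) * k x).
  rewrite -{1}[l]mulr1 -k1 -ointZ; last exact: L1i_cont ck.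
  by rewrite -ointB//; apply: eq_oint => x _; rewrite mulrBl.
have ih : L1i c d (fun x => (f x - l) * k x).
  have : L1i c d (fun x => f x * k x - l * k x) by exact: L1iB.
  by under eq_fun do rewrite -mulrBl.
have cd : c <= d by rewrite (le_trans cx)// (le_trans xx).
have z p q (h : R -> R) : (forall x, p < x < q -> h x = 0) -> L1i p q h -> oint p q h = 0.
  move=> h0 ih'; rewrite (ae_eq_oint ih' (L1i_cst p q 0)); last by apply: aeW.
  by rewrite /oint; under eq_Rintegral do rewrite -[0](mul0r 0); rewrite /Rintegral integral0_eq//= => x _; rewrite mul0r.
rewrite (oint_split (m := x1))//; last exact: le_trans xd.
rewrite z; last 2 first.
- by move=> x /andP[_ xx1]; rewrite k0 ?mulr0//; left.
- by apply: L1iS ih => //; exact: le_trans xd.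
rewrite add0r (oint_split (m := x2))//; last by apply: L1iS ih.
rewrite [X in _ + X]z; last 2 first.
- by move=> x /andP[xx1 _]; rewrite k0 ?mulr0//; right.
- by apply: L1iS ih => //; exact: le_trans xx.
rewrite addr0 mulrA -oint_cst//; apply: oint_norm; first by apply: L1iS ih.
- exact: L1i_cst.
- by move=> x hx; rewrite normrM ler_pM// fl.
Qed.

Lemma oint_plateau_cvg c d g : c < d -> L1i c d g ->
  oint c d (fun x => g x * plateau c d n x) @[n --> \oo] --> oint c d g.
Proof.
move=> cd ig.
have hm n : measurable_fun (`[c, d]%classic : set R) (plateau c d n).
  have cp : continuous (plateau c d n) by apply: Cn_continuous; exact: Cn_plateau.
  exact: L1_measurable (L1i_cont (continuous_subspaceT cp)).
have igo : mu.-integrable `]c, d[ (EFin \o g).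
  by apply: L1S ig => //; exact: subset_itv_oo_cc.
have oo (h : R -> R) : L1i c d h -> oint c d h = \int[mu]_(x in `]c, d[) h x.
  move=> ih; rewrite /oint -Rintegral_itv_obnd_cbnd; last first.
    by apply: L1S ih => //; exact: subset_itv_oc_cc.
  by rewrite -Rintegral_itv_bndo_bndc//; apply: L1S ih => //; exact: subset_itv_oo_cc.
have igp n : L1i c d (fun x => g x * plateau c d n x).
  have : L1i c d (fun x => plateau c d n x * g x).
    by apply: (@L1_bmul _ _ _ mu _ _ _ 1) => // [|x _]; [exact: hm|exact: plateau_norm].
  by under eq_fun do rewrite mulrC.
have -> : (fun n => oint c d (fun x => g x * plateau c d n x)) =
    (fun n => \int[mu]_(x in `]c, d[) (g x * plateau c d n x)).
  by apply/funext => n; exact: oo.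
rewrite oo//.
apply: (@Rintegral_dominated_cvg _ _ _ mu `]c, d[%classic (fun n x => g x * plateau c d n x) g (fun x => `|g x|)) => //.
- move=> n; apply: measurable_funM; first exact: L1_measurable igo.
  by apply: measurable_funS (hm n) => //; exact: subset_itv_oo_cc.
- exact: L1abs.
- move=> x; rewrite /= in_itv /= => cxd; rewrite -[X in _ --> X]mulr1.
  by apply: cvgM; [exact: cvg_cst|exact: plateau_cvg].
- by move=> n x _; rewrite normrM ler_piMr// plateau_norm.
Qed.

(** The derivatives of the plateaus tend to the difference of the Dirac masses at [c]
    and [d], and the plateaus themselves to the indicator of the interval. *)
Lemma plateau_increment c d f g : c < d ->
  {within `[c, d], continuous f} -> L1i c d g ->
  (forall n, 4 <= n%:R * (d - c) ->
    oint c d (fun x => f x * derive1 (plateau c d n) x) =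
    - oint c d (fun x => g x * plateau c d n x)) ->
  f d - f c = oint c d g.
Proof.
move=> cd cf ig H.
have cvB := oint_plateau_cvg cd ig.
have cvA : oint c d (fun x => f x * derive1 (plateau c d n) x) @[n --> \oo] --> f c - f d.
  have [C C0 hC] := derive1_smoothstep_bound.
  apply/cvgrPdist_le => /= e e0.
  have tri (p q c1 c2 : R) : `|p - c1| <= e / 2 -> `|q - c2| <= e / 2 ->
      `|c1 - c2 - (p - q)| <= e.
    rewrite !ler_norml => /andP[? ?] /andP[? ?]; apply/andP; split; lra.
  have e1 : 0 < e / (4 * C) by rewrite divr_gt0// mulr_gt0.
  have [del del0 hdel] := compact_unif_continuous (segment_compact (a := c) (b := d)) cf e1.
  near=> n.
  have nd : 4 <= n%:R * (d - c) by near: n; exact: plateau_large.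
  have n0 : 0 < (n%:R : R).
    by rewrite ltr0n lt0n; apply/negP => /eqP n0; move: nd; rewrite n0 mul0r; lra.
  have nn : n%:R * n%:R^-1 = 1 :> R by rewrite divff// gt_eqF.
  have nc : n%:R * c + 4 <= n%:R * d by move: nd; rewrite mulrBr; lra.
  have ndel : 2 * n%:R^-1 < del.
    rewrite mulrC mulrC ltr_pdivrMr// mulrC -ltr_pdivrMr//.
    by near: n; exact: nbhs_infty_gtr.
  have iv0 : 0 < (n%:R : R)^-1 by rewrite invr_gt0.
  have i2 : 2 * n%:R^-1 <= d - c.
    by rewrite -(ler_pM2l n0) mulrCA nn; lra.
  have kl : continuous (bumpL c n) by exact: bumpL_cont.
  have kr : continuous (bumpR d n) by exact: bumpR_cont.
  have wkl := continuous_subspaceT kl (A := `[c, d]).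
  have wkr := continuous_subspaceT kr (A := `[c, d]).
  have hL : `|oint c d (fun x => f x * bumpL c n x) - f c| <=
      e / (4 * C) * (n%:R * C * (c + 2 * n%:R^-1 - c)).
    have A1 : c <= c + 2 * n%:R^-1 by lra.
    have A2 : c + 2 * n%:R^-1 <= d by lra.
    have A3 : 0 <= e / (4 * C) by exact: ltW.
    apply: (approx_identity (lexx c) A1 A2 cf wkl _ _ A3).
    - move=> x hx; rewrite /bumpL derive1_smoothstep_out ?mulr0//; case: hx => hx; [left|right].
        have : n%:R * x < n%:R * c by rewrite ltr_pM2l.
        lra.
      have : n%:R * (c + 2 * n%:R^-1) < n%:R * x by rewrite ltr_pM2l.
      by rewrite mulrDr mulrCA nn; lra.
    - pose F x : R := smoothstep (n%:R * x + (- (n%:R * c) - 1)).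
      have cF : continuous F by apply: Cn_continuous; exact: Cn_affine (Cn_smoothstep 1).
      have dF x : c < x < d -> is_derive x (1 : R) F (bumpL c n x).
        by move=> _; exact: is_derive_comp_affine (Cn_smoothstep 1).
      rewrite (oint_FTC2 cd wkl (continuous_subspaceT cF) dF) /F.
      rewrite smoothstep_ge1; last lra.
      by rewrite smoothstep_le0 ?subr0//; lra.
    - by move=> x; rewrite normrM ger0_norm ?(ltW n0)// ler_wpM2l// ltW.
    - move=> x /andP[x1 x2]; apply/ltW/hdel.
      + by rewrite /= in_itv /= x1 /=; lra.
      + by rewrite /= in_itv /= lexx /=; lra.
      + by rewrite /ball /= ger0_norm ?subr_ge0//; lra.
  have hR : `|oint c d (fun x => f x * bumpR d n x) - f d| <=
      e / (4 * C) * (n%:R * C * (d - (d - 2 * n%:R^-1))).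
    have A1 : c <= d - 2 * n%:R^-1 by lra.
    have A2 : d - 2 * n%:R^-1 <= d by lra.
    have A3 : 0 <= e / (4 * C) by exact: ltW.
    apply: (approx_identity A1 A2 (lexx d) cf wkr _ _ A3).
    - move=> x hx; rewrite /bumpR derive1_smoothstep_out ?mulr0//; case: hx => hx; [left|right].
        have : n%:R * x < n%:R * (d - 2 * n%:R^-1) by rewrite ltr_pM2l.
        by rewrite mulrBr mulrCA nn; lra.
      have : n%:R * d < n%:R * x by rewrite ltr_pM2l.
      lra.
    - pose F x : R := smoothstep (n%:R * x + (2 - n%:R * d)).
      have cF : continuous F by apply: Cn_continuous; exact: Cn_affine (Cn_smoothstep 1).
      have dF x : c < x < d -> is_derive x (1 : R) F (bumpR d n x).
        by move=> _; exact: is_derive_comp_affine (Cn_smoothstep 1).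
      rewrite (oint_FTC2 cd wkr (continuous_subspaceT cF) dF) /F.
      rewrite smoothstep_ge1; last lra.
      by rewrite smoothstep_le0 ?subr0//; lra.
    - by move=> x; rewrite normrM ger0_norm ?(ltW n0)// ler_wpM2l// ltW.
    - move=> x /andP[x1 x2]; apply/ltW/hdel.
      + by rewrite /= in_itv /= x2 andbT; lra.
      + by rewrite /= in_itv /= lexx andbT; lra.
      + by rewrite /ball /= ler0_norm ?subr_le0//; lra.
  have eE : e / (4 * C) * (n%:R * C * (2 * n%:R^-1)) = e / 2.
    by field; rewrite !gt_eqF.
  have cE : c + 2 * n%:R^-1 - c = 2 * n%:R^-1 by ring.
  rewrite cE eE in hL.
  have dE : d - (d - 2 * n%:R^-1) = 2 * n%:R^-1 by ring.
  rewrite dE eE in hR.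
  have iM (k : R -> R) : continuous k -> L1i c d (fun x => f x * k x).
    move=> ck; apply: L1i_cont => x; apply: cvgM; first exact: cf.
    exact: (continuous_subspaceT ck).
  have -> : oint c d (fun x => f x * derive1 (plateau c d n) x) =
     oint c d (fun x => f x * bumpL c n x) - oint c d (fun x => f x * bumpR d n x).
    rewrite -ointB; [|exact: iM|exact: iM].
    by apply: eq_oint => x _; rewrite derive1_plateau mulrBr.
  exact: tri hL hR.
have cvA' : oint c d (fun x => f x * derive1 (plateau c d n) x) @[n --> \oo] --> - oint c d g.
  apply: cvg_trans (cvgN cvB); apply: near_eq_cvg.
  near=> n.
  have nd : 4 <= n%:R * (d - c) by near: n; exact: plateau_large.
  by rewrite (H n nd).
have eq : f c - f d = - oint c d g := cvg_unique (@Rhausdorff R) cvA cvA'.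
by rewrite -[RHS]opprK -eq opprB.
Unshelve. all: by end_near. Qed.

End plateau.

(** * Weak derivatives on slices *)

Section slices.
Context {R : realType}.
Local Notation mu := (@lebesgue_measure R).
Local Notation TR := (measurableTypeR R).
Local Notation mu2 := (@lebesgue_measure R \x @lebesgue_measure R)%E.
Implicit Types (K f g : R * R -> R).

Lemma eq_Rintegral_supp d (T : measurableType d) (nu : {measure set T -> \bar R})
    (D E : set T) (h : T -> R) :
  (forall z, h z != 0 -> D z <-> E z) ->
  \int[nu]_(z in D) h z = \int[nu]_(z in E) h z.
Proof.
move=> H; rewrite Rintegral_mkcond [RHS]Rintegral_mkcond; congr Rintegral.
apply/funext => z; rewrite !patchE; have [hz|hz] := eqVneq (h z) 0.
  by rewrite hz; do 2 case: ifP.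
have [DE ED] := H z hz; case: ifPn => [/set_mem/DE Ez|/negP nD].
  by rewrite mem_set.
by case: ifPn => // /set_mem/ED Dz; case: nD; rewrite inE.
Qed.

Let fine_ae (F : R -> \bar R) : mu.-integrable setT F ->
  mu.-integrable setT (EFin \o (fun x => fine (F x))) /\
  (\int[mu]_x (fine (F x))%:E = \int[mu]_x F x)%E.
Proof.
move=> iF; have mF := measurable_int _ iF.
have mf : measurable_fun setT (EFin \o (fun x => fine (F x))).
  by apply/measurable_EFinP; apply: measurableT_comp mF; exact: fine_measurable.
split.
  apply: le_integrable iF => //= x _.
  by case: (F x) => [r| |] //=; rewrite normr0 leey.
apply: ae_eq_integral => //.
have h := integrable_ae measurableT iF.
by apply: leb_aeS h => x /(_ I) /= hx _; rewrite fineK.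
Qed.

Lemma Rfubini1 K : mu2.-integrable setT (EFin \o K) ->
  [/\ mu.-integrable setT (EFin \o (fun x => \int[mu]_y K (x, y))),
      \int[mu]_x \int[mu]_y K (x, y) = \int[mu2]_p K p &
      {ae mu, forall x, mu.-integrable setT (EFin \o (fun y => K (x, y)))}].
Proof.
move=> iK; have [h1 h2] := fine_ae (integrable_fubini_F iK).
split; [exact: h1| |exact: ae_integrable1 iK].
by rewrite /Rintegral h2 -(integral12_prod_meas1 iK).
Qed.

Lemma Rfubini2 K : mu2.-integrable setT (EFin \o K) ->
  [/\ mu.-integrable setT (EFin \o (fun y => \int[mu]_x K (x, y))),
      \int[mu]_y \int[mu]_x K (x, y) = \int[mu2]_p K p &
      {ae mu, forall y, mu.-integrable setT (EFin \o (fun x => K (x, y)))}].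
Proof.
move=> iK; have mK := measurable_int _ iK.
have iG : mu.-integrable setT (fubini_G mu (EFin \o K)).
  have mG := measurable_fubini_G iK.
  apply/integrableP; split; first exact: mG.
  apply: le_lt_trans ((integrable21ltyP mu mu mK).1 iK).
  have mA : measurable_fun setT (abse \o (EFin \o K)) by exact: measurableT_comp.
  apply: ge0_le_integral => //.
  - by apply: measurableT_comp mG.
  - have := @measurable_fun_fubini_tonelli_G _ _ _ _ _ mu (abse \o (EFin \o K)).
    by apply => // x; exact: abse_ge0.
  - move=> y _; apply: le_abse_integral => //.
    exact: (measurableT_comp mK (pair2_measurable y)).
have [h1 h2] := fine_ae iG.
split; [exact: h1| |exact: ae_integrable2 iK].
by rewrite /Rintegral h2 -(integral21_prod_meas1 iK).
Qed.

(** Both coordinate directions are treated at once: [pi x y] is the point whose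
    slice coordinate [rho1] is [x] and whose running coordinate [rho2] is [y]. *)
Section direction.
Variables (pi : R -> R -> R * R) (rho1 rho2 : R * R -> R).
Hypothesis rho1K : forall x y, rho1 (pi x y) = x.
Hypothesis rho2K : forall x y, rho2 (pi x y) = y.
Hypothesis mrho1 : measurable_fun [set: (TR * TR)%type] rho1.
Hypothesis mrho2 : measurable_fun [set: (TR * TR)%type] rho2.
Hypothesis fub : forall K, mu2.-integrable setT (EFin \o K) ->
  [/\ mu.-integrable setT (EFin \o (fun x => \int[mu]_y K (pi x y))),
      \int[mu]_x \int[mu]_y K (pi x y) = \int[mu2]_p K p &
      {ae mu, forall x, mu.-integrable setT (EFin \o (fun y => K (pi x y)))}].

Let mplateau c d n : measurable_fun [set: TR] (@plateau R c d n).
Proof. by apply: continuous_measurable_fun; apply: Cn_continuous; exact: Cn_plateau. Qed.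

(** By Fubini the marginal of [K] integrates to zero against every plateau, hence over
    every interval. *)
Lemma slice_null K (al be : R) : mu2.-integrable setT (EFin \o K) ->
  (forall x1 x2 n, al < x1 -> x1 < x2 -> x2 < be -> 4 <= n%:R * (x2 - x1) ->
     \int[mu2]_p (plateau x1 x2 n (rho1 p) * K p) = 0) ->
  {ae mu, forall x, al < x < be -> \int[mu]_y K (pi x y) = 0}.
Proof.
move=> iK H; have [iD _ aeK] := fub iK.
set D := fun x => \int[mu]_y K (pi x y) in iD.
have iDi c d : L1i c d D by apply: L1S iD.
apply: (oint_eq0_ae (iDi al be)) => x1 x2 ax; rewrite le_eqVlt => /predU1P[->|xx] xb.
  exact: oint_xx.
apply/eqP; rewrite eq_sym; apply/eqP.
apply: (cvg_unique (@Rhausdorff R) _ (oint_plateau_cvg xx (iDi x1 x2))).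
apply: cvg_near_cst; near=> n.
have nd : 4 <= n%:R * (x2 - x1) by near: n; exact: plateau_large.
have iP : mu2.-integrable setT (EFin \o (fun p => plateau x1 x2 n (rho1 p) * K p)).
  have mp : measurable_fun [set: (TR * TR)%type] (fun p => plateau x1 x2 n (rho1 p)).
    exact: measurableT_comp (mplateau _ _ _) mrho1.
  have bp p : setT p -> `|plateau x1 x2 n (rho1 p)| <= 1 by move=> _; exact: plateau_norm.
  exact: (L1_bmul measurableT mp bp iK).
have [iE E _] := fub iP; rewrite -(H x1 x2 n)// -E.
rewrite /oint (@eq_Rintegral_supp _ _ mu _ setT); last first.
  move=> z; rewrite mulf_eq0 negb_or => /andP[_ /(plateau_supp_oo nd) /andP[/ltW h1 /ltW h2]].
  by split=> // _; rewrite /= in_itv /= h1.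
apply: ae_eq_Rintegral => //.
  have : mu.-integrable setT (EFin \o (fun x => plateau x1 x2 n x * D x)).
    exact: (@L1_bmul _ _ _ _ _ _ _ 1 measurableT (mplateau x1 x2 n) (fun p _ => plateau_norm _ _ _ p)).
  by under eq_fun do rewrite mulrC.
apply: leb_aeS aeK => x ix _.
rewrite mulrC /D -(RintegralZl (plateau x1 x2 n x) measurableT ix).
by apply: eq_Rintegral => y _; rewrite rho1K.
Unshelve. all: by end_near. Qed.

Variables (Q : set (R * R)) (f g : R * R -> R).
Hypothesis f_L1 : mu2.-integrable setT (EFin \o (f \_ Q)).
Hypothesis g_L1 : mu2.-integrable setT (EFin \o (g \_ Q)).
Hypothesis weak : forall theta psi,
  (forall n, Cn n theta) -> (forall n, Cn n psi) ->
  test_function Q (fun p => theta (rho1 p) * psi (rho2 p)) ->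
  \int[mu2]_(p in Q) (f p * (theta (rho1 p) * derive1 psi (rho2 p))) =
  - \int[mu2]_(p in Q) (g p * (theta (rho1 p) * psi (rho2 p))).
Hypothesis test : forall theta psi (t1 t2 c d : R),
  (forall n, Cn n theta) -> (forall n, Cn n psi) ->
  (forall t, theta t != 0 -> t1 <= t <= t2) ->
  (forall z, psi z != 0 -> c <= z <= d) ->
  (forall t z, t1 <= t <= t2 -> c <= z <= d -> Q (pi t z)) ->
  test_function Q (fun p => theta (rho1 p) * psi (rho2 p)).

(** Testing with a plateau in the slice coordinate times a plateau in the running
    coordinate gives the one-dimensional identity of [plateau_increment] on almost every
    slice; there are only countably many running plateaus, so one null set of slices is
    enough for all of them. *)
Lemma slice_increment (al be c d : R) : c < d ->
  (forall x y, al < x < be -> c < y < d -> Q (pi x y)) ->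
  {ae mu, forall x, al < x < be ->
    mu.-integrable setT (EFin \o (fun y => (g \_ Q) (pi x y))) /\
    ({within `[c, d], continuous (fun y => f (pi x y))} ->
     f (pi x d) - f (pi x c) = oint c d (fun y => (g \_ Q) (pi x y)))}.
Proof.
move=> cd hQ.
pose K m p := derive1 (plateau c d m) (rho2 p) * (f \_ Q) p +
  plateau c d m (rho2 p) * (g \_ Q) p.
have cpl m : continuous (plateau c d m) by apply: Cn_continuous; exact: Cn_plateau.
have cdpl m : continuous (derive1 (plateau c d m)).
  by apply: Cn_continuous; exact: (Cn_derive1 (fun n => Cn_plateau c d m n) 1).
have mdpl m : measurable_fun [set: (TR * TR)%type] (fun p => derive1 (plateau c d m) (rho2 p)).
  exact: measurableT_comp (continuous_measurable_fun (@cdpl m)) mrho2.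
have mpl m : measurable_fun [set: (TR * TR)%type] (fun p => plateau c d m (rho2 p)).
  exact: measurableT_comp (continuous_measurable_fun (@cpl m)) mrho2.
have bdpl m : exists M : R, forall x, `|derive1 (plateau c d m) x| <= M.
  have [C C0 hC] := @derive1_smoothstep_bound R.
  exists (m%:R * C + m%:R * C) => x; rewrite derive1_plateau.
  by apply: le_trans (ler_normB _ _) _; rewrite lerD// normrM ger0_norm// ler_wpM2l.
have i1 m : mu2.-integrable setT (EFin \o (fun p => derive1 (plateau c d m) (rho2 p) * (f \_ Q) p)).
  have [M hM] := bdpl m.
  have bp p : setT p -> `|derive1 (plateau c d m) (rho2 p)| <= M by move=> _; exact: hM.
  exact: (L1_bmul measurableT (mdpl m) bp f_L1).
have i2 m : mu2.-integrable setT (EFin \o (fun p => plateau c d m (rho2 p) * (g \_ Q) p)).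
  have bp p : setT p -> `|plateau c d m (rho2 p)| <= 1 by move=> _; exact: plateau_norm.
  exact: (L1_bmul measurableT (mpl m) bp g_L1).
have iK m : mu2.-integrable setT (EFin \o K m) by exact: L1D.
have mulpatch (h k : R * R -> R) p : h p * (k \_ Q) p = ((fun p => k p * h p) \_ Q) p.
  by rewrite !patchE; case: ifP => _; rewrite ?mulr0// mulrC.
have ae1 : {ae mu, forall x, forall m, 4 <= m%:R * (d - c) -> al < x < be ->
    \int[mu]_y K m (pi x y) = 0}.
  apply: ae_foralln => m.
  have [nd|nd] := leP 4 (m%:R * (d - c)); last by apply: aeW.
  have : {ae mu, forall x, al < x < be -> \int[mu]_y K m (pi x y) = 0}.
    apply: slice_null => // x1 x2 n ax xx xb nx.
    have hw := weak (fun k => Cn_plateau x1 x2 n k) (fun k => Cn_plateau c d m k).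
    have /hw hw' : test_function Q (fun p => plateau x1 x2 n (rho1 p) * plateau c d m (rho2 p)).
      apply: (test (t1 := x1) (t2 := x2) (c := c + m%:R^-1) (d := d - m%:R^-1)).
      - by move=> k; exact: Cn_plateau.
      - by move=> k; exact: Cn_plateau.
      - by move=> t /(plateau_supp_oo nx)/andP[? ?]; rewrite !ltW.
      - by move=> z /(plateau_supp nd).
      - have m0 : 0 < (m%:R : R).
          by rewrite ltr0n lt0n; apply/negP => /eqP n0; move: nd; rewrite n0 mul0r; lra.
        have : 0 < (m%:R : R)^-1 by rewrite invr_gt0.
        set w := (m%:R)^-1 => w0 t z /andP[h1 h2] /andP[h3 h4]; apply: hQ.
          by rewrite (lt_le_trans ax h1) (le_lt_trans h2 xb).
        by rewrite (lt_le_trans _ h3) ?ltrDl// (le_lt_trans h4)// gtrBl.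
    have bp p : `|plateau x1 x2 n (rho1 p)| <= 1 by exact: plateau_norm.
    have mp : measurable_fun [set: (TR * TR)%type] (fun p => plateau x1 x2 n (rho1 p)).
      exact: measurableT_comp (mplateau _ _ _) mrho1.
    have j1 := @L1_bmul _ _ _ _ _ _ _ 1 measurableT mp (fun p _ => bp p) (i1 m).
    have j2 := @L1_bmul _ _ _ _ _ _ _ 1 measurableT mp (fun p _ => bp p) (i2 m).
    under eq_Rintegral do rewrite /K mulrDr.
    rewrite RintegralD//.
    rewrite Rintegral_mkcond [in RHS]Rintegral_mkcond in hw'.
    have -> : \int[mu2]_p (plateau x1 x2 n (rho1 p) *
        (derive1 (plateau c d m) (rho2 p) * (f \_ Q) p)) =
      \int[mu2]_p ((fun p => f p * (plateau x1 x2 n (rho1 p) *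
        derive1 (plateau c d m) (rho2 p))) \_ Q) p.
      apply: eq_Rintegral => p _; rewrite mulrA.
      exact: (mulpatch (fun p => plateau x1 x2 n (rho1 p) * derive1 (plateau c d m) (rho2 p))).
    have -> : \int[mu2]_p (plateau x1 x2 n (rho1 p) *
        (plateau c d m (rho2 p) * (g \_ Q) p)) =
      \int[mu2]_p ((fun p => g p * (plateau x1 x2 n (rho1 p) *
        plateau c d m (rho2 p))) \_ Q) p.
      apply: eq_Rintegral => p _; rewrite mulrA.
      exact: (mulpatch (fun p => plateau x1 x2 n (rho1 p) * plateau c d m (rho2 p))).
    by rewrite hw' addNr.
  by apply: leb_aeS => x h _.
have [_ _ aef] := fub f_L1.
have [_ _ aeg] := fub g_L1.
have aefg := leb_aeS2 (fun x p q => conj p q) aef aeg.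
apply: leb_aeS2 ae1 aefg => x hx [fx gx] xab; split; first exact: gx.
move=> cf.
have gi : L1i c d (fun y => (g \_ Q) (pi x y)) by apply: L1S gx.
apply: (plateau_increment cd cf gi) => m nd.
have := hx m nd xab; rewrite /K.
have mdpl' : measurable_fun [set: TR] (derive1 (plateau c d m)) by exact: continuous_measurable_fun.
have mpl' : measurable_fun [set: TR] (plateau c d m) by exact: continuous_measurable_fun.
have [M hM] := bdpl m.
have k1 := @L1_bmul _ _ _ mu setT _ _ M measurableT mdpl' (fun p _ => hM p) fx.
have k2 := @L1_bmul _ _ _ mu setT _ _ 1 measurableT mpl' (fun p _ => plateau_norm _ _ _ p) gx.
under eq_Rintegral do rewrite rho2K.
rewrite RintegralD// => /eqP; rewrite addr_eq0 => /eqP h.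
transitivity (\int[mu]_y (derive1 (plateau c d m) y * (f \_ Q) (pi x y))).
  rewrite /oint (@eq_Rintegral_supp _ _ mu _ `]c, d[); last first.
    move=> z; rewrite mulf_eq0 negb_or => /andP[_ /(derive1_plateau_supp nd) /andP[h1 h2]].
    by rewrite /= !in_itv /= h1 h2 !ltW.
  rewrite [RHS](@eq_Rintegral_supp _ _ mu _ `]c, d[); last first.
    move=> z; rewrite mulf_eq0 negb_or => /andP[/(derive1_plateau_supp nd) /andP[h1 h2] _].
    by rewrite /= !in_itv /= h1 h2.
  apply: eq_Rintegral => y; rewrite inE /= in_itv /= => cyd.
  by rewrite mulrC patchE mem_set//; exact: hQ.
rewrite h; congr (- _).
rewrite /oint [RHS](@eq_Rintegral_supp _ _ mu _ setT); last first.
  move=> z; rewrite mulf_eq0 negb_or => /andP[_ /(plateau_supp_oo nd) /andP[h1 h2]].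
  by rewrite /= !in_itv /= !ltW.
by apply: eq_Rintegral => y _; rewrite mulrC.
Qed.

End direction.

Lemma slice_increment_z (Q : set (R * R)) f g (al be c d : R) :
  mu2.-integrable setT (EFin \o (f \_ Q)) ->
  mu2.-integrable setT (EFin \o (g \_ Q)) ->
  weak_deriv2 Q (0, 1) f g -> c < d ->
  (forall t z, al < t < be -> c < z < d -> Q (t, z)) ->
  {ae mu, forall t, al < t < be ->
    mu.-integrable setT (EFin \o (fun z => (g \_ Q) (t, z))) /\
    ({within `[c, d], continuous (fun z => f (t, z))} ->
     f (t, d) - f (t, c) = oint c d (fun z => (g \_ Q) (t, z)))}.
Proof.
move=> fL gL W cd hQ.
apply: (@slice_increment pair fst snd) => //.
- exact: Rfubini1.
- move=> theta psi ht hp T; have := W _ T.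
  under eq_Rintegral => p _.
    have h := is_derive_tensor p (0, 1) (ht 1%N) (hp 1%N).
    rewrite [X in f p * X](@derive_val _ _ _ _ _ _ _ h) /= !mul0r add0r mul1r.
    over.
  by [].
- by move=> theta psi t1 t2 c' d'; exact: test_function_tensor.
Qed.

Lemma slice_increment_t (Q : set (R * R)) f g (al be c d : R) :
  mu2.-integrable setT (EFin \o (f \_ Q)) ->
  mu2.-integrable setT (EFin \o (g \_ Q)) ->
  weak_deriv2 Q (1, 0) f g -> c < d ->
  (forall t z, c < t < d -> al < z < be -> Q (t, z)) ->
  {ae mu, forall z, al < z < be ->
    mu.-integrable setT (EFin \o (fun t => (g \_ Q) (t, z))) /\
    ({within `[c, d], continuous (fun t => f (t, z))} ->
     f (d, z) - f (c, z) = oint c d (fun t => (g \_ Q) (t, z)))}.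
Proof.
move=> fL gL W cd hQ.
apply: (@slice_increment (fun x y => (y, x)) snd fst) => //; last 2 first.
- move=> theta psi t1 t2 c' d' ht hp st sp sQ.
  have -> : (fun p : R * R => theta p.2 * psi p.1) = tensor psi theta.
    by apply/funext => p; rewrite mulrC.
  by apply: (test_function_tensor hp ht sp st) => t z h1 h2; exact: sQ.
- by move=> x y h1 h2; exact: hQ.
- exact: Rfubini2.
- move=> theta psi ht hp.
  have -> : (fun p : R * R => theta p.2 * psi p.1) = tensor psi theta.
    by apply/funext => p; rewrite mulrC.
  move=> T; have := W _ T.
  under eq_Rintegral => p _.
    have h := is_derive_tensor p (1, 0) (hp 1%N) (ht 1%N).
    rewrite [X in f p * X](@derive_val _ _ _ _ _ _ _ h) /= !mul0r mulr0 addr0 mul1r (mulrC (derive1 psi _)).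
    over.
  move=> ->; congr (- _); apply: eq_Rintegral => p _.
  by rewrite /tensor (mulrC (psi _)).
Qed.

End slices.

(** * Transport of an integral over a moving interval *)

Lemma Rintegral_subset d (X : measurableType d) (R : realType)
    (nu : {measure set X -> \bar R}) (D E : set X) (f : X -> R) :
  measurable D -> measurable E -> D `<=` E -> nu.-integrable E (EFin \o f) ->
  (forall x, E x -> 0 <= f x) -> \int[nu]_(x in D) f x <= \int[nu]_(x in E) f x.
Proof.
move=> mD mE DE fE f0; rewrite Rintegral_mkcond [leRHS]Rintegral_mkcond.
apply: le_Rintegral => //; [|exact/L1_restrict|].
  by apply/L1_restrict => //; apply: L1S fE.
move=> x _; rewrite !patchE; case: ifPn => [/set_mem/DE Ex|_]; first by rewrite mem_set.
by case: ifPn => // /set_mem/f0.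
Qed.

Section boxes.
Context {R : realType}.
Local Notation mu := (@lebesgue_measure R).
Local Notation TR := (measurableTypeR R).
Local Notation mu2 := (@lebesgue_measure R \x @lebesgue_measure R)%E.
Implicit Types (K : R * R -> R).

Definition box (x y c d : R) : set (TR * TR) := `[x, y] `*` `[c, d].
Definition strip (x y : R) : set (TR * TR) := `[x, y] `*` setT.

Lemma measurable_box x y c d : measurable (box x y c d).
Proof. by apply: measurableX; exact: measurable_itv. Qed.

Lemma measurable_strip x y : measurable (strip x y).
Proof. by apply: measurableX => //; exact: measurable_itv. Qed.

Hint Resolve measurable_box measurable_strip : core.

Lemma Rintegral_strip K x y : mu2.-integrable setT (EFin \o K) ->
  L1i x y (fun t => \int[mu]_z K (t, z)) /\
  \int[mu2]_(p in strip x y) K p = oint x y (fun t => \int[mu]_z K (t, z)).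
Proof.
move=> iK; have [i1 _ _] := Rfubini1 iK; split; first by apply: L1S i1.
have iS : mu2.-integrable setT (EFin \o (K \_ (strip x y))).
  by apply/L1_restrict => //; apply: L1S iK.
have [_ E _] := Rfubini1 iS.
rewrite Rintegral_mkcond -E /oint [RHS]Rintegral_mkcond.
apply: eq_Rintegral => t _; rewrite [RHS]patchE.
case: ifPn => [/set_mem xty|/negP nt].
  by apply: eq_Rintegral => z _; rewrite patchE mem_set.
rewrite /Rintegral integral0_eq//= => z _; rewrite patchE ifN//.
by apply/negP => /set_mem[/= h _]; apply: nt; rewrite inE.
Qed.

Lemma Rintegral_box K x y c d : mu2.-integrable setT (EFin \o K) ->
  L1i c d (fun z => oint x y (fun t => K (t, z))) /\
  \int[mu2]_(p in box x y c d) K p =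
    oint c d (fun z => oint x y (fun t => K (t, z))).
Proof.
move=> iK.
have iB : mu2.-integrable setT (EFin \o (K \_ (box x y c d))).
  by apply/L1_restrict => //; apply: L1S iK.
have [i2 E _] := Rfubini2 iB.
have H : (fun z => \int[mu]_t (K \_ (box x y c d)) (t, z)) =
    (fun z => oint x y (fun t => K (t, z))) \_ `[c, d].
  apply/funext => z; rewrite [RHS]patchE; case: ifPn => [/set_mem cz|/negP nz].
    rewrite /oint [RHS]Rintegral_mkcond; apply: eq_Rintegral => t _.
    rewrite !patchE; case: ifPn => [/set_mem[/= h _]|/negP nt]; first by rewrite mem_set.
    by rewrite ifN//; apply/negP => /set_mem h; apply: nt; rewrite inE.
  rewrite /Rintegral integral0_eq//= => t _; rewrite patchE ifN//.
  by apply/negP => /set_mem[/= _ h]; apply: nz; rewrite inE.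
rewrite H in i2; split; first by apply/L1_restrict.
rewrite Rintegral_mkcond -E /oint [RHS]Rintegral_mkcond.
by apply: eq_Rintegral => z _; rewrite -[LHS]/((fun z => _) z) H.
Qed.

Lemma box_measure x y c d : x <= y -> c <= d ->
  mu2 (box x y c d) = ((y - x) * (d - c))%:E.
Proof.
move=> xy cd; rewrite /box product_measure1E; [|exact: measurable_itv..].
have len p q : p <= q -> mu (`[p, q]%classic : set R) = (q - p)%:E.
  move=> pq; rewrite lebesgue_measure_itv /= lte_fin.
  by case: ltP => // qp; rewrite (le_anti (_ : p <= q <= p)) ?subrr// pq.
by rewrite [X in (X * _)%E]len// [X in (_ * X)%E]len.
Qed.

Lemma box_cst x y c d (r : R) : x <= y -> c <= d ->
  mu2.-integrable (box x y c d) (EFin \o (fun=> r)) /\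
  \int[mu2]_(p in box x y c d) r = r * ((y - x) * (d - c)).
Proof.
move=> xy cd; have E := box_measure xy cd; split.
  apply: measurable_bounded_integrable => //; first by rewrite (_ : _ (box x y c d) = ((y - x) * (d - c))%:E) ?ltry//; exact: E.
  by exists `|r|; split; rewrite ?num_real// => M /ltW rM p _; exact: rM.
by rewrite Rintegral_cst// (_ : _ (box x y c d) = ((y - x) * (d - c))%:E)//; exact: E.
Qed.

End boxes.
#[global] Hint Resolve measurable_box measurable_strip : core.

Lemma dist_itv (R : realDomainType) (x y t t' : R) :
  x <= t <= y -> x <= t' <= y -> `|t - t'| <= y - x.
Proof. by move=> /andP[? ?] /andP[? ?]; rewrite ler_norml; apply/andP; split; lra. Qed.

Lemma dist_between (R : realDomainType) (p q w xi e : R) :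
  `|p - w| < e -> `|q - w| < e -> Num.min p q <= xi <= Num.max p q ->
  `|xi - w| < e.
Proof.
rewrite !ltr_norml ge_min le_max => /andP[? ?] /andP[? ?] /andP[/orP[] ? /orP[] ?];
by apply/andP; split; lra.
Qed.

Section moving_domain.
Context {R : realType}.
Local Notation mu := (@lebesgue_measure R).
Local Notation mu2 := (@lebesgue_measure R \x @lebesgue_measure R)%E.
Variables (a T : R) (s sig : R -> R) (u ut : R * R -> R).
Hypothesis T_gt0 : 0 < T.
Hypothesis s_gt : forall t, 0 <= t <= T -> a < s t.
Hypothesis sig_cont : {within `[0, T], continuous sig}.
Hypothesis s_inc : forall x y, 0 <= x -> x <= y -> y <= T -> s y - s x = oint x y sig.
Hypothesis s_cont : {within `[0, T], continuous s}.
Hypothesis u_cont : {within Qdom_closed a s T, continuous u}.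

Local Notation Q := (Qdom a s T).
Local Notation Qc := (Qdom_closed a s T).

(** Rescaling the space variable maps a rectangle onto the closed domain. *)
Lemma Qdom_closed_compact : compact Qc.
Proof.
pose K : set (R * R) := `[0, T] `*` `[0, 1].
have cK : compact K by apply: compact_setX; exact: segment_compact.
pose h (p : R * R) := (p.1, a + p.2 * (s p.1 - a)).
have c1 : {within K, continuous (@fst R R)}.
  by apply: continuous_subspaceT => p; exact: cvg_fst.
have c2 : {within K, continuous (@snd R R)}.
  by apply: continuous_subspaceT => p; exact: cvg_snd.
have c3 : {within K, continuous (s \o fst)}.
  by apply: within_continuous_comp c1 _ s_cont => p [].
have ch : {within K, continuous h}.
  apply: within_continuous_pair => // p.
  apply: cvgD; first exact: cvg_cst.
  apply: cvgM; first exact: c2.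
  by apply: cvgB; [exact: c3|exact: cvg_cst].
suff -> : Qc = h @` K by exact: continuous_compact ch cK.
apply/seteqP; split => [[t z] [/= ht /andP[az zs]]|_ [[t l] [/= ht hl] <-]].
- have sa : 0 < s t - a by rewrite subr_gt0 s_gt.
  exists (t, (z - a) / (s t - a)).
    split => /=; rewrite in_itv /= ?ht//.
    apply/andP; split; first by apply: divr_ge0; rewrite ?subr_ge0// -subr_ge0 ltW.
    by rewrite ler_pdivrMr// mul1r lerD2r.
  by rewrite /h /= divfK ?gt_eqF//; congr (_, _); ring.
- move: ht hl; rewrite !in_itv /= => ht /andP[l0 l1].
  have sa : 0 < s t - a by rewrite subr_gt0 s_gt.
  split => //=; apply/andP; split; first by rewrite lerDl mulr_ge0// ltW.
  by rewrite -lerBrDl ler_piMl// ltW.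
Qed.

Lemma slice_cont t (c d : R) : 0 <= t <= T -> a <= c -> d <= s t ->
  {within `[c, d], continuous (fun z => u (t, z))}.
Proof.
move=> ht ac ds.
have cp : {within `[c, d], continuous (fun z : R => (t, z))}.
  apply: within_continuous_pair; apply: continuous_subspaceT => x; first exact: cvg_cst.
  exact: cvg_id.
apply: within_continuous_comp cp _ u_cont => z; rewrite /= in_itv /= => /andP[cz zd].
by split => //=; rewrite (le_trans ac)//= (le_trans zd).
Qed.

Lemma time_cont z (x y : R) : 0 <= x -> y <= T -> a <= z ->
  (forall t, x <= t <= y -> z <= s t) ->
  {within `[x, y], continuous (fun t => u (t, z))}.
Proof.
move=> x0 yT az zs.
have cp : {within `[x, y], continuous (fun t : R => (t, z))}.
  apply: within_continuous_pair; apply: continuous_subspaceT => t; first exact: cvg_id.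
  exact: cvg_cst.
apply: within_continuous_comp cp _ u_cont => t; rewrite /= in_itv /= => /andP[xt ty].
by split => /=; rewrite ?(le_trans x0)//= ?(le_trans ty)//= az/= zs// xt.
Qed.

Lemma trace_s_cont : {within `[0, T], continuous (fun t => u (t, s t))}.
Proof.
have cp : {within `[0, T], continuous (fun t : R => (t, s t))}.
  by apply: within_continuous_pair => //; apply: continuous_subspaceT => t; exact: cvg_id.
apply: within_continuous_comp cp _ u_cont => t; rewrite /= in_itv /= => ht.
by split => //=; rewrite lexx andbT ltW// s_gt.
Qed.

Lemma trace_a_cont : {within `[0, T], continuous (fun t => u (t, a))}.
Proof.
apply: time_cont => //; rewrite ?lexx// => t ht.
by rewrite ltW// s_gt.
Qed.

Lemma u_bounded : exists2 M : R, 0 <= M & forall p, Qc p -> `|u p| <= M.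
Proof.
have [M [_ hM]] := compact_bounded (continuous_compact u_cont Qdom_closed_compact).
exists (`|M| + 1); first by rewrite addr_ge0.
move=> p Qp; apply: hM; last by exists p.
by apply: le_lt_trans (ler_norm _) _; rewrite ltrDl.
Qed.

Lemma sub_Qdom : Q `<=` Qc.
Proof.
by move=> [t z] [/= /andP[? ?] /andP[? ?]]; split => /=; apply/andP; split; exact: ltW.
Qed.

Hypothesis uQ_meas : measurable_fun [set: (measurableTypeR R * measurableTypeR R)%type] (u \_ Q).
Hypothesis u_L1 : mu2.-integrable setT (EFin \o (u \_ Q)).
Hypothesis ut_L1 : mu2.-integrable setT (EFin \o (ut \_ Q)).
Hypothesis ut_L2 : mu2.-integrable setT (EFin \o (fun p => (ut \_ Q) p ^+ 2)).
Hypothesis ut_weak : weak_deriv2 Q (1, 0) u ut.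

Variables G G1 : R -> R.
Hypothesis G_der : forall x : R, is_derive x (1 : R) G (G1 x).
Hypothesis G1_cont : continuous G1.

Let E t := oint a (s t) (fun z => G (u (t, z))).
Let P p := G1 ((u \_ Q) p) * (ut \_ Q) p.

Let G_cont : continuous G.
Proof. by move=> x; apply/differentiable_continuous/derivable1_diffP; apply: ex_derive. Qed.

Let Gu_cont : {within Qc, continuous (G \o u)}.
Proof.
apply: (within_continuous_comp (B := setT) u_cont) => //.
by apply: continuous_subspaceT.
Qed.

Let G1u_bound : exists2 N : R, 0 < N & forall p, `|G1 ((u \_ Q) p)| <= N.
Proof.
have [M M0 hM] := u_bounded.
have cG1 : {within `[- M, M], continuous G1} by exact: continuous_subspaceT.
have [N [_ hN]] := compact_bounded (continuous_compact cG1 (segment_compact (a := - M) (b := M))).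
exists (`|N| + 1); first by rewrite ltr_wpDl.
move=> p; apply: hN; first by apply: le_lt_trans (ler_norm _) _; rewrite ltrDl.
exists ((u \_ Q) p) => //; rewrite /= in_itv /= -ler_norml patchE.
by case: ifPn => [/set_mem/sub_Qdom/hM//|_]; rewrite normr0.
Qed.

Lemma composed_ut_L1 : mu2.-integrable setT (EFin \o P).
Proof.
have [N N0 hN] := G1u_bound.
have mG1 : measurable_fun [set: (measurableTypeR R * measurableTypeR R)%type]
    (fun p => G1 ((u \_ Q) p)).
  exact: measurableT_comp (continuous_measurable_fun G1_cont) uQ_meas.
exact: (L1_bmul measurableT mG1 (fun p _ => hN p) ut_L1).
Qed.

Lemma speed_bounded : exists2 L : R, 0 < L & forall t, 0 <= t <= T -> `|sig t| <= L.
Proof.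
have [M [_ hM]] := compact_bounded (continuous_compact sig_cont (segment_compact (a := 0) (b := T))).
exists (`|M| + 1); first by rewrite ltr_wpDl.
move=> t ht; apply: hM; last by exists t => //; rewrite /= in_itv.
by apply: le_lt_trans (ler_norm _) _; rewrite ltrDl.
Qed.

Lemma s_lipschitz L : (forall t, 0 <= t <= T -> `|sig t| <= L) ->
  forall x y, 0 <= x -> x <= y -> y <= T -> `|s y - s x| <= L * (y - x).
Proof.
move=> hL x y x0 xy yT; rewrite s_inc// -oint_cst//.
apply: oint_norm; [|exact: L1i_cst|].
  by apply: L1iS (L1i_cont sig_cont).
by move=> t /andP[xt ty]; apply: hL; rewrite (le_trans x0)//= (le_trans ty).
Qed.

Lemma s_gap : exists2 kap : R, 0 < kap & forall t, 0 <= t <= T -> a + kap <= s t.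
Proof.
have [c cT hc] := EVT_min (ltW T_gt0) s_cont.
have ca : a < s c by apply: s_gt; rewrite in_itv in cT.
exists (s c - a); rewrite ?subr_gt0// => t ht.
by rewrite subrKC hc// in_itv.
Qed.

Let J t := \int[mu]_z P (t, z) + sig t * G (u (t, s t)).

Let Gus_cont : {within `[0, T], continuous (fun t => sig t * G (u (t, s t)))}.
Proof.
have c : {within `[0, T], continuous (G \o (fun t => u (t, s t)))}.
  apply: (within_continuous_comp (B := setT) trace_s_cont) => //.
  exact: continuous_subspaceT.
by move=> t; apply: cvgM; [exact: sig_cont|exact: c].
Qed.

Let GuL1 t c d : 0 <= t <= T -> a <= c -> d <= s t -> L1i c d (fun z => G (u (t, z))).
Proof.
move=> ht ac ds; apply: L1i_cont.
apply: (within_continuous_comp (B := setT) (slice_cont ht ac ds)) => //.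
exact: continuous_subspaceT.
Qed.

(** On a rectangle inside the domain the chain rule holds along almost every
    vertical line, up to the oscillation of [G1 \o u]. *)
Lemma rectangle_increment (x y m e : R) : 0 <= x -> x < y -> y <= T -> a < m ->
  (forall t, x <= t <= y -> m <= s t) ->
  (forall z t, a <= z <= m -> x <= t <= y -> forall xi,
     Num.min (u (x, z)) (u (y, z)) <= xi <= Num.max (u (x, z)) (u (y, z)) ->
     `|G1 xi - G1 (u (t, z))| <= e) ->
  `|oint a m (fun z => G (u (y, z)) - G (u (x, z))) -
    \int[mu2]_(p in box x y a m) P p| <=
  e * \int[mu2]_(p in box x y a m) `|(ut \_ Q) p|.
Proof.
move=> x0 xy yT am ms He.
have iP := composed_ut_L1.
have iA : mu2.-integrable setT (EFin \o (fun p => `|(ut \_ Q) p|)) by exact: L1abs.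
have [i1 ->] := Rintegral_box x y a m iP.
have [i2 ->] := Rintegral_box x y a m iA.
have hx : 0 <= x <= T by rewrite x0 (le_trans (ltW xy)).
have hy : 0 <= y <= T by rewrite yT (le_trans x0 (ltW xy)).
have iG t : 0 <= t <= T -> m <= s t -> L1i a m (fun z => G (u (t, z))).
  by move=> ht mt; apply: GuL1.
have mx : m <= s x by apply: ms; rewrite lexx ltW.
have my : m <= s y by apply: ms; rewrite lexx ltW.
have iD : L1i a m (fun z => G (u (y, z)) - G (u (x, z))).
  by apply: L1iB; exact: iG.
rewrite -ointB// -ointZ//.
apply: ae_norm_Rintegral_le => //; [exact: L1iB|exact: L1iZ|].
apply: ae_itv_oo.
have hQ t z : x < t < y -> a < z < m -> Q (t, z).
  move=> /andP[xt ty] /andP[az zm]; split => /=.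
    by rewrite (le_lt_trans x0)//= (lt_le_trans ty).
  by rewrite az/= (lt_le_trans zm)// ms// !ltW.
have aeP : {ae mu, forall z, mu.-integrable setT (EFin \o (fun t => P (t, z)))}.
  by have [] := Rfubini2 iP.
have := slice_increment_t u_L1 ut_L1 ut_weak xy hQ.
move=> aeu; apply: leb_aeS2 aeP aeu => z iPz hu azm.
have [az zm] := andP azm.
have [iut] := hu azm.
have cz : {within `[x, y], continuous (fun t => u (t, z))}.
  apply: time_cont; rewrite ?(ltW az)// => t ht.
  by apply: le_trans (ms t ht); exact: ltW.
move=> /(_ cz) uE.
have iutz : L1i x y (fun t => (ut \_ Q) (t, z)) by apply: L1S iut.
have [xi hxi GE] : exists2 xi,
    Num.min (u (x, z)) (u (y, z)) <= xi <= Num.max (u (x, z)) (u (y, z)) &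
    G (u (y, z)) - G (u (x, z)) = G1 xi * (u (y, z) - u (x, z)).
  have [e1|ne] := eqVneq (u (x, z)) (u (y, z)).
    by exists (u (x, z)); rewrite e1 ?minxx ?maxxx ?lexx// !subrr mulr0.
  have mvt (p q : R) : p < q -> exists2 xi, p <= xi <= q & G q - G p = G1 xi * (q - p).
    move=> pq; have [|xi] := @MVT_segment R G G1 p q (ltW pq).
    - exact: continuous_subspaceT.
    - by rewrite in_itv /= => h1 h2; exists xi.
  have [lt1|lt1|] := ltgtP (u (x, z)) (u (y, z)).
  - by have [xi h1 h2] := mvt _ _ lt1; exists xi.
  - have [xi h1 h2] := mvt _ _ lt1; exists xi => //.
    by rewrite -opprB h2 -mulrN opprB.
  - by move=> e1; rewrite e1 eqxx in ne.
rewrite GE uE -ointZ//.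
have iPzi : L1i x y (fun t => P (t, z)) by apply: L1S iPz.
rewrite -ointB//; last exact: L1iZ.
rewrite -ointZ; last exact: L1iabs.
apply: ae_norm_Rintegral_le => //; [apply: L1iB => //; exact: L1iZ|exact/L1iZ/L1iabs|].
apply: ae_itv_oo; apply: aeW => t xty.
rewrite /P [(u \_ Q) _]patchE mem_set; last exact: hQ.
rewrite -mulrBl normrM ler_wpM2r//.
by apply: He => //; [rewrite !ltW|have [? ?] := andP xty; rewrite !ltW].
Qed.


(** Over a short time step [[x, y]] of length [h], the moving interval is split at
    [m = s x - L h], where [L] bounds the speed, so that [[x, y] * [a, m]] lies in the
    domain and [rectangle_increment] applies. The rest of the domain in that strip is
    contained in a rectangle of area [2 L h^2]; there [|ut|] is split by Young's inequality
    into a constant and a small multiple of [ut^2]. Near the moving end [G \o u]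
    is almost constant, so the remaining boundary terms add up to its value times the
    increment of [s]. *)
Lemma moving_domain_increment (t1 t2 : R) : 0 <= t1 -> t1 <= t2 -> t2 <= T ->
  L1i t1 t2 J /\ E t2 - E t1 = oint t1 t2 J.
Proof.
move=> t10 t12 t2T.
have iP := composed_ut_L1.
have iA : mu2.-integrable setT (EFin \o (fun p => `|(ut \_ Q) p|)) by exact: L1abs.
pose N1 t := \int[mu]_z `|(ut \_ Q) (t, z)|.
pose N2 t := \int[mu]_z ((ut \_ Q) (t, z)) ^+ 2.
have iJ x y : 0 <= x -> y <= T -> L1i x y J.
  move=> x0 yT; apply: L1iD; first exact: (Rintegral_strip x y iP).1.
  exact: L1iS (L1i_cont Gus_cont).
split; first exact: iJ.
have [Nb Nb0 hNb] := G1u_bound.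
have [L L0 hL] := speed_bounded.
have lipL := s_lipschitz hL.
have [kap kap0 hkap] := s_gap.
have [M M0 hM] := u_bounded.
pose Phi t := E t - oint t1 t J.
(* The four summands of the error: boundary terms, sliver area, chain rule, [ut^2]. *)
pose A t := (4 * L + Nb * L) * t + oint t1 t N1 + Nb / 2 * oint t1 t N2.
suff : Phi t2 = Phi t1.
  rewrite /Phi oint_xx subr0 => h.
  by rewrite -h; ring.
apply: (const_of_small_increments (A := A)) => // e e0.
have [d1 d10 hd1] := compact_unif_continuous Qdom_closed_compact Gu_cont e0.
have cG1 : {within `[- M, M], continuous G1} by exact: continuous_subspaceT.
have [eta eta0 heta] := compact_unif_continuous (segment_compact (a := - M) (b := M)) cG1 e0.
have [d2 d20 hd2] := compact_unif_continuous Qdom_closed_compact u_cont eta0.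
(* [h <= e^2] makes the sliver area, divided by [e], at most [2 L h e]. *)
pose del := Num.min (Num.min d1 d2) (Num.min (d1 / L) (Num.min (kap / L) (e ^+ 2))).
exists del; first by rewrite !lt_min d10 d20 !divr_gt0 ?exprn_gt0.
move=> x y t1x; rewrite le_eqVlt => /predU1P[->|xy] yt2; first by rewrite !subrr normr0 mulr0.
rewrite !lt_min ltr_pdivlMr// ltr_pdivlMr//.
move=> /andP[/andP[hd1' hd2'] /andP[Ld1 /andP[Lk he2]]].
have x0 : 0 <= x by exact: le_trans t1x.
have yT : y <= T by exact: le_trans t2T.
have hh : 0 < y - x by rewrite subr_gt0.
set h := y - x in hh hd1' hd2' Ld1 Lk he2.
rewrite [h * L]mulrC in Ld1 Lk.
pose m := s x - L * h.
have hxT t : x <= t <= y -> 0 <= t <= T.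
  by move=> /andP[xt ty]; rewrite (le_trans x0 xt) (le_trans ty yT).
have Lh t : x <= t <= y -> `|s t - s x| <= L * h.
  move=> /andP[xt ty]; apply: le_trans (lipL x t x0 xt (le_trans ty yT)) _.
  by rewrite ler_pM2l// lerD2r.
have hx : x <= x <= y by rewrite lexx ltW.
have hy : x <= y <= y by rewrite lexx ltW.
have am : a < m.
  rewrite /m ltrBrDr; apply: lt_le_trans (hkap x (hxT x hx)).
  by rewrite ltrD2l.
have mE : m + 2 * L * h = s x + L * h by rewrite /m; ring.
have sm t : x <= t <= y -> m <= s t /\ s t <= s x + L * h.
  by move=> /Lh; rewrite ler_norml lerBrDr lerBlDr addrC -/m addrC => /andP[].
have ms t : x <= t <= y -> m <= s t by move=> /sm[].
have Qcz t z : x <= t <= y -> a <= z <= s t -> Qc (t, z).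
  by move=> ht hz; split => //=; exact: hxT.
have bu t z : x <= t <= y -> a <= z <= s t -> `|u (t, z)| <= M.
  by move=> ht hz; apply: hM; exact: Qcz.
have near_u t t' z : x <= t <= y -> x <= t' <= y -> a <= z <= m ->
    `|u (t, z) - u (t', z)| < eta.
  move=> ht ht' /andP[az zm]; apply: hd2.
  - by apply: Qcz => //; rewrite az (le_trans zm)// ms.
  - by apply: Qcz => //; rewrite az (le_trans zm)// ms.
  - split; rewrite /ball /= ?subrr ?normr0//.
    exact: le_lt_trans (dist_itv ht ht') hd2'.
have RI := @rectangle_increment x y m e x0 xy yT am ms.
have {}RI : `|oint a m (fun z => G (u (y, z)) - G (u (x, z))) -
    \int[mu2]_(p in box x y a m) P p| <=
  e * \int[mu2]_(p in box x y a m) `|(ut \_ Q) p|.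
  apply: RI => z t hz ht xi /andP[xi1 xi2].
  have uxz := near_u x t z hx ht hz; have uyz := near_u y t z hy ht hz.
  have hzs t' : x <= t' <= y -> a <= z <= s t'.
    by move=> ht'; move: hz => /andP[-> zm]; rewrite (le_trans zm)// ms.
  have bx := bu x z hx (hzs x hx); have by' := bu y z hy (hzs y hy).
  apply: ltW; apply: heta.
  - rewrite /= in_itv /=; move: bx by'; rewrite !ler_norml => /andP[? ?] /andP[? ?].
    apply/andP; split; first by apply: le_trans xi1; rewrite le_min; apply/andP.
    by apply: le_trans xi2 _; rewrite ge_max; apply/andP.
  - by rewrite /= in_itv /= -ler_norml; apply: bu => //; exact: hzs.
  - by rewrite /ball /=; apply: (dist_between uxz uyz); rewrite xi1.
have hxx := hxT x hx; have hyy := hxT y hy.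
have GE t : x <= t <= y -> E t = oint a m (fun z => G (u (t, z))) + oint m (s t) (fun z => G (u (t, z))).
  move=> ht; apply: oint_split; [exact: ltW|exact: ms|].
  by apply: GuL1 => //; exact: hxT.
have X1 : oint a m (fun z => G (u (y, z)) - G (u (x, z))) =
    oint a m (fun z => G (u (y, z))) - oint a m (fun z => G (u (x, z))).
  by apply: ointB; apply: GuL1 => //; exact: ms.
pose g := G (u (x, s x)).
have sxa t : x <= t <= y -> a <= s t by move=> ht; apply: ltW; apply: s_gt; exact: hxT.
have nearG t z : x <= t <= y -> m <= z <= s t -> `|G (u (t, z)) - g| <= e.
  move=> ht /andP[mz zs]; apply: ltW; apply: (hd1 (t, z) (x, s x)).
  - by apply: Qcz => //; rewrite zs andbT (le_trans _ mz)// ltW.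
  - by apply: Qcz => //; rewrite lexx sxa.
  - have [st1 st2] := sm t ht; split; rewrite /ball /=.
      exact: le_lt_trans (dist_itv ht hx) hd1'.
    apply: le_lt_trans Ld1; rewrite ler_norml; apply/andP; split.
      by rewrite lerBrDl; exact: mz.
    by rewrite lerBlDl; exact: le_trans zs st2.
have Bterm t : x <= t <= y ->
    `|oint m (s t) (fun z => G (u (t, z))) - g * (s t - m)| <= e * (s t - m).
  move=> ht; have mst := ms t ht.
  have iG : L1i m (s t) (fun z => G (u (t, z))).
    by apply: GuL1; [exact: hxT|exact: ltW|].
  rewrite -oint_cst// -ointB//; last exact: L1i_cst.
  rewrite -oint_cst//; apply: oint_norm; [|exact: L1i_cst|].
    by apply: L1iB => //; exact: L1i_cst.
  by move=> z hz; exact: nearG.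
have isig : L1i x y sig by apply: L1iS (L1i_cont sig_cont).
have isG : L1i x y (fun t => sig t * G (u (t, s t))) by apply: L1iS (L1i_cont Gus_cont).
have Sterm : `|oint x y (fun t => sig t * G (u (t, s t))) - g * (s y - s x)| <= L * e * h.
  rewrite (s_inc x0 (ltW xy) yT) -ointZ// -ointB//; last exact: L1iZ.
  rewrite -oint_cst ?(ltW xy)//; apply: oint_norm; [|exact: L1i_cst|].
    by apply: L1iB => //; exact: L1iZ.
  move=> t ht; rewrite [g * _]mulrC -mulrBr normrM ler_pM//; first by apply: hL; exact: hxT.
  by apply: nearG => //; rewrite lexx ms.
have JE : oint x y J = \int[mu2]_(p in strip x y) P p +
    oint x y (fun t => sig t * G (u (t, s t))).
  have [i1 ->] := Rintegral_strip x y iP.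
  by rewrite -ointD.
have sub_bs : box x y a m `<=` strip x y by move=> p [].
have sE : \int[mu2]_(p in strip x y) P p = \int[mu2]_(p in box x y a m) P p +
    \int[mu2]_(p in strip x y `\` box x y a m) P p.
  rewrite -Rintegral_setU//.
  - by rewrite setDE setUIr setUCr setIT; congr (Rintegral _ _ _); apply/esym/setUidPr.
  - exact: measurableD.
  - apply: L1S iP => //; apply: measurableU => //; exact: measurableD.
  - by apply/disj_setPS => p [h1 [_ h2]].
pose box2 := box x y m (m + 2 * L * h).
have sE2 : \int[mu2]_(p in strip x y `\` box x y a m) P p =
    \int[mu2]_(p in box2 `\` box x y a m) P p.
  apply: eq_Rintegral_supp => -[t z]; rewrite /P [(ut \_ Q) _]patchE.
  case: ifPn => [/set_mem[/= h1 /andP[az zs]] _|_]; last by rewrite mulr0 eqxx.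
  split => -[h2 h3]; split => //.
  - move: h2 => [/= ht _]; split => //=; move: ht; rewrite !in_itv /= => ht.
    have [_] := sm t ht; rewrite -mE => st.
    rewrite (le_trans (ltW zs) st) andbT leNgt; apply/negP => zm; apply: h3.
    by split; rewrite /= in_itv //= ltW//= ltW.
  - by move: h2 => [? ?].
have mD2 : measurable (box2 `\` box x y a m).
  exact: measurableD (measurable_box _ _ _ _) (measurable_box _ _ _ _).
have mb2 : measurable box2 by exact: measurable_box.
have h2 : m <= m + 2 * L * h by rewrite lerDl mulr_ge0 ?(ltW hh)// mulr_ge0// ltW.
have [ic Ec] := box_cst (Nb / (2 * e)) (ltW xy) h2.
have iU2 D : measurable D -> mu2.-integrable D (EFin \o (fun p => Nb * e / 2 * (ut \_ Q) p ^+ 2)).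
  by move=> mD; apply: L1Z => //; apply: L1S ut_L2.
have c0 : 0 <= Nb / (2 * e) by rewrite divr_ge0 ?ltW// mulr_gt0.
have c1 : 0 <= Nb * e / 2 by rewrite divr_ge0// mulr_ge0// ltW.
have remainder : `|\int[mu2]_(p in strip x y `\` box x y a m) P p| <=
    Nb / (2 * e) * (h * (2 * L * h)) + Nb * e / 2 * oint x y N2.
  rewrite sE2; apply: (@le_trans _ _ (\int[mu2]_(p in box2 `\` box x y a m)
      (Nb / (2 * e) + Nb * e / 2 * (ut \_ Q) p ^+ 2))).
    apply: norm_Rintegral_le => //; first by apply: L1S iP.
      apply: L1D => //; last exact: iU2.
      by apply: L1S ic => //; exact: subDsetl.
    move=> p _; rewrite /P normrM.
    apply: le_trans (ler_wpM2r (normr_ge0 _) (hNb p)) _.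
    rewrite -(real_normK (num_real ((ut \_ Q) p))).
    set w := `|(ut \_ Q) p|.
    rewrite -subr_ge0.
    have -> : Nb / (2 * e) + Nb * e / 2 * w ^+ 2 - Nb * w = Nb / (2 * e) * (1 - e * w) ^+ 2.
      by field; rewrite gt_eqF.
    by rewrite mulr_ge0// sqr_ge0.
  apply: (@le_trans _ _ (\int[mu2]_(p in box2)
      (Nb / (2 * e) + Nb * e / 2 * (ut \_ Q) p ^+ 2))).
    apply: (Rintegral_subset mD2 mb2); first exact: subDsetl.
    - by apply: L1D; [exact: mb2|exact: ic|exact: iU2].
    - by move=> p _; rewrite addr_ge0// mulr_ge0// sqr_ge0.
  rewrite RintegralD//; last exact: iU2.
  rewrite Ec (addrC m) addrK lerD2l.
  have [iN EN] := Rintegral_strip x y ut_L2.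
  rewrite -EN -RintegralZl//; last by apply: L1S ut_L2.
  apply: (Rintegral_subset mb2 (measurable_strip x y)); [by move=> p []|exact: iU2|].
  by move=> p _; rewrite mulr_ge0// sqr_ge0.
have boxN1 : \int[mu2]_(p in box x y a m) `|(ut \_ Q) p| <= oint x y N1.
  have [iN EN] := Rintegral_strip x y iA.
  by rewrite -EN; apply: Rintegral_subset => //; apply: L1S iA.
have sp (f : R -> R) : L1i t1 y f -> oint t1 y f - oint t1 x f = oint x y f.
  by move=> jf; rewrite (oint_split t1x (ltW xy) jf); ring.
have AE : A y - A x = (4 * L + Nb * L) * h + oint x y N1 + Nb / 2 * oint x y N2.
  rewrite -(sp _ (Rintegral_strip t1 y iA).1) -(sp _ (Rintegral_strip t1 y ut_L2).1).
  rewrite /A; move: (oint t1 y N1) (oint t1 x N1) (oint t1 y N2) (oint t1 x N2) => *.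
  by rewrite /h; ring.
have PE : Phi y - Phi x = E y - E x - oint x y J.
  by rewrite -sp; [rewrite /Phi; ring|exact: iJ].
rewrite PE AE JE sE (GE y hy) (GE x hx).
have [sy1 sy2] := sm y hy.
have By := Bterm y hy; have Bx := Bterm x hx.
have dy : s y - m <= 2 * L * h by rewrite lerBlDl mE.
have dx : s x - m <= L * h by rewrite /m opprB addrC subrK.
rewrite X1 in RI.
set Oy := oint m (s y) _ in By *; set Ox := oint m (s x) _ in Bx *.
set Gy := oint a m (fun z => G (u (y, z))) in RI *.
set Gx := oint a m (fun z => G (u (x, z))) in RI *.
set PB := \int[mu2]_(p in box x y a m) P p in RI *.
set PD := \int[mu2]_(p in strip x y `\` _) P p in remainder *.
set SG := oint x y _ in Sterm *.
set AB := \int[mu2]_(p in box x y a m) `|_| in RI boxN1.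
set n1 := oint x y N1 in boxN1 *; set n2 := oint x y N2 in remainder *.
have n20 : 0 <= n2.
  apply: oint_ge0 => t _; apply: Rintegral_ge0 => z _; exact: sqr_ge0.
have -> : Gy + Oy - (Gx + Ox) - (PB + PD + SG) =
  (Gy - Gx - PB) - PD + (Oy - g * (s y - m)) - (Ox - g * (s x - m)) - (SG - g * (s y - s x)).
  ring.
have tri (p q r v w : R) : `|p - q + r - v - w| <= `|p| + `|q| + `|r| + `|v| + `|w|.
  apply: le_trans (ler_normB _ _) _; rewrite lerD2r.
  apply: le_trans (ler_normB _ _) _; rewrite lerD2r.
  apply: le_trans (ler_normD _ _) _; rewrite lerD2r.
  exact: ler_normB.
apply: le_trans (tri _ _ _ _ _) _.
have q1 : `|Gy - Gx - PB| <= e * n1 by exact: le_trans RI (ler_wpM2l (ltW e0) boxN1).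
have q3 : `|Oy - g * (s y - m)| <= e * (2 * L * h).
  exact: le_trans By (ler_wpM2l (ltW e0) dy).
have q4 : `|Ox - g * (s x - m)| <= e * (L * h).
  exact: le_trans Bx (ler_wpM2l (ltW e0) dx).
have q2 : `|PD| <= e * (Nb * L * h + Nb / 2 * n2).
  apply: le_trans remainder _.
  have -> : Nb / (2 * e) * (h * (2 * L * h)) + Nb * e / 2 * n2 =
     e * (Nb * L * h * (h / e ^+ 2) + Nb / 2 * n2).
    by field; rewrite gt_eqF.
  rewrite ler_pM2l// lerD2r ler_piMr//; first by rewrite !mulr_ge0// ltW.
  by rewrite ler_pdivrMr ?exprn_gt0// mul1r ltW.
have -> : e * ((4 * L + Nb * L) * h + n1 + Nb / 2 * n2) =
  e * n1 + e * (Nb * L * h + Nb / 2 * n2) + e * (2 * L * h) + e * (L * h) + L * e * h.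
  ring.
by rewrite !lerD.
Qed.

End moving_domain.

(** * The energy inequality *)

Section one_dimensional.
Context {R : realType}.
Local Notation mu := (@lebesgue_measure R).
Implicit Types (f g : R -> R).

Lemma continuous_eq0_rat (c d : R) f : c < d -> {within `[c, d], continuous f} ->
  (forall q : rat, c < ratr q < d -> f (ratr q) = 0) ->
  forall x, c <= x <= d -> f x = 0.
Proof.
move=> cd cf f0 x /andP[cx xd]; apply/eqP; rewrite -normr_le0.
apply/ler_addgt0Pr => e e0; rewrite add0r.
have [del del0 h] := compact_unif_continuous (segment_compact (a := c) (b := d)) cf e0.
have lt : Num.max c (x - del) < Num.min d (x + del).
  rewrite lt_min !gt_max cd; apply/andP; split; apply/andP; split=> //; lra.
have [q] := rat_in_itvoo lt.
rewrite in_itv /= gt_max lt_min => /andP[/andP[cq xq] /andP[qd qx]].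
have fq : f (ratr q) = 0 by apply: f0; rewrite cq.
have h1 : `[c, d]%classic x by rewrite /= in_itv /= cx.
have h2 : `[c, d]%classic (ratr q) by rewrite /= in_itv /= !ltW.
have := h x (ratr q) h1 h2; rewrite fq subr0 => h3; apply: ltW; apply: h3.
by rewrite /ball /= ltr_norml; apply/andP; split; lra.
Qed.

(** A continuous representative with an integrable weak derivative. *)
Lemma weak_deriv1_increment (al be x y : R) f g : al <= x -> x < y -> y <= be ->
  {within `[x, y], continuous f} -> L1i x y g -> weak_deriv1 `]al, be[ f g ->
  f y - f x = oint x y g.
Proof.
move=> ax xy yb cf ig W; apply: (plateau_increment xy cf ig) => n nd.
have n0 : 0 < (n%:R : R).
  by rewrite ltr0n lt0n; apply/negP => /eqP n0; move: nd; rewrite n0 mul0r; lra.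
have iv0 : 0 < (n%:R : R)^-1 by rewrite invr_gt0.
have T : test_function `]al, be[ (plateau x y n).
  apply: (@test_function_itv _ al be (x + n%:R^-1) (y - n%:R^-1)) => //.
  - by rewrite (le_lt_trans ax)// ltrDl.
  - by rewrite (lt_le_trans _ yb)// gtrBl.
  - by move=> m; exact: Cn_plateau.
  - by move=> z; exact: plateau_supp.
have D1 z : 'D_1 (plateau x y n) z = derive1 (plateau x y n) z by rewrite derive1E.
have sub (h : R -> R) : (forall z, h z != 0 -> x < z < y) ->
    oint x y h = \int[mu]_(z in `]al, be[) h z.
  move=> hs; rewrite /oint; apply: eq_Rintegral_supp => z /hs /andP[xz zy].
  by rewrite /= !in_itv /= (le_lt_trans ax)// (lt_le_trans zy)// !ltW.
rewrite !sub; first by rewrite -(W _ T); apply: eq_Rintegral => z _; rewrite D1.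
- by move=> z; rewrite mulf_eq0 negb_or => /andP[_ /(plateau_supp_oo nd)].
- by move=> z; rewrite mulf_eq0 negb_or => /andP[_ /(derive1_plateau_supp nd)].
Qed.

(** The chain rule for a primitive of a continuous function. *)
Lemma chain_increment (c d : R) f f1 (G G1 : R -> R) :
  {within `[c, d], continuous f} -> {within `[c, d], continuous f1} ->
  (forall x y, c <= x -> x <= y -> y <= d -> f y - f x = oint x y f1) ->
  (forall x : R, is_derive x (1 : R) G (G1 x)) -> continuous G1 ->
  forall x y, c <= x -> x <= y -> y <= d ->
    G (f y) - G (f x) = oint x y (fun z => G1 (f z) * f1 z).
Proof.
move=> cf cf1 fE dG cG1 x y cx; rewrite le_eqVlt => /predU1P[->|xy] yd.
  by rewrite subrr oint_xx.
have sub : `[x, y] `<=` `[c, d] by apply: subset_itv; rewrite bnd_simp.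
have cfx := continuous_subspaceW sub cf; have cf1x := continuous_subspaceW sub cf1.
have cG : continuous G.
  by move=> z; apply/differentiable_continuous/derivable1_diffP; apply: ex_derive.
have cGf : {within `[x, y], continuous (G \o f)}.
  by apply: (within_continuous_comp (B := setT) cfx) => //; exact: continuous_subspaceT.
have cG1f : {within `[x, y], continuous (G1 \o f)}.
  by apply: (within_continuous_comp (B := setT) cfx) => //; exact: continuous_subspaceT.
rewrite -[G (f y)]/((G \o f) y) -[G (f x)]/((G \o f) x); symmetry.
apply: oint_FTC2 => //.
  by move=> z; apply: cvgM; [exact: cG1f|exact: cf1x].
move=> z /andP[xz zy].
have cz : {for z, continuous f1}.
  have /(continuous_within_itvP _ xy)[h _ _] := cf1x.
  by apply: h; rewrite in_itv /= xz.
have [dF F1] := continuous_FTC1_closed zy (L1i_cont cf1x) xz cz.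
have df : is_derive z (1 : R) f (f1 z).
  apply: (@near_eq_is_derive R R R (fun w => cst (f x) w + oint x w f1)).
    near=> w; rewrite /= -fE//; first by rewrite subrKC.
    - by apply: ltW; near: w; exact: lt_nbhsr.
    - by apply: le_trans yd; apply: ltW; near: w; exact: lt_nbhsl.
  have h : is_derive z (1 : R) (fun w => oint x w f1) (f1 z).
    exact: DeriveDef dF (etrans (esym (derive1E _ _)) F1).
  by have := is_deriveD (is_derive_cst (f x) z (1:R)) h; rewrite add0r.
exact: (@is_derive1_comp R G f z _ _ (dG _) df).
Unshelve. all: by end_near. Qed.

(** The mean square slope is at least the square of the mean slope. *)
Lemma slope_square (c d : R) g (l : R) : c < d -> {within `[c, d], continuous g} ->
  oint c d g = l -> l ^+ 2 / (d - c) <= oint c d (fun z => g z ^+ 2).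
Proof.
move=> cd cg gl; have dc : 0 < d - c by rewrite subr_gt0.
have ig := L1i_cont cg.
have ig2 : L1i c d (fun z => g z ^+ 2).
  by apply: L1i_cont => z; apply: cvgM; exact: cg.
pose q := l / (d - c).
have : 0 <= oint c d (fun z => (g z ^+ 2 - 2 * q * g z) + q ^+ 2).
  apply: oint_ge0 => z _.
  have -> : g z ^+ 2 - 2 * q * g z + q ^+ 2 = (g z - q) ^+ 2 by ring.
  exact: sqr_ge0.
have i1 : L1i c d (fun z => 2 * q * g z) by exact: L1iZ.
have i2 : L1i c d (fun=> q ^+ 2) by exact: L1i_cst.
have i3 : L1i c d (fun z => g z ^+ 2 - 2 * q * g z) by exact: L1iB.
rewrite ointD// ointB// ointZ// oint_cst ?(ltW cd)// gl.
set X := oint _ _ _ => h.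
have E : X - 2 * q * l + q ^+ 2 * (d - c) = X - l ^+ 2 / (d - c).
  by rewrite /q; field; rewrite gt_eqF.
by rewrite E subr_ge0 in h.
Qed.

Lemma L2_L1 d (X : measurableType d) (nu : {measure set X -> \bar R}) (B : set X)
    (K : X -> R) : measurable B -> nu.-integrable B (EFin \o (fun=> 1)) ->
  (forall p, K p != 0 -> B p) -> K \in Lfun nu 2%:E ->
  nu.-integrable setT (EFin \o K).
Proof.
move=> mB i1 KB KL.
have mK : measurable_fun setT K by move: KL; rewrite inE => /andP[/[!inE]].
have iB : nu.-integrable B (EFin \o K).
  apply: (@L1_dom _ _ _ _ _ _ (fun p => 1 + K p ^+ 2)) => //.
  - exact: measurable_funS mK.
  - move=> p _; rewrite -[K p ^+ 2]real_normK ?num_real//.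
    have := sqr_ge0 (`|K p| - 2^-1); set w := `|K p|; rewrite sqrrB; lra.
  - by apply: L1D => //; apply: L1S (Lfun2_integrable_sqr KL).
have -> : K = K \_ B.
  apply/funext => p; rewrite patchE; case: ifPn => // /negP nB.
  by apply/eqP; apply: contrapT => /negP /KB Bp; apply: nB; rewrite inE.
exact/L1_restrict.
Qed.

End one_dimensional.

Section energy.
Context {R : realType}.
Local Notation mu := (@lebesgue_measure R).
Local Notation mu2 := (@lebesgue_measure R \x @lebesgue_measure R)%E.
Variables (a a0 H k : R) (beta varphi b : R -> R) (s0 : R) (u0 : R -> R) (T : R).
Variables (s : R -> R) (u : R * R -> R) (st : R -> R) (ut uz uzz : R * R -> R).
Hypothesis T_gt0 : 0 < T.
Hypothesis k_gt0 : 0 < k.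
Hypothesis beta_cont : continuous beta.
Hypothesis varphi_cont : continuous varphi.
Hypothesis b_cont : {within `[0, T], continuous b}.
Hypothesis sol : solution_with a a0 H k beta varphi b s0 u0 T s u st ut uz uzz.

Local Notation Q := (Qdom a s T).

Let sig t := a0 * (u (t, s t) - varphi (s t)).

Let s_gt := sol_s_gt sol.
Let s_cont := sol_s_cont sol.
Let u_cont := sol_u_cont sol.
Let us_cont := trace_s_cont s_gt s_cont u_cont.
Let ua_cont := trace_a_cont s_gt u_cont.

Let varphi_s_cont : {within `[0, T], continuous (varphi \o s)}.
Proof.
by apply: (within_continuous_comp (B := setT) s_cont) => //; exact: continuous_subspaceT.
Qed.

Let sig_cont : {within `[0, T], continuous sig}.
Proof.
move=> t; apply: cvgM; first exact: cvg_cst.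
by apply: cvgB; [exact: us_cont|exact: varphi_s_cont].
Qed.

(** The free boundary condition gives the weak derivative [st] a continuous
    representative, so the boundary curve is of class C^1. *)
Let s_inc x y : 0 <= x -> x <= y -> y <= T -> s y - s x = oint x y sig.
Proof.
move=> x0; rewrite le_eqVlt => /predU1P[->|xy] yT; first by rewrite subrr oint_xx.
have sub : `[x, y] `<=` `[0, T] by apply: subset_itv; rewrite bnd_simp.
have [_ stL sW] := sol_s_W1oo sol.
apply: (weak_deriv1_increment x0 xy yT) => //.
- exact: continuous_subspaceW sub s_cont.
- exact: L1iS (L1i_cont sig_cont).
move=> phi tphi; rewrite sW//; congr (- _).
have mst : measurable_fun `]0, T[ st.
  move: stL; rewrite /in_Lp inE => /andP[/[!inE]/= m _].
  apply: eq_measurable_fun (measurable_funTS (D := `]0, T[) m) => z zT.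
  by rewrite patchE zT.
have isig : mu.-integrable `]0, T[ (EFin \o sig).
  by apply: L1S (L1i_cont sig_cont) => //; exact: subset_itv_oo_cc.
have ae_st : {ae mu, forall t, `]0, T[%classic t -> sig t = st t}.
  by apply: leb_aeS (sol_fb sol) => t h; rewrite /= in_itv /= => /h.
have ist : mu.-integrable `]0, T[ (EFin \o st).
  by apply: L1_ae_eq isig _ => //; exact: measurable_itv.
have [phi_smooth phi_compact _] := tphi.
have cphi : continuous phi by have [] := phi_smooth [::].
have [M [_ hM]] : bounded_set (phi @` `[0, T]).
  apply: compact_bounded; apply: continuous_compact; last exact: segment_compact.
  exact: continuous_subspaceT.
have mphi : measurable_fun (`]0, T[%classic : set (measurableTypeR R)) phi.
  by apply: measurable_funTS; exact: continuous_measurable_fun.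
have bphi t : `]0, T[%classic t -> `|phi t| <= `|M| + 1.
  move=> tT; apply: hM; first by apply: le_lt_trans (ler_norm _) _; rewrite ltrDl.
  by exists t => //; exact: subset_itv_oo_cc.
have mI : measurable (`]0, T[%classic : set (measurableTypeR R)) by exact: measurable_itv.
apply: ae_eq_Rintegral => //.
- rewrite (_ : (fun x => st x * phi x) = (fun x => phi x * st x)).
    exact: (L1_bmul mI mphi bphi ist).
  by apply/funext => w; rewrite mulrC.
- rewrite (_ : (fun x => sig x * phi x) = (fun x => phi x * sig x)).
    exact: (L1_bmul mI mphi bphi isig).
  by apply/funext => w; rewrite mulrC.
- by apply: leb_aeS ae_st => t h /h ->.
Qed.

Let s_bound : exists2 B : R, a < B & forall t, 0 <= t <= T -> s t <= B.
Proof.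
have [c cT hc] := EVT_max (ltW T_gt0) s_cont.
exists (s c); first by apply: s_gt; rewrite in_itv in cT.
by move=> t ht; apply: hc; rewrite in_itv.
Qed.

Let Q_box : exists B : R, [/\ a <= B, mu2.-integrable (box 0 T a B) (EFin \o (fun=> 1)) &
  Q `<=` box 0 T a B].
Proof.
have [B aB hB] := s_bound; exists B; split; first exact: ltW.
  exact: (box_cst 1 (ltW T_gt0) (ltW aB)).1.
move=> [t z] [/= /andP[t0 tT] /andP[az zs]]; split; rewrite /= in_itv /= !ltW//=.
by apply: lt_le_trans zs _; apply: hB; rewrite !ltW.
Qed.

Let Lp2_L1 (v : R * R -> R) : in_Lp mu2 2%:E Q v ->
  mu2.-integrable setT (EFin \o (v \_ Q)).
Proof.
have [B [aB i1 QB]] := Q_box.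
apply: (L2_L1 (measurable_box 0 T a B) i1) => p.
by rewrite patchE; case: ifPn => [/set_mem/QB//|_]; rewrite eqxx.
Qed.

Let ut_L1 := Lp2_L1 (sol_ut_L2 sol).
Let uz_L1 := Lp2_L1 (sol_uz_L2 sol).
Let uzz_L1 := Lp2_L1 (sol_uzz_L2 sol).
Let ut_L2 := Lfun2_integrable_sqr (sol_ut_L2 sol).

Let uQ_meas : measurable_fun [set: (measurableTypeR R * measurableTypeR R)%type] (u \_ Q).
Proof. by have := sol_u_Loo sol; rewrite /in_Lp inE => /andP[/[!inE]]. Qed.

Let u_L1 : mu2.-integrable setT (EFin \o (u \_ Q)).
Proof.
have [B [aB i1 QB]] := Q_box.
have [M M0 hM] := u_bounded s_gt s_cont u_cont.
have -> : u \_ Q = (u \_ Q) \_ (box 0 T a B).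
  apply/funext => p; rewrite [RHS]patchE; case: ifPn => // /negP nB.
  by rewrite patchE; case: ifPn => // /set_mem/QB Bp; case: nB; rewrite inE.
apply/L1_restrict => //.
apply: (@L1_dom _ _ _ _ _ _ (fun=> M * 1)) => //; last exact: L1Z.
  by apply: measurable_funTS; exact: uQ_meas.
move=> p _; rewrite mulr1 patchE; case: ifPn => [/set_mem/sub_Qdom/hM//|_].
by rewrite normr0.
Qed.

(* Countably many rational rectangles [(q1, q2) * (a, q)] cover the domain up to the
   moving end; continuity of the slice extends the identity to all abscissas. *)
Let uz_slice_ae : {ae mu, forall t, 0 < t < T ->
  mu.-integrable setT (EFin \o (fun z => (uzz \_ Q) (t, z))) /\
  forall x y, a <= x -> x <= y -> y <= s t ->
    uz (t, y) - uz (t, x) = oint x y (fun z => (uzz \_ Q) (t, z))}.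
Proof.
pose S (q : rat * rat * rat) t := let al : R := ratr q.1.1 in
  let be : R := ratr q.1.2 in let d : R := ratr q.2 in
  a < d -> (forall t z, al < t < be -> a < z < d -> Q (t, z)) ->
  al < t < be -> {within `[a, d], continuous (fun z => uz (t, z))} ->
  uz (t, d) - uz (t, a) = oint a d (fun z => (uzz \_ Q) (t, z)).
have aeS : {ae mu, forall t, forall n : nat,
    if unpickle n is Some q then S q t else True}.
  apply: ae_foralln => n; case: (unpickle n) => [q|]; last exact: aeW.
  have [ad|da] := ltP a (ratr q.2); last first.
    by apply: aeW => t; rewrite /S /= ltNge da.
  have [hQ|hQ] := pselect (forall t z, (ratr q.1.1 : R) < t < ratr q.1.2 ->
      a < z < ratr q.2 -> Q (t, z)); last by apply: aeW => t; rewrite /S /= => _ /hQ.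
  have := slice_increment_z uz_L1 uzz_L1 (sol_uzz sol) ad hQ.
  by apply: leb_aeS => t h; rewrite /S /= => _ _ /h[].
have [_ _ aei] := Rfubini1 uzz_L1.
have := leb_aeS2 (fun x p q => conj p q) aeS aei.
apply: leb_aeS2 (sol_uz_cont sol) => t hc [hS ii] ht; split => //.
have cuz := hc ht.
have ht' : 0 <= t <= T by move: ht => /andP[? ?]; rewrite !ltW.
have as_ : a < s t by exact: s_gt.
have ii' x y : L1i x y (fun z => (uzz \_ Q) (t, z)) by apply: L1S ii.
pose D z := uz (t, z) - uz (t, a) - oint a z (fun z => (uzz \_ Q) (t, z)).
have cD : {within `[a, s t], continuous D}.
  have c1 : {within `[a, s t], continuous (fun z => oint a z (fun z => (uzz \_ Q) (t, z)))}.
    by apply: (@parameterized_integral_continuous _ a (s t) _ (ltW as_)); exact: ii'.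
  move=> z; apply: cvgB; last exact: c1.
  by apply: cvgB; [exact: cuz|exact: cvg_cst].
have D0 : forall z, a <= z <= s t -> D z = 0.
  apply: continuous_eq0_rat => // q /andP[aq qs].
  have [e e0 he] : exists2 e, 0 < e & forall t', `|t' - t| < e -> 0 < t' < T /\ ratr q < s t'.
    have /andP[t0 tT] := ht.
    have gap : 0 < s t - ratr q by rewrite subr_gt0.
    have [e1 e10 h1] := compact_unif_continuous (segment_compact (a := 0) (b := T)) s_cont gap.
    exists (Num.min e1 (Num.min t (T - t))); first by rewrite !lt_min e10 t0 subr_gt0.
    move=> t'; rewrite !lt_min => /and3P[h2]; rewrite !ltr_norml => /andP[h3 _] /andP[_ h4].
    have ht1 : 0 < t' < T by apply/andP; split; lra.
    split => //.
    have tT' : `[0, T]%classic t' by rewrite /= in_itv /=; move: ht1 => /andP[? ?]; rewrite !ltW.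
    have tT1 : `[0, T]%classic t by rewrite /= in_itv.
    have : `|s t' - s t| < s t - ratr q by exact: (h1 t' t tT' tT1 h2).
    by rewrite ltr_norml opprB => /andP[+ _]; rewrite ltrBrDr subrK.
  have lt1 : t - e < t by lra.
  have lt2 : t < t + e by lra.
  have [q1] := rat_in_itvoo lt1; rewrite in_itv /= => /andP[q11 q12].
  have [q2] := rat_in_itvoo lt2; rewrite in_itv /= => /andP[q21 q22].
  have := hS (pickle ((q1, q2), q)); rewrite pickleK /S /= => /(_ aq) h.
  have near_t t' : ratr q1 < t' < ratr q2 -> `|t' - t| < e.
    by move=> /andP[? ?]; rewrite ltr_norml; apply/andP; split; lra.
  have {}h : uz (t, ratr q) - uz (t, a) = oint a (ratr q) (fun z => (uzz \_ Q) (t, z)).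
    apply: h.
    - move=> t' z /near_t/he[ht1 hs] /andP[az zq].
      by split => //=; rewrite az (lt_trans zq).
    - by rewrite q12.
    - by apply: continuous_subspaceW cuz; apply: subset_itv; rewrite bnd_simp// ltW.
  by rewrite /D h subrr.
move=> x y ax xy ys.
have h1 := D0 x; have h2 := D0 y.
rewrite ax (le_trans xy ys) in h1; rewrite ys (le_trans ax xy) in h2.
have := h2 isT; have := h1 isT; rewrite /D.
rewrite (oint_split ax xy (ii' a y)); lra.
Qed.

Let u_slice t : 0 < t < T -> {within `[a, s t], continuous (fun z => uz (t, z))} ->
  forall x y, a <= x -> x <= y -> y <= s t ->
    u (t, y) - u (t, x) = oint x y (fun z => uz (t, z)).
Proof.
move=> ht cuz x y ax; rewrite le_eqVlt => /predU1P[->|xy] ys.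
  by rewrite subrr oint_xx.
have ht' : 0 <= t <= T by move: ht => /andP[? ?]; rewrite !ltW.
have [_ _ W] := sol_uz_slice sol ht'.
apply: (weak_deriv1_increment (f := fun z => u (t, z)) ax xy ys) => //.
- exact: (slice_cont u_cont ht' ax ys).
- by apply: L1iS (L1i_cont cuz).
Qed.

Variables (G G1 G2 : R -> R) (gam : R).
Hypothesis G_der : forall x : R, is_derive x (1 : R) G (G1 x).
Hypothesis G1_der : forall x : R, is_derive x (1 : R) G1 (G2 x).
Hypothesis G2_cont : continuous G2.
Hypothesis G2_ge : forall x, gam <= G2 x.
Hypothesis gam_ge0 : 0 <= gam.

Let G1_cont : continuous G1.
Proof. by move=> x; apply/differentiable_continuous/derivable1_diffP; apply: ex_derive. Qed.

Let G_cont : continuous G.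
Proof. by move=> x; apply/differentiable_continuous/derivable1_diffP; apply: ex_derive. Qed.

(** A bound for the time derivative of int_a^s G(u) that involves [u] only through its
    traces. *)
Definition dissipation_rate (t : R) : R :=
  a0 * (u (t, s t) - varphi (s t)) * (G (u (t, s t)) - u (t, s t) * G1 (u (t, s t)))
  + beta (b t - H * u (t, a)) * G1 (u (t, a))
  - k * gam * ((u (t, s t) - u (t, a)) ^+ 2 / (s t - a)).

Let comp_cont (F v : R -> R) : continuous F -> {within `[0, T], continuous v} ->
  {within `[0, T], continuous (F \o v)}.
Proof.
move=> cF cv; apply: (within_continuous_comp (B := setT) cv) => //.
exact: continuous_subspaceT.
Qed.

Lemma dissipation_rate_cont : {within `[0, T], continuous dissipation_rate}.
Proof.
have cG := comp_cont G_cont us_cont.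
have cG1 := comp_cont G1_cont us_cont.
have cG1a := comp_cont G1_cont ua_cont.
have cb : {within `[0, T], continuous (fun t => b t - H * u (t, a))}.
  move=> t; apply: cvgB; first exact: b_cont.
  by apply: cvgM; [exact: cvg_cst|exact: ua_cont].
have cbeta := comp_cont beta_cont cb.
have csa : {within `[0, T], continuous (fun t => (s t - a)^-1)}.
  apply/subspace_continuousP => t tT.
  apply: cvgV; first by rewrite gt_eqF// subr_gt0; apply: s_gt; move: tT; rewrite /= in_itv.
  apply: cvgB; last exact: cvg_cst.
  by have /subspace_continuousP/(_ t tT) := s_cont.
have cd : {within `[0, T], continuous (fun t => u (t, s t) - u (t, a))}.
  by move=> t; apply: cvgB; [exact: us_cont|exact: ua_cont].
move=> t; apply: cvgB; first apply: cvgD.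
- apply: cvgM; first exact: sig_cont.
  by apply: cvgB; [exact: cG|apply: cvgM; [exact: us_cont|exact: cG1]].
- by apply: cvgM; [exact: cbeta|exact: cG1a].
- apply: cvgM; first exact: cvg_cst.
  apply: cvgM; last exact: csa.
  by apply: cvgM; exact: cd.
Qed.

(** Integration by parts on almost every slice moves one space derivative of [u] to
    [G1 \o u]; the boundary conditions then replace the traces of [uz]. *)
Lemma energy_inequality (t1 t2 : R) : 0 <= t1 -> t1 <= t2 -> t2 <= T ->
  oint a (s t2) (fun z => G (u (t2, z))) - oint a (s t1) (fun z => G (u (t1, z))) <=
  oint t1 t2 dissipation_rate.
Proof.
move=> t10 t12 t2T.
have [iJ ->] := moving_domain_increment T_gt0 s_gt sig_cont s_inc s_cont u_cont
  uQ_meas u_L1 ut_L1 ut_L2 (sol_ut sol) G_der G1_cont t10 t12 t2T.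
have iP := composed_ut_L1 s_gt s_cont u_cont uQ_meas ut_L1 G1_cont.
have iP' := composed_ut_L1 s_gt s_cont u_cont uQ_meas uzz_L1 G1_cont.
have isG : L1i t1 t2 (fun t => sig t * G (u (t, s t))).
  have c : {within `[0, T], continuous (fun t => sig t * G (u (t, s t)))}.
    by move=> t; apply: cvgM; [exact: sig_cont|exact: (comp_cont G_cont us_cont)].
  exact: L1iS (L1i_cont c).
have [i1 E1] := Rintegral_strip t1 t2 iP.
have [i2 E2] := Rintegral_strip t1 t2 iP'.
have heat : oint t1 t2 (fun t => \int[mu]_z (G1 ((u \_ Q) (t, z)) * (ut \_ Q) (t, z))) =
    k * oint t1 t2 (fun t => \int[mu]_z (G1 ((u \_ Q) (t, z)) * (uzz \_ Q) (t, z))).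
  rewrite -E1 -E2 -RintegralZl//; last by apply: L1S iP'.
  apply: ae_eq_Rintegral => //; [by apply: L1S iP|by apply: L1Z => //; apply: L1S iP'|].
  apply: (negligibleS _ (sol_heat sol)) => p /= nS h; apply: nS => _; rewrite !patchE.
  case: ifPn => [/set_mem/h/eqP|_]; last by rewrite !mulr0.
  by rewrite subr_eq0 => /eqP ->; rewrite mulrCA.
rewrite (ointD i1 isG) heat -(ointZ k i2) -(ointD (L1iZ k i2) isG).
apply: ae_oint_le.
- exact: L1iD (L1iZ k i2) isG.
- exact: L1iS (L1i_cont dissipation_rate_cont).
have bc := leb_aeS2 (fun x p q => conj p q)
  (leb_aeS2 (fun x p q => conj p q) (sol_bc_a sol) (sol_bc_s sol))
  (leb_aeS2 (fun x p q => conj p q) (sol_fb sol) (sol_uz_cont sol)).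
apply: leb_aeS2 bc uz_slice_ae => t [[hba hbs] [hfb huzc]] hsl /andP[t1t tt2].
have ht : 0 < t < T by rewrite (le_lt_trans t10)//= (lt_le_trans tt2).
have ht' : 0 <= t <= T by move: ht => /andP[? ?]; rewrite !ltW.
have as_ : a < s t by exact: s_gt.
have cuz := huzc ht.
have [iuzz uzE] := hsl ht.
have uE := u_slice ht cuz.
have cu : {within `[a, s t], continuous (fun z => u (t, z))} by exact: (slice_cont u_cont ht' (lexx a) (lexx (s t))).
have G1E := chain_increment cu cuz uE G1_der G2_cont.
have cc (F : R -> R) : continuous F -> {within `[a, s t], continuous (fun z => F (u (t, z)))}.
  move=> cF; apply: (within_continuous_comp (B := setT) cu) => //.
  exact: continuous_subspaceT.
have cG2uz : {within `[a, s t], continuous (fun z => G2 (u (t, z)) * uz (t, z))}.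
  by move=> z; apply: cvgM; [exact: (cc _ G2_cont)|exact: cuz].
have iuzz' : L1i a (s t) (fun z => (uzz \_ Q) (t, z)) by apply: L1S iuzz.
have PI := oint_parts (ltW as_) (cc _ G1_cont) cuz (L1i_cont cG2uz) iuzz' G1E uzE.
have -> : \int[mu]_z (G1 ((u \_ Q) (t, z)) * (uzz \_ Q) (t, z)) =
    oint a (s t) (fun z => G1 (u (t, z)) * (uzz \_ Q) (t, z)).
  rewrite /oint (@eq_Rintegral_supp R _ _ mu setT `[a, s t]); last first.
    move=> z; rewrite mulf_eq0 negb_or [(uzz \_ Q) _]patchE => /andP[_].
    case: ifPn => [/set_mem[/= _ /andP[az zs]] _|_]; last by rewrite eqxx.
    by rewrite in_itv /= !ltW.
  apply: eq_Rintegral => z _; rewrite !patchE.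
  by case: ifPn => //; rewrite !mulr0.
rewrite PI.
have := hba ht; have := hbs ht; rewrite (hfb ht) -/(sig t) => e1 e2.
have slope : gam * ((u (t, s t) - u (t, a)) ^+ 2 / (s t - a)) <=
    oint a (s t) (fun z => G2 (u (t, z)) * uz (t, z) * uz (t, z)).
  have iz2 : L1i a (s t) (fun z => uz (t, z) ^+ 2).
    by apply: L1i_cont => z; apply: cvgM; exact: cuz.
  apply: (@le_trans _ _ (gam * oint a (s t) (fun z => uz (t, z) ^+ 2))).
    rewrite ler_wpM2l//; apply: slope_square => //.
    by rewrite -uE ?lexx ?ltW.
  rewrite -ointZ//; apply: oint_le; first exact: L1iZ.
    by apply: L1i_cont => z; apply: cvgM; [exact: cG2uz|exact: cuz].
  by move=> z _; rewrite -mulrA ler_wpM2r// sqr_ge0.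
set I2 := oint _ _ _ in slope *.
set us := u (t, s t) in e1 slope *; set ua := u (t, a) in e2 slope *.
rewrite /dissipation_rate -/(sig t) -/us -/ua.
have e1' : k * uz (t, s t) = - (us * sig t) by rewrite -e1; ring.
have e2' : k * uz (t, a) = - beta (b t - H * ua) by rewrite -e2; ring.
have -> : k * (G1 us * uz (t, s t) - G1 ua * uz (t, a) - I2) + sig t * G us =
  G1 us * (k * uz (t, s t)) - G1 ua * (k * uz (t, a)) - k * I2 + sig t * G us by ring.
rewrite e1' e2'.
have : k * (gam * ((us - ua) ^+ 2 / (s t - a))) <= k * I2 by rewrite ler_pM2l.
set Y := _ / (s t - a); set B := beta _; set v := sig t => hY.
rewrite -subr_ge0 (_ : _ - _ = k * I2 - k * (gam * Y)) ?subr_ge0//.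
by ring.
Qed.

End energy.

(** * Truncations and structure functions *)

Section truncations.
Context {R : realType}.

Definition pospow (n : nat) (x : R) : R := Num.max x 0 ^+ n.

Lemma pospow_ge0 n x : 0 <= pospow n x.
Proof. by apply: exprn_ge0; rewrite le_max lexx orbT. Qed.

Lemma pospow_le0 n x : x <= 0 -> pospow n.+1 x = 0.
Proof. by move=> x0; rewrite /pospow max_r// expr0n. Qed.

Lemma pospow_gt0E n x : 0 <= x -> pospow n x = x ^+ n.
Proof. by move=> x0; rewrite /pospow max_l. Qed.

Lemma pospow_cont n : continuous (pospow n).
Proof.
have c1 : continuous (fun x : R => Num.max x 0).
  by move=> x; apply: continuous_max; [exact: cvg_id|exact: cvg_cst].
move=> x; rewrite /pospow; apply: (@continuous_comp _ _ _ (fun x : R => Num.max x 0) (fun y => y ^+ n)).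
  exact: c1.
exact: exprn_continuous.
Qed.

Lemma is_derive_pospow n x :
  is_derive x (1 : R) (pospow n.+2) (n.+2%:R * pospow n.+1 x).
Proof.
have [x0|x0|->] := ltgtP x 0.
- rewrite pospow_le0 ?(ltW x0)// mulr0.
  apply: (@near_eq_is_derive R R R (cst 0)).
  near=> y; rewrite /= pospow_le0//; apply: ltW.
  by near: y; exact: lt_nbhsl.
- rewrite pospow_gt0E ?(ltW x0)//.
  apply: (@near_eq_is_derive R R R (fun y => y ^+ n.+2)).
    near=> y; rewrite pospow_gt0E//; apply: ltW.
    by near: y; exact: lt_nbhsr.
  apply: DeriveDef; first exact: exprn_derivable.
  by rewrite exp_derive /GRing.scale /= mulr1.
- rewrite pospow_le0// mulr0.
  have cv : (h^-1 *: (pospow n.+2 (h *: 1 + 0) - pospow n.+2 0)) @[h --> 0^'] --> (0:R).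
    apply/cvgr0Pnorm_le => /= e e0.
    near=> h.
    have h1 : `|h| <= 1 by near: h; exact: dnbhs0_le.
    have he : `|h| <= e by near: h; exact: dnbhs0_le.
    rewrite [pospow _ 0]pospow_le0// subr0 addr0 /GRing.scale /= mulr1.
    have [h0|h0] := ltP 0 h; last by rewrite pospow_le0// mulr0 normr0 ltW.
    rewrite gtr0_norm// in h1 he.
    rewrite pospow_gt0E ?(ltW h0)// exprS mulKf ?gt_eqF// normrX gtr0_norm//.
    apply: le_trans he; rewrite exprS ler_piMr// ?(ltW h0)//.
    by rewrite exprn_ile1// ltW.
  by apply: DeriveDef; [apply/cvg_ex; exists 0|exact/cvg_lim].
Unshelve. all: by end_near. Qed.

Lemma is_derive_pospow_affine n (p q x : R) :
  is_derive x (1 : R) (fun x => pospow n.+2 (p * x + q))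
    (p * (n.+2%:R * pospow n.+1 (p * x + q))).
Proof.
have := @is_derive1_comp R (pospow n.+2) (fun x => p * x + q) x _ _
  (is_derive_pospow n _) (is_derive_affine p q x).
by rewrite mulrC.
Qed.

Lemma pospow_affine_cont n (p q : R) : continuous (fun x => pospow n (p * x + q)).
Proof.
move=> x; apply: (@continuous_comp _ _ _ (fun x : R => p * x + q) (pospow n)).
  by apply: cvgD; [apply: cvgM; [exact: cvg_cst|exact: cvg_id]|exact: cvg_cst].
exact: pospow_cont.
Qed.

(** For [m > 0], a convex C^2 function that vanishes exactly on [[m, +oo)] and is
    affine on [(-oo, 0]]: its second derivative is a hat supported in [[0, m]]. All its
    tangents meet the vertical axis at or above zero, which is the sign needed at the
    moving end; a power of the positive part of [m - x] of degree above one does not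
    have this property for very negative [x]. *)
Definition hinge (m x : R) : R :=
  pospow 3 (-1 * x + m) - 2 * pospow 3 (-1 * x + m / 2) + pospow 3 (-1 * x + 0).
Definition hinge1 (m x : R) : R :=
  -1 * (3 * pospow 2 (-1 * x + m)) - 2 * (-1 * (3 * pospow 2 (-1 * x + m / 2)))
  + -1 * (3 * pospow 2 (-1 * x + 0)).
Definition hinge2 (m x : R) : R :=
  6 * (pospow 1 (-1 * x + m) - 2 * pospow 1 (-1 * x + m / 2) + pospow 1 (-1 * x + 0)).

Lemma is_derive_hinge (m x : R) : is_derive x (1 : R) (hinge m) (hinge1 m x).
Proof.
have h1 := is_derive_pospow_affine 1 (-1) m x.
have h2 := is_derive_pospow_affine 1 (-1) (m / 2) x.
have h3 := is_derive_pospow_affine 1 (-1) 0 x.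
exact: (is_deriveD (is_deriveB h1 (is_deriveZ 2 h2)) h3).
Qed.

Lemma is_derive_hinge1 (m x : R) : is_derive x (1 : R) (hinge1 m) (hinge2 m x).
Proof.
have h1 := is_derive_pospow_affine 0 (-1) m x.
have h2 := is_derive_pospow_affine 0 (-1) (m / 2) x.
have h3 := is_derive_pospow_affine 0 (-1) 0 x.
have h := is_deriveD (is_deriveB (is_deriveZ (-3) h1) (is_deriveZ (-6) h2)) (is_deriveZ (-3) h3).
have E : hinge1 m = (fun y => -3 * pospow 2 (-1 * y + m) - -6 * pospow 2 (-1 * y + m / 2)
    + -3 * pospow 2 (-1 * y + 0)).
  by apply/funext => y; rewrite /hinge1; ring.
rewrite E; apply: (@is_derive_eq R R R _ x 1 _ _ h).
by rewrite /hinge2 /GRing.scale /=; ring.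
Qed.

Lemma hinge2_cont m : continuous (hinge2 m).
Proof.
move=> x; apply: cvgM; first exact: cvg_cst.
apply: cvgD; last exact: pospow_affine_cont.
apply: cvgB; first exact: pospow_affine_cont.
by apply: cvgM; [exact: cvg_cst|exact: pospow_affine_cont].
Qed.

Lemma hinge2_ge0 m x : 0 < m -> 0 <= hinge2 m x.
Proof.
move=> m0; rewrite /hinge2 /pospow !expr1.
set p := -1 * x + m; set q := -1 * x + m / 2; set r := -1 * x + 0.
have pq : p = q + m / 2 by rewrite /p /q; lra.
have qr : q = r + m / 2 by rewrite /q /r; lra.
by rewrite /Num.max /Order.max; case: (ltP p 0) => ?; case: (ltP q 0) => ?;
  case: (ltP r 0) => ?; lra.
Qed.

Lemma hinge_above m x : m <= x -> 0 < m -> hinge m x = 0 /\ hinge1 m x = 0.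
Proof.
by move=> mx m0; rewrite /hinge /hinge1 !pospow_le0; lra.
Qed.

Lemma hinge_below m x : x < m -> 0 < m ->
  [/\ 0 < hinge m x, hinge1 m x <= 0 & 0 <= hinge m x - x * hinge1 m x].
Proof.
move=> xm m0; set h := m / 2.
have mh : m = 2 * h by rewrite /h; field.
have h0 : 0 < h by rewrite /h divr_gt0.
have p3 : 0 < h ^+ 3 by rewrite exprn_gt0.
have ym : 0 <= -1 * x + m by lra.
have [hx|xh] := leP h x.
  have yh : -1 * x + m / 2 <= 0 by rewrite -/h; lra.
  have y0 : -1 * x + 0 <= 0 by lra.
  have E0 : hinge m x = (m - x) ^+ 3.
    by rewrite /hinge (pospow_gt0E _ ym) (pospow_le0 _ yh) (pospow_le0 _ y0); ring.
  have E1 : hinge1 m x = - (3 * (m - x) ^+ 2).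
    by rewrite /hinge1 (pospow_gt0E _ ym) (pospow_le0 _ yh) (pospow_le0 _ y0); ring.
  have y3 : 0 < (m - x) ^+ 3 by rewrite exprn_gt0 ?subr_gt0.
  have y2 : 0 <= x * (m - x) ^+ 2 by rewrite mulr_ge0 ?sqr_ge0//; lra.
  have y2' : 0 <= (m - x) ^+ 2 by rewrite sqr_ge0.
  by rewrite E0 E1; split; lra.
have yh : 0 <= -1 * x + m / 2 by rewrite -/h; lra.
have [x0|x0] := leP 0 x.
  have y0 : -1 * x + 0 <= 0 by lra.
  pose w := h - x.
  have w0 : 0 < w by rewrite subr_gt0.
  have wh : 0 <= h - w by rewrite /w; lra.
  have E0 : hinge m x = h ^+ 3 + 3 * (h ^+ 2 * w) + 3 * (w ^+ 2 * (h - w)) + 2 * w ^+ 3.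
    rewrite /hinge (pospow_gt0E _ ym) (pospow_gt0E _ yh) (pospow_le0 _ y0) -/h {1}mh /w.
    by ring.
  have E1 : hinge1 m x = - (3 * ((h - w) * (h + 3 * w) + 2 * w ^+ 2)).
    rewrite /hinge1 (pospow_gt0E _ ym) (pospow_gt0E _ yh) (pospow_le0 _ y0) -/h {1}mh /w.
    by ring.
  have q1 : 0 < h ^+ 2 * w by rewrite mulr_gt0// exprn_gt0.
  have q2 : 0 <= w ^+ 2 * (h - w) by rewrite mulr_ge0// sqr_ge0.
  have q3 : 0 < w ^+ 3 by rewrite exprn_gt0.
  have q4 : 0 <= (h - w) * (h + 3 * w) by rewrite mulr_ge0//; lra.
  have q5 : 0 <= w ^+ 2 by rewrite sqr_ge0.
  have q6 : 0 <= x * ((h - w) * (h + 3 * w) + 2 * w ^+ 2) by rewrite mulr_ge0//; lra.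
  by rewrite E0 E1; split; lra.
have y0 : 0 <= -1 * x + 0 by lra.
have E0 : hinge m x = 6 * (- x * h ^+ 2) + 6 * h ^+ 3.
  by rewrite /hinge (pospow_gt0E _ ym) (pospow_gt0E _ yh) (pospow_gt0E _ y0) -/h {1}mh; ring.
have E1 : hinge1 m x = - 6 * h ^+ 2.
  by rewrite /hinge1 (pospow_gt0E _ ym) (pospow_gt0E _ yh) (pospow_gt0E _ y0) -/h {1}mh; ring.
have p2 : 0 <= h ^+ 2 by rewrite sqr_ge0.
have q : 0 <= - x * h ^+ 2 by rewrite mulr_ge0//; lra.
rewrite E0 E1; split; [lra|lra|].
by have -> : 6 * (- x * h ^+ 2) + 6 * h ^+ 3 - x * (- 6 * h ^+ 2) = 6 * h ^+ 3; [ring|lra].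
Qed.

Lemma saturating_facts (r c : R) (f : R -> R) : cond_saturating r c f ->
  [/\ continuous f, {homo f : x y / x <= y}, forall x, 0 < x -> 0 < f x &
      forall x, 0 <= f x <= c].
Proof.
move=> [[df _ _ _] f0 [r0 c0] f'gt fc].
have cf : continuous f by move=> x; apply/differentiable_continuous/derivable1_diffP.
have inc : {in `[0, r] &, {homo f : x y / x < y}}.
  apply: gtr0_derive1_lt_cc; [by move=> x _; exact: df| |exact: continuous_subspaceT].
  by move=> x; rewrite in_itv /=; exact: f'gt.
pose cl (x : R) := Num.min (Num.max x 0) r.
have fcl x : f x = f (cl x).
  rewrite /cl; have [xr|rx] := leP (Num.max x 0) r.
    have [x0|x0] := leP x 0; last by [].
    by rewrite !f0.
  have : r <= x by move: rx; rewrite lt_max => /orP[/ltW//|]; lra.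
  by move=> /fc ->; rewrite fc.
have clin x : cl x \in `[0, r].
  rewrite in_itv /= /cl le_min le_max lexx orbT (ltW r0)/= ge_min lexx orbT//.
have clh x y : x <= y -> cl x <= cl y.
  move=> xy; rewrite /cl le_min ge_min; apply/andP; split; last by rewrite ge_min lexx orbT.
  by apply/orP; left; rewrite ge_max !le_max xy lexx /= orbT.
have hom : {homo f : x y / x <= y}.
  move=> x y /clh; rewrite (fcl x) (fcl y) le_eqVlt => /predU1P[->//|h].
  by apply: ltW; apply: inc.
split=> //.
- move=> x x0; rewrite -(f0 0)// (fcl 0) (fcl x).
  apply: inc => //; rewrite /cl max_r// max_l ?(ltW x0)//.
  by rewrite min_l ?(ltW r0)// lt_min x0.
- move=> x; apply/andP; split.
    by have := hom 0 (Num.max x 0); rewrite f0// le_max lexx orbT => /(_ isT) h; have [x0|x0] := leP x 0; [rewrite f0|move: h; rewrite max_l// ltW].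
  rewrite -(fc (Num.max x r)); first by apply: hom; rewrite le_max lexx.
  by rewrite le_max lexx orbT.
Qed.

Lemma oint_le0_eq0 (c d : R) (f : R -> R) : c < d -> {within `[c, d], continuous f} ->
  (forall x, c <= x <= d -> 0 <= f x) -> oint c d f <= 0 ->
  forall x, c <= x <= d -> f x = 0.
Proof.
move=> cd cf f0 I0 x hx; apply/eqP; rewrite eq_le f0// andbT leNgt; apply/negP => fx.
have e0 : 0 < f x / 2 by rewrite divr_gt0.
have [del del0 h] := compact_unif_continuous (segment_compact (a := c) (b := d)) cf e0.
have [cx xd] := andP hx.
pose p := Num.max c (x - del / 2); pose q := Num.min d (x + del / 2).
have pq : p < q by rewrite /q lt_min !gt_max cd; apply/andP; split; apply/andP; split=> //; lra.
have cp : c <= p by rewrite le_max lexx.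
have qd : q <= d by rewrite ge_min lexx.
have i1 := L1i_cont cf.
have : f x / 2 * (q - p) <= oint p q f.
  rewrite -oint_cst ?(ltW pq)//; apply: oint_le; [exact: L1i_cst|exact: L1iS i1|].
  move=> y; rewrite ge_max le_min => /andP[/andP[cy xy] /andP[yd yx]].
  have hy : `[c, d]%classic y by rewrite /= in_itv /= cy.
  have hx' : `[c, d]%classic x by rewrite /= in_itv.
  have : `|f x - f y| < f x / 2.
    apply: h => //; rewrite /ball /= ltr_norml; apply/andP; split; lra.
  by rewrite ltr_norml => /andP[_]; clear; lra.
have : 0 < f x / 2 * (q - p) by rewrite mulr_gt0// subr_gt0.
move=> h1 h2.
have sp : oint c d f = oint c p f + (oint p q f + oint q d f).
  rewrite (oint_split (m := p))// ?(le_trans (ltW pq))//.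
  by rewrite -(oint_split (m := q))// ?(ltW pq)//; apply: L1iS i1.
have o1 : 0 <= oint c p f.
  by apply: oint_ge0 => y /andP[cy yp]; apply: f0; rewrite cy (le_trans yp)// (le_trans (ltW pq)).
have o2 : 0 <= oint q d f.
  by apply: oint_ge0 => y /andP[qy yd]; apply: f0; rewrite yd (le_trans _ qy)// (le_trans cp (ltW pq)).
by clear -I0 sp o1 o2 h1 h2; lra.
Qed.

End truncations.

(** * Consequences for global solutions *)

Lemma is_derive_square (R : realType) (c x : R) :
  is_derive x (1:R) (fun x : R => (x - c) * (x - c)) (2 * (x - c)) /\
  is_derive x (1:R) (fun x : R => 2 * (x - c)) 2.
Proof.
have h : is_derive x (1:R) (fun x : R => x - c) 1.
  by have := is_deriveB (is_derive_id x (1:R)) (is_derive_cst c x (1:R)); rewrite subr0.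
split.
  apply: (@is_derive_eq R R R _ x 1 _ _ (is_deriveM h h)).
  by rewrite /GRing.scale /=; ring.
apply: (@is_derive_eq R R R _ x 1 _ _ (is_deriveZ 2 h)).
by rewrite /GRing.scale /= mulr1.
Qed.

Section global.
Context {R : realType}.
Local Notation mu := (@lebesgue_measure R).
Variables (a a0 H k blow bup binf : R) (b : R -> R) (r_beta k0 : R) (beta : R -> R)
  (r_varphi c0 : R) (varphi : R -> R) (s0 : R) (u0 : R -> R) (s : R -> R)
  (u : R * R -> R).
Hypothesis a_gt0 : 0 < a.
Hypothesis a0_gt0 : 0 < a0.
Hypothesis H_gt0 : 0 < H.
Hypothesis k_gt0 : 0 < k.
Hypothesis hb : cond_b blow bup binf b.
Hypothesis hbeta : cond_saturating r_beta k0 beta.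
Hypothesis hvarphi : cond_saturating r_varphi c0 varphi.
Hypothesis hc0 : c0 < blow * H^-1.
Hypothesis hs0 : a < s0 < r_varphi.
Hypothesis hu0_bounds : forall z, a <= z <= s0 -> varphi a <= u0 z <= bup * H^-1.
Hypothesis hsol : is_global_solution a a0 H k beta varphi b s0 u0 s u.

Let rate := dissipation_rate a a0 H k beta varphi b s u.
Let energy G t := oint a (s t) (fun z => G (u (t, z))).
Let us t := u (t, s t).
Let ua t := u (t, a).
Let m := bup * H^-1.

Let beta_cont : continuous beta. Proof. by have [] := saturating_facts hbeta. Qed.
Let beta_ge0 x : 0 <= beta x.
Proof. by have [_ _ _ h] := saturating_facts hbeta; have /andP[] := h x. Qed.
Let beta_incr : {homo beta : x y / x <= y}. Proof. by have [] := saturating_facts hbeta. Qed.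
Let beta_gt0 x : 0 < x -> 0 < beta x. Proof. by have [_ _ h _] := saturating_facts hbeta; exact: h. Qed.
Let beta_le0 x : x <= 0 -> beta x = 0. Proof. by have [_ h _ _ _] := hbeta; exact: h. Qed.
Let varphi_cont : continuous varphi. Proof. by have [] := saturating_facts hvarphi. Qed.
Let varphi_incr : {homo varphi : x y / x <= y}. Proof. by have [] := saturating_facts hvarphi. Qed.
Let varphi_a_gt0 : 0 < varphi a.
Proof. by have [_ _ h _] := saturating_facts hvarphi; exact: h. Qed.
Let varphi_le x : varphi x <= c0.
Proof. by have [_ _ _ h] := saturating_facts hvarphi; have /andP[] := h x. Qed.

Let b_bounds t : 0 < t -> blow <= b t <= bup.
Proof. by have [_ _ _ _ [_ [_ h]]] := hb; exact: h. Qed.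

Let bup_gt0 : 0 < bup. Proof. by have [_ _ _ _ [_ []]] := hb. Qed.
Let m_gt0 : 0 < m. Proof. by rewrite divr_gt0. Qed.

Let c0_lt_m : c0 < m.
Proof.
apply: lt_le_trans hc0 _; rewrite ler_pM2r ?invr_gt0//.
by have /andP[h1 h2] := b_bounds (@ltr01 R); exact: le_trans h1 h2.
Qed.

Let b_cont T : {within `[0, T], continuous b}.
Proof.
have [cb _ _ _ _] := hb; apply: continuous_subspaceW cb.
by move=> t; rewrite /= !in_itv /= => /andP[->].
Qed.

Let s_gt t : 0 <= t -> a < s t.
Proof.
move=> t0; have T0 : 0 < t + 1 by rewrite ltr_wpDl.
have [st [ut [uz [uzz sol]]]] := hsol T0.
by apply: (sol_s_gt sol); rewrite t0 lerDl ler01.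
Qed.

Let s_cont T : {within `[0, T], continuous s}.
Proof.
have T0 : 0 < `|T| + 1 by rewrite ltr_wpDl.
have [st [ut [uz [uzz sol]]]] := hsol T0.
apply: continuous_subspaceW (sol_s_cont sol); apply: subset_itvl; rewrite bnd_simp.
by apply: le_trans (ler_norm _) _; rewrite lerDl ler01.
Qed.

Let u_cont T : {within Qdom_closed a s T, continuous u}.
Proof.
have T0 : 0 < `|T| + 1 by rewrite ltr_wpDl.
have [st [ut [uz [uzz sol]]]] := hsol T0.
apply: continuous_subspaceW (sol_u_cont sol) => -[t z] [/= /andP[t0 tT] hz].
split=> //=; rewrite t0 (le_trans tT)//.
by apply: le_trans (ler_norm _) _; rewrite lerDl ler01.
Qed.

Let s_init : s 0 = s0.
Proof. by have [st [ut [uz [uzz sol]]]] := hsol ltr01; exact: (sol_init_s sol). Qed.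

Let u_init z : a <= z <= s0 -> u (0, z) = u0 z.
Proof. by have [st [ut [uz [uzz sol]]]] := hsol ltr01; by apply: (sol_init_u sol). Qed.

Let us_cont T : {within `[0, T], continuous us}.
Proof.
apply: trace_s_cont (@s_cont T) (@u_cont T) => t /andP[t0 _]; exact: s_gt.
Qed.

Let ua_cont T : {within `[0, T], continuous ua}.
Proof.
by apply: (trace_a_cont (s := s) _ (@u_cont T)) => t /andP[t0 _]; exact: s_gt.
Qed.

Let slice t : 0 <= t -> {within `[a, s t], continuous (fun z => u (t, z))}.
Proof.
by move=> t0; apply: (slice_cont (@u_cont t)) => //; rewrite t0 lexx.
Qed.

Let comp (c d : R) (F v : R -> R) : continuous F -> {within `[c, d], continuous v} ->
  {within `[c, d], continuous (fun x => F (v x))}.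
Proof.
move=> cF cv; apply: (within_continuous_comp (B := setT) cv) => //.
exact: continuous_subspaceT.
Qed.

Section convex.
Variables (G G1 G2 : R -> R) (gam : R).
Hypothesis G_der : forall x : R, is_derive x (1 : R) G (G1 x).
Hypothesis G1_der : forall x : R, is_derive x (1 : R) G1 (G2 x).
Hypothesis G2_cont : continuous G2.
Hypothesis G2_ge : forall x, gam <= G2 x.
Hypothesis gam_ge0 : 0 <= gam.

Let G_cont : continuous G.
Proof. by move=> x; apply/differentiable_continuous/derivable1_diffP; apply: ex_derive. Qed.

Let rate_L1 t1 t2 : 0 <= t1 -> L1i t1 t2 (rate G G1 gam).
Proof.
move=> t10; have T0 : 0 < `|t2| + 1 by rewrite ltr_wpDl.
have [st [ut [uz [uzz sol]]]] := hsol T0.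
have := dissipation_rate_cont beta_cont varphi_cont (@b_cont (`|t2| + 1)) sol G_der G1_der.
move=> h; apply: L1iS (L1i_cont (h gam)) => //.
by apply: le_trans (ler_norm _) _; rewrite lerDl ler01.
Qed.

Lemma energy_le (t1 t2 : R) (j : R -> R) : 0 <= t1 -> t1 <= t2 -> L1i t1 t2 j ->
  (forall t, t1 < t < t2 -> rate G G1 gam t <= j t) ->
  energy G t2 - energy G t1 <= oint t1 t2 j.
Proof.
move=> t10 t12 ij hj; have T0 : 0 < t2 + 1 by rewrite ltr_wpDl// (le_trans t10).
have [st [ut [uz [uzz sol]]]] := hsol T0.
apply: le_trans (energy_inequality T0 k_gt0 beta_cont varphi_cont (@b_cont (t2 + 1))
  sol G_der G1_der G2_cont G2_ge gam_ge0 t10 t12 _) _; first by rewrite lerDl.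
by apply: oint_le_interior => //; exact: rate_L1.
Qed.

(** A nonnegative energy that starts at zero and does not grow stays zero. *)
Lemma energy_zero : (forall x, 0 <= G x) -> (forall z, a <= z <= s0 -> G (u0 z) = 0) ->
  (forall t, 0 < t -> rate G G1 gam t <= 0) ->
  forall t z, 0 <= t -> a <= z <= s t -> G (u (t, z)) = 0.
Proof.
move=> G0 Gu0 hr t z t0.
have E0 : energy G 0 = 0.
  rewrite /energy s_init (eq_oint (g := fun=> 0)).
    have [/ltW as0 _] := andP hs0.
    by rewrite oint_cst// mul0r.
  by move=> x hx; rewrite u_init// Gu0.
apply: (@oint_le0_eq0 R a (s t) (fun z => G (u (t, z))) (s_gt t0) (comp G_cont (slice t0))).
  by move=> *; exact: G0.
have := @energy_le 0 t (fun=> 0) (lexx 0) t0 (L1i_cst 0 t 0).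
rewrite oint_cst// mul0r /= E0 subr0; apply.
by move=> t' /andP[t'0 _]; exact: hr.
Qed.

End convex.

(** Where [u] exceeds [bup / H] there is no influx at [a], and the boundary [s] moves
    outwards. *)
Lemma u_upper_bound t z : 0 <= t -> a <= z <= s t -> u (t, z) <= m.
Proof.
move=> t0 hz.
pose G (x : R) := pospow 3 (1 * x + - m).
pose G1 (x : R) := 1 * (3 * pospow 2 (1 * x + - m)).
pose G2 (x : R) := 1 * (3 * (1 * (2 * pospow 1 (1 * x + - m)))).
have GE x : x <= m -> G x = 0 /\ G1 x = 0.
  by move=> xm; rewrite /G /G1 !pospow_le0; lra.
suff : G (u (t, z)) = 0.
  rewrite leNgt => h; apply/negP => um; move: h; rewrite /G pospow_gt0E; last by lra.
  move=> /eqP; rewrite expf_eq0 /= => /eqP; lra.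
have dG x : is_derive x (1 : R) G (G1 x) by exact: is_derive_pospow_affine.
have dG1 x : is_derive x (1 : R) G1 (G2 x).
  rewrite /G1 /G2; have h := is_deriveZ 3 (is_derive_pospow_affine 0 1 (- m) x).
  have -> : (fun x => 1 * (3 * pospow 2 (1 * x + - m))) = (fun x => 3 * pospow 2 (1 * x + - m)).
    by apply/funext => y; rewrite mul1r.
  by apply: (@is_derive_eq R R R _ x 1 _ _ h); rewrite /GRing.scale /=; ring.
have cG2 : continuous G2.
  move=> x; rewrite /G2; do 4 (apply: cvgM; first exact: cvg_cst).
  exact: pospow_affine_cont.
have G2ge x : 0 <= G2 x by rewrite /G2 !mulr_ge0// pospow_ge0.
have G0 x : 0 <= G x by exact: pospow_ge0.
have Gu0 x : a <= x <= s0 -> G (u0 x) = 0.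
  by move=> /hu0_bounds/andP[_ h]; have [] := GE _ h.
have hr t' : 0 < t' -> rate G G1 0 t' <= 0; last first.
  exact: (energy_zero dG dG1 cG2 G2ge (lexx 0) G0 Gu0 hr t0 hz).
- move=> t'0; rewrite /rate /dissipation_rate -/(us t') -/(ua t') mulr0 mul0r subr0.
  have T2 : beta (b t' - H * ua t') * G1 (ua t') <= 0.
    have [h|h] := leP (ua t') m; first by rewrite (GE _ h).2 mulr0.
    rewrite beta_le0 ?mul0r// subr_le0.
    have /andP[_ bb] := b_bounds t'0; apply: le_trans bb _.
    by rewrite mulrC -ler_pdivrMr// ltW.
  suff T1 : a0 * (us t' - varphi (s t')) * (G (us t') - us t' * G1 (us t')) <= 0.
    by rewrite -[leRHS]addr0 lerD.
  have [h|h] := leP (us t') m; first by have [-> ->] := GE _ h; rewrite mulr0 subrr mulr0.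
  have vp : varphi (s t') < us t' by apply: le_lt_trans (varphi_le _) _; apply: lt_trans h.
  rewrite mulr_ge0_le0//; first by rewrite mulr_ge0 ?subr_ge0 ?ltW.
  have y0 : 0 <= 1 * us t' + - m by lra.
  rewrite /G /G1 !pospow_gt0E//.
  set y := 1 * _ + _; have -> : us t' = y + m by rewrite /y; ring.
  have -> : y ^+ 3 - (y + m) * (1 * (3 * y ^+ 2)) = - (y ^+ 2 * (2 * y + 3 * m)) by ring.
  by rewrite oppr_le0 mulr_ge0 ?sqr_ge0// addr_ge0// mulr_ge0// ltW.
Qed.

(** Where [us] is below [varphi a], it is below [varphi (s t)] and the boundary recedes,
    while the influx can only increase [u]. *)
Lemma u_lower_bound t z : 0 <= t -> a <= z <= s t -> varphi a <= u (t, z).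
Proof.
move=> t0 hz.
have va := varphi_a_gt0.
have G0 x : 0 <= hinge (varphi a) x.
  have [h|h] := leP (varphi a) x; first by rewrite (hinge_above h va).1.
  by have [/ltW] := hinge_below h va.
suff h : hinge (varphi a) (u (t, z)) = 0.
  rewrite leNgt; apply/negP => um.
  by have [] := hinge_below um va; rewrite h ltxx.
have dG x := is_derive_hinge (varphi a) x.
have dG1 x := is_derive_hinge1 (varphi a) x.
have G2ge x : 0 <= hinge2 (varphi a) x by exact: hinge2_ge0.
have Gu0 x : a <= x <= s0 -> hinge (varphi a) (u0 x) = 0.
  by move=> /hu0_bounds/andP[h _]; have [] := hinge_above h va.
have hr t' : 0 < t' -> rate (hinge (varphi a)) (hinge1 (varphi a)) 0 t' <= 0; last first.
  exact: (energy_zero dG dG1 (@hinge2_cont _ _) G2ge (lexx 0) G0 Gu0 hr t0 hz).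
- move=> t'0; rewrite /rate /dissipation_rate -/(us t') -/(ua t') mulr0 mul0r subr0.
  have T2 : beta (b t' - H * ua t') * hinge1 (varphi a) (ua t') <= 0.
    rewrite mulr_ge0_le0//.
    have [h|h] := leP (varphi a) (ua t'); first by rewrite (hinge_above h va).2.
    by have [] := hinge_below h va.
  suff T1 : a0 * (us t' - varphi (s t')) *
      (hinge (varphi a) (us t') - us t' * hinge1 (varphi a) (us t')) <= 0.
    by rewrite -[leRHS]addr0 lerD.
  have [h|h] := leP (varphi a) (us t').
    by have [-> ->] := hinge_above h va; rewrite mulr0 subrr mulr0.
  have [_ _ h3] := hinge_below h va.
  have vp : us t' <= varphi (s t').
    by apply: le_trans (ltW h) _; apply: varphi_incr; apply: ltW; apply: s_gt; exact: ltW.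
  by rewrite mulr_le0_ge0// mulr_ge0_le0 ?subr_le0// ltW.
Qed.

Let flux t := beta (b t - H * ua t).
Let flux_total t := oint 0 t flux.
Let mass t := oint a (s t) (fun z => u (t, z)).

Let flux_cont T : {within `[0, T], continuous flux}.
Proof.
apply: comp => //; move=> t; apply: cvgB; first exact: b_cont.
by apply: cvgM; [exact: cvg_cst|exact: ua_cont].
Qed.

Let flux_L1 t1 t2 : 0 <= t1 -> L1i t1 t2 flux.
Proof. by move=> t10; apply: L1iS (L1i_cont (@flux_cont t2)). Qed.

(** The two convex functions [x] and [-x] turn the energy inequality into the exact
    balance of mass. *)
Lemma mass_balance t1 t2 : 0 <= t1 -> t1 <= t2 ->
  mass t2 - mass t1 = oint t1 t2 flux.
Proof.
move=> t10 t12.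
have dI (x : R) : is_derive x (1:R) (fun x : R => x) 1 by exact: is_derive_id.
have dC (c x : R) : is_derive x (1:R) (fun=> c) 0 by exact: is_derive_cst.
have c0' : continuous (fun _ : R => 0 : R) by move=> x; exact: cvg_cst.
apply/eqP; rewrite eq_le; apply/andP; split.
  apply: (energy_le dI (dC 1) c0' (fun=> lexx 0) (lexx 0) t10 t12).
  - exact: flux_L1.
  - move=> t _; rewrite /rate /dissipation_rate -/(ua t) -/(flux t).
    by rewrite (_ : _ - _ = flux t)//; ring.
have iN : L1i t1 t2 (fun t => -1 * flux t) by apply: L1iZ; exact: flux_L1.
have eN t : 0 <= t -> energy (fun x => -1 * x) t = - mass t.
  by move=> t0; rewrite /energy ointZ ?mulN1r//; apply: L1i_cont; exact: slice.
have dN (x : R) : is_derive x (1:R) (fun x : R => -1 * x) (-1).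
  have := is_deriveZ (-1) (is_derive_id x (1:R)).
  by rewrite /GRing.scale /= mulr1.
have : - mass t2 - - mass t1 <= oint t1 t2 (fun t => -1 * flux t).
  rewrite -(eN _ (le_trans t10 t12)) -(eN _ t10).
  apply: (energy_le dN (dC (-1)) c0' (fun=> lexx 0) (lexx 0) t10 t12 iN).
  - move=> t _; rewrite /rate /dissipation_rate -/(ua t) -/(flux t).
    by rewrite (_ : _ - _ = -1 * flux t)//; ring.
rewrite ointZ; last exact: flux_L1.
by lra.
Qed.

Let mass_eq t : 0 <= t -> mass t = mass 0 + flux_total t.
Proof. by move=> t0; rewrite /flux_total -mass_balance//; ring. Qed.

Let mass_le t : 0 <= t -> mass t <= m * (s t - a).
Proof.
move=> t0; have as_ := ltW (s_gt t0).
rewrite -oint_cst//; apply: oint_le; [exact: L1i_cont (slice t0)|exact: L1i_cst|].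
by move=> z hz; exact: u_upper_bound.
Qed.

Let mass_ge t : 0 <= t -> varphi a * (s t - a) <= mass t.
Proof.
move=> t0; have as_ := ltW (s_gt t0).
rewrite -oint_cst//; apply: oint_le; [exact: L1i_cst|exact: L1i_cont (slice t0)|].
by move=> z hz; exact: u_lower_bound.
Qed.

Let flux_total_homo x y : x <= y -> flux_total x <= flux_total y.
Proof.
move=> xy; have f0 t1 t2 : 0 <= oint t1 t2 flux by apply: oint_ge0 => t _; exact: beta_ge0.
have [x0|x0] := leP 0 x.
  rewrite /flux_total (oint_split x0 xy); first by rewrite lerDl.
  exact: flux_L1.
rewrite {1}/flux_total /oint set_itv_ge; first by rewrite Rintegral_set0; exact: f0.
by rewrite bnd_simp -ltNge.
Qed.

(** Once the interface stays beyond [r_varphi], the only equilibrium concentration is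
    [c0], below the saturation level [blow / H]: the energy of [(x - c0)^2] forces
    [ua] close to [c0] in mean square, so influx has to go on forever. *)
Lemma flux_unbounded (t0 S B : R) : 0 <= t0 ->
  (forall t, t0 <= t -> r_varphi <= s t) -> (forall t, t0 <= t -> s t - a <= S) ->
  (forall t, t0 <= t -> flux_total t <= B) -> False.
Proof.
move=> t00 hs hS hB.
have S0 : 0 < S by apply: lt_le_trans (hS t0 (lexx _)); rewrite subr_gt0 s_gt.
have c00 : 0 < c0 by have [_ _ [_ ?] _ _] := hvarphi.
have va := varphi_a_gt0.
(* If [|ua - c0| <= e] then [b - H ua >= blow - H c0 - H e = H e], so the flux is at
   least [del]; otherwise [Lam (ua - c0)^2 >= del]. *)
pose e := (blow * H^-1 - c0) / 2.
have e0 : 0 < e by rewrite divr_gt0// subr_gt0.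
pose del := beta (H * e).
have del0 : 0 < del by apply: beta_gt0; rewrite mulr_gt0.
pose Lam := del / e ^+ 2.
have Lam0 : 0 < Lam by rewrite divr_gt0// exprn_gt0.
pose kap := Num.min (a0 * c0) (2 * k / S) / 2.
have kap0 : 0 < kap.
  by rewrite divr_gt0// lt_min; apply/andP; split; [rewrite mulr_gt0|rewrite divr_gt0// mulr_gt0].
pose C := 2 * m + kap / Lam.
have low t : 0 < t -> del <= flux t + Lam * (ua t - c0) ^+ 2.
  move=> tp; have [h|h] := leP `|ua t - c0| e.
    have : 0 <= Lam * (ua t - c0) ^+ 2 by rewrite mulr_ge0 ?sqr_ge0// ltW.
    have : del <= flux t; last lra.
    apply: beta_incr; have /andP[bl _] := b_bounds tp.
    move: h; rewrite ler_norml => /andP[_ h].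
    have h' : H * (ua t - c0) <= H * e by rewrite ler_pM2l.
    have he : 2 * (H * e) = blow - H * c0 by rewrite /e; field; rewrite gt_eqF.
    by rewrite mulrBr in h'; lra.
  have : del <= Lam * (ua t - c0) ^+ 2.
    rewrite /Lam mulrAC ler_pdivlMr ?exprn_gt0// ler_pM2l//.
    by rewrite -[leRHS]real_normK ?num_real// lerXn2r ?nnegrE ?(ltW e0)// ltW.
  by have := beta_ge0 (b t - H * ua t); rewrite -/(flux t); lra.
have iq t1 t2 : 0 <= t1 -> L1i t1 t2 (fun t => C * flux t - kap / Lam * del).
  by move=> t10; apply: L1iB; [apply: L1iZ; exact: flux_L1|exact: L1i_cst].
have dG (x : R) := (is_derive_square c0 x).1.
have dG1 (x : R) := (is_derive_square c0 x).2.
have cG2 : continuous (fun _ : R => 2 : R) by move=> x; exact: cvg_cst.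
pose E t := energy (fun x => (x - c0) * (x - c0)) t.
have Ele t : t0 <= t -> E t - E t0 <= oint t0 t (fun t => C * flux t - kap / Lam * del).
  move=> t0t; apply: (energy_le dG dG1 cG2 (fun=> lexx 2) (ler0n _ 2) t00 t0t (iq _ _ t00)).
  move=> t' /andP[t1 t2]; have tp : 0 < t' by exact: le_lt_trans t1.
  have [_ _ _ _ phi_c] := hvarphi.
  rewrite /rate /dissipation_rate -/(us t') -/(ua t') -/(flux t') phi_c; last exact/hs/ltW.
  have as_ : a < s t' by apply: s_gt; exact: ltW.
  have usl : varphi a <= us t' by apply: u_lower_bound; rewrite ?lexx ?(ltW tp) ?(ltW as_).
  have uau : ua t' <= m by apply: u_upper_bound; rewrite ?lexx ?(ltW tp) ?(ltW as_).
  have lt' := low t' tp.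
  have f0 : 0 <= flux t' by exact: beta_ge0.
  set w := us t' - c0; set v := ua t' - c0.
  have -> : us t' - ua t' = w - v by rewrite /w /v; ring.
  have T1 : a0 * w * (w * w - us t' * (2 * w)) <= - (a0 * c0 * w ^+ 2).
    have -> : a0 * w * (w * w - us t' * (2 * w)) = - (a0 * c0 * w ^+ 2) - a0 * us t' * w ^+ 2.
      by rewrite /w; ring.
    rewrite gerBl; apply: mulr_ge0; last exact: sqr_ge0.
    by rewrite mulr_ge0 ?(ltW a0_gt0)// (le_trans (ltW va)).
  have T2 : flux t' * (2 * v) <= 2 * m * flux t'.
    rewrite mulrC ler_wpM2r// ler_pM2l// /v; lra.
  have T3 : 2 * k / S * (w - v) ^+ 2 <= k * 2 * ((w - v) ^+ 2 / (s t' - a)).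
    have inv : S^-1 <= (s t' - a)^-1 by rewrite lef_pV2 ?posrE ?subr_gt0//; exact/hS/ltW.
    have -> : 2 * k / S * (w - v) ^+ 2 = 2 * k * (w - v) ^+ 2 * S^-1 by ring.
    have -> : k * 2 * ((w - v) ^+ 2 / (s t' - a)) = 2 * k * (w - v) ^+ 2 * (s t' - a)^-1 by ring.
    by rewrite ler_wpM2l// mulr_ge0 ?sqr_ge0// mulr_ge0// ltW.
  have k1 : 2 * kap * w ^+ 2 <= a0 * c0 * w ^+ 2.
    by rewrite ler_wpM2r ?sqr_ge0// /kap mulrC divfK// ge_min lexx.
  have k2 : 2 * kap * (w - v) ^+ 2 <= 2 * k / S * (w - v) ^+ 2.
    by rewrite ler_wpM2r ?sqr_ge0// /kap mulrC divfK// ge_min lexx orbT.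
  have k3 : kap * v ^+ 2 <= 2 * kap * w ^+ 2 + 2 * kap * (w - v) ^+ 2.
    rewrite -subr_ge0.
    have -> : 2 * kap * w ^+ 2 + 2 * kap * (w - v) ^+ 2 - kap * v ^+ 2 = kap * (2 * w - v) ^+ 2 by ring.
    by rewrite mulr_ge0 ?sqr_ge0// ltW.
  have k4 : kap / Lam * del <= kap / Lam * flux t' + kap * v ^+ 2.
    have -> : kap / Lam * flux t' + kap * v ^+ 2 = kap / Lam * (flux t' + Lam * v ^+ 2).
      by field; rewrite gt_eqF.
    exact: (ler_wpM2l (ltW (divr_gt0 kap0 Lam0)) lt').
  have -> : C * flux t' = 2 * m * flux t' + kap / Lam * flux t' by rewrite /C mulrDl.
  move: T1 T2 T3 k1 k2 k3 k4.
  set X1 := a0 * w * _; set X2 := flux t' * _; set X3 := k * 2 * _.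
  by lra.
have E0 t : 0 <= E t.
  by apply: oint_ge0 => z _; rewrite -expr2 sqr_ge0.
have C0 : 0 <= C.
  apply: addr_ge0; first exact: mulr_ge0 (ler0n _ 2) (ltW m_gt0).
  exact: divr_ge0 (ltW kap0) (ltW Lam0).
pose D := kap / Lam * del.
have D0 : 0 < D by rewrite mulr_gt0// divr_gt0.
have FT0 : 0 <= flux_total t0 by apply: oint_ge0 => t _; exact: beta_ge0.
have bound t : t0 <= t -> D * (t - t0) <= E t0 + C * B.
  move=> t0t; have := Ele t t0t.
  rewrite ointB; [|apply: L1iZ; exact: flux_L1|exact: L1i_cst].
  rewrite ointZ; last exact: flux_L1.
  rewrite oint_cst// -/D.
  have fE : oint t0 t flux = flux_total t - flux_total t0.
    rewrite /flux_total (oint_split t00 t0t); first by ring.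
    exact: flux_L1.
  have h1 : C * oint t0 t flux <= C * B.
    rewrite ler_wpM2l// fE; have := hB t t0t; lra.
  have := E0 t; lra.
pose t := t0 + (E t0 + C * B) / D + 1.
have EB : 0 <= E t0 + C * B.
  have := bound t0 (lexx _); rewrite subrr mulr0//.
have t0t : t0 <= t by rewrite /t -addrA lerDl addr_ge0// divr_ge0// ltW.
have := bound t t0t.
have -> : t - t0 = (E t0 + C * B) / D + 1 by rewrite /t; ring.
by rewrite mulrDr mulrC divfK ?gt_eqF// mulr1; lra.
Qed.

Let total_cvgy : ~ (exists B, forall t, 0 <= t -> flux_total t <= B) ->
  flux_total t @[t --> +oo] --> +oo.
Proof.
move=> nB; apply/cvgryPge => A.
have [t [t0 At]] : exists t, 0 <= t /\ A < flux_total t.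
  apply: contrapT => h; apply: nB; exists A => t t0.
  by rewrite leNgt; apply/negP => At; apply: h; exists t.
near=> x; apply: le_trans (ltW At) _; apply: flux_total_homo.
by near: x; apply: nbhs_pinfty_ge; exact: num_real.
Unshelve. all: by end_near. Qed.

(** A limit mass above [m * (r_varphi - a)] would push [s] beyond [r_varphi] for good, by
    the upper bound on [u]; [flux_unbounded] excludes this. *)
Lemma dichotomy :
  (flux_total t @[t --> +oo] --> +oo /\ s t @[t --> +oo] --> +oo) \/
  exists2 l : R, flux_total t @[t --> +oo] --> l &
    mass 0 + l <= m * (r_varphi - a) /\
    forall t, 0 <= t -> s t <= a + (mass 0 + l) / varphi a.
Proof.
have va := varphi_a_gt0.
have [[B hB]|nB] := pselect (exists B, forall t, 0 <= t -> flux_total t <= B); last first.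
  left; have cI := total_cvgy nB; split => //.
  apply/cvgryPge => A; move/cvgryPge : cI => /(_ (m * (A - a) - mass 0)) cI.
  near=> t.
  have t0 : 0 <= t by near: t; apply: nbhs_pinfty_ge; exact: num_real.
  have h1 : m * (A - a) - mass 0 <= flux_total t by near: t; exact: cI.
  have := mass_le t0; rewrite mass_eq// => h2.
  have : m * (A - a) <= m * (s t - a) by lra.
  by rewrite ler_pM2l// lerD2r.
right; have hu : has_ubound (range flux_total).
  exists B => _ [t _ <-]; have [t0|t0] := leP 0 t; first exact: hB.
  by apply: le_trans (flux_total_homo (ltW t0)) _; exact: hB.
pose l := sup (range flux_total).
have ll t : flux_total t <= l by apply: sup_ubound => //; exists t.
have sb t : 0 <= t -> s t <= a + (mass 0 + l) / varphi a.
  move=> t0; rewrite -lerBlDl ler_pdivlMr// mulrC.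
  by apply: le_trans (mass_ge t0) _; rewrite mass_eq// lerD2l.
exists l; first exact: nondecreasing_cvgr.
split=> //; rewrite leNgt; apply/negP => big.
have [t0 [t00 hl]] : exists t0, 0 <= t0 /\ m * (r_varphi - a) - mass 0 < flux_total t0.
  have : m * (r_varphi - a) - mass 0 < l by rewrite ltrBlDl.
  move=> /(sup_gt (ex_intro _ _ (ex_intro2 _ _ 0 I erefl)))[_ [t _ <-] ht].
  have [t0|t0] := leP 0 t; first by exists t.
  by exists 0; split=> //; apply: lt_le_trans ht _; apply: flux_total_homo; exact: ltW.
apply: (@flux_unbounded t0 ((mass 0 + l) / varphi a) l t00).
- move=> t t0t; have tp := le_trans t00 t0t.
  have h1 := flux_total_homo t0t; have := mass_le tp; rewrite mass_eq// => h2.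
  have : m * (r_varphi - a) <= m * (s t - a) by lra.
  by rewrite ler_pM2l// lerD2r.
- by move=> t t0t; rewrite lerBlDl; apply: sb; exact: le_trans t0t.
- by move=> t _.
Unshelve. all: by end_near. Qed.

Lemma initial_mass : mass 0 = \int[mu]_(z in `]a, s0[) `|u0 z| /\
  mass 0 <= m * (s0 - a).
Proof.
have [as0 _] := andP hs0; split; last by rewrite -s_init; exact: mass_le.
have i0 : L1i a s0 (fun z => u (0, z)) by rewrite -s_init; exact: L1i_cont (slice (lexx 0)).
have sub : `]a, s0[ `<=` `[a, s0] by exact: subset_itv_oo_cc.
rewrite /mass s_init /oint -Rintegral_itv_obnd_cbnd; last first.
  by apply: L1S i0 => //; exact: subset_itv_oc_cc.
rewrite -Rintegral_itv_bndo_bndc; last by apply: L1S i0.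
apply: eq_Rintegral => z /set_mem /sub; rewrite /= in_itv /= => hz.
rewrite u_init// ger0_norm//; have /andP[h _] := hu0_bounds hz.
by apply: le_trans h; exact: ltW.
Qed.

End global.

Theorem theorem6p2 (R : realType) (a a0 H k : R)
    (blow bup binf : R) (b : R -> R)
    (r_beta k0 : R) (beta : R -> R)
    (r_varphi c0 : R) (varphi : R -> R)
    (s0 : R) (u0 : R -> R) (s : R -> R) (u : R * R -> R)
    (a_gt0 : 0 < a) (a0_gt0 : 0 < a0) (H_gt0 : 0 < H) (k_gt0 : 0 < k)
    (hb : cond_b blow bup binf b)
    (hbeta : cond_saturating r_beta k0 beta)
    (hvarphi : cond_saturating r_varphi c0 varphi)
    (hc0 : c0 < Num.min (2 * varphi a) (blow * H^-1))
    (hs0 : a < s0 < r_varphi)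
    (hu0 : in_H1_itv a s0 u0)
    (hu0_bounds : forall z, a <= z <= s0 -> varphi a <= u0 z <= bup * H^-1)
    (hsol : is_global_solution a a0 H k beta varphi b s0 u0 s u) :
  let r_star : R := a + H * bup^-1 * \int[leb1 R]_(z in `]a, s0[) `|u0 z| in
  let I : R -> R := fun t =>
    \int[leb1 R]_(tau in `[0, t]) beta (b tau - H * u (tau, a)) in
  (I t @[t --> +oo] --> +oo /\ s t @[t --> +oo] --> +oo)
  \/
  ((exists2 l : R, I t @[t --> +oo] --> l & l <= bup / H * (r_varphi - r_star))
   /\
   (limf_esup (EFin \o s) +oo%R <=
     (a + (varphi a)^-1 * (bup / H) * (s0 - a + r_varphi - r_star))%:E)%E).
Proof.
move=> r_star I.
have hc0' : c0 < blow * H^-1 by move: hc0; rewrite lt_min => /andP[].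
have [_ _ _ _ [_ [bup_gt0 _]]] := hb.
have m_gt0 : 0 < bup / H by rewrite divr_gt0.
have va : 0 < varphi a by have [_ _ h _] := saturating_facts hvarphi; exact: h.
have [M0E M0le] := initial_mass a_gt0 a0_gt0 H_gt0 k_gt0 hb hbeta hvarphi hc0' hs0 hu0_bounds hsol.
have rE : bup / H * (r_varphi - r_star) =
    bup / H * (r_varphi - a) - \int[leb1 R]_(z in `]a, s0[) `|u0 z|.
  by rewrite /r_star; field; rewrite !gt_eqF.
have [[h1 h2]|[l hl [h1 h2]]] := dichotomy a_gt0 a0_gt0 H_gt0 k_gt0 hb hbeta hvarphi hc0' hs0 hu0_bounds hsol.
  by left.
right; rewrite M0E in M0le h1 h2; split.
  by exists l; [exact: hl|rewrite rE; lra].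
apply: (@le_trans _ _ (ereal_sup ((EFin \o s) @` [set t | 0 <= t]))).
  apply: ereal_inf_lbound; exists [set t | 0 <= t] => //.
  by apply: nbhs_pinfty_ge; exact: num_real.
apply: ge_ereal_sup => _ [t t0 <-]; rewrite lee_fin.
apply: le_trans (h2 t t0) _; rewrite lerD2l mulrC -mulrA ler_pM2l ?invr_gt0//.
have -> : bup / H * (s0 - a + r_varphi - r_star) =
  bup / H * (s0 - a) + bup / H * (r_varphi - r_star) by ring.
by rewrite rE; lra.
Qed.
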